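(* Let $n$ be an odd prime. There is $q_0=q_0(n)$ such that for every power $q\ge q_0$ of $2$ the following holds. Let $\mathcal{T}$ be the set of $n$-th power-free polynomials $f\in\mathbb{F}_q[x]$. For $f\in\mathcal{T}$ let $\mathcal{C}_f$ be the smooth projective curve with affine model $y^n=f(x)$, let $\mathbf{m}(f)$ be the number of points of $\mathbb{P}^1(\overline{\mathbb{F}}_q)$ over which the map $\mathcal{C}_f\to\mathbb{P}^1$, $(x,y)\mapsto x$, is ramified, and let $g(f)=\frac{1}{2}(n-1)(\mathbf{m}(f)-2)$ be its genus. Let $N(X)=\#\{f\in\mathcal{T}: q^{g(f)}<X\}$ and $N_0(X)=\#\{f\in\mathcal{T}: \mathcal{C}_f \text{ ordinary},\ q^{g(f)}<X\}$. Then $$\lim_{X\to\infty}\frac{N_0(X)}{N(X)}=0.$$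
   Context: A curve over a field of characteristic $2$ is ordinary if the $2$-rank of its Jacobian equals its genus, equivalently its $a$-number is $0$. Writing $f=c\prod_{i=1}^{n-1}f_i^i$ with $f_i$ monic squarefree pairwise coprime, the cover $\mathcal{C}_f\to\mathbb{P}^1$ is ramified exactly at the roots of $f$ and, when $\sum_i i\deg f_i\not\equiv0\pmod n$, also at $\infty$. *)

(* Defs.v *)
From HB Require Import structures.
From mathcomp Require Import all_boot all_order all_algebra all_field.
From mathcomp Require Import finmap.
From mathcomp Require Import all_classical all_reals all_analysis.

Set Implicit Arguments.
Unset Strict Implicit.
Unset Printing Implicit Defensive.

Import Order.TTheory GRing.Theory Num.Theory.
Import numFieldNormedType.Exports.

Local Open Scope classical_set_scope.
Local Open Scope card_scope.
Local Open Scope ring_scope.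

(* A smooth projective curve over an algebraically closed field k is handled   *)
(* through its function field L: the closed points are the places of L / k,    *)
(* and the k-points of the Jacobian are the divisor classes of degree 0. Here  *)
(* c : k -> L is the inclusion of the constants.                               *)
Section Curve.
Variables (k : closedFieldType) (L : fieldType) (c : k -> L).

(* The value at 0, morally +oo, is set to 0 so that a place has exactly one    *)
(* representing function.                                                      *)
Definition is_place (v : L -> int) : Prop :=
  [/\ v 0 = 0,
      forall x y : L, x != 0 -> y != 0 -> v (x * y) = v x + v y,
      forall x y : L, x != 0 -> y != 0 -> x + y != 0 ->
        Num.min (v x) (v y) <= v (x + y),
      forall a : k, v (c a) = 0
    & exists2 t : L, t != 0 & v t = 1].

Record place := Place { ord_at :> L -> int; _ : is_place ord_at }.

HB.instance Definition _ := gen_eqMixin place.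
HB.instance Definition _ := gen_choiceMixin place.

Definition is_divisor (D : place -> int) : Prop :=
  finite_set [set P | D P != 0].

(* As k is algebraically closed, every place has degree 1. *)
Definition divisor_degree (D : place -> int) : int :=
  \sum_(P \in [set: place]) D P.

Definition principal (D : place -> int) : Prop :=
  exists2 h : L, h != 0 & forall P, D P = ord_at P h.

Definition lin_equiv (D E : place -> int) : Prop :=
  principal (fun P => D P - E P).

Definition divisor_class (D : place -> int) : set (place -> int) :=
  [set E | is_divisor E /\ lin_equiv D E].

Definition jacobian_torsion (m : nat) : set (set (place -> int)) :=
  [set divisor_class D | D in
     [set D | [/\ is_divisor D, divisor_degree D = 0
                & principal (fun P => D P *+ m)]]].

(* J[2](k) is an elementary abelian 2-group, so it is (Z/2)^r precisely when   *)
(* it has 2 ^ r elements.                                                      *)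
Definition has_two_rank (r : nat) : Prop :=
  jacobian_torsion 2 #= `I_(2 ^ r)%N.

End Curve.

Section Superelliptic.
Variables (k : closedFieldType) (n : nat) (f : {poly k}).

Definition superelliptic_poly : {poly {fraction {poly k}}} :=
  'X^n - (tofrac f)%:P.

Section FunctionField.
Variable irr : monic_irreducible_poly superelliptic_poly.

(* k(x)[y] / (y^n - f(x)) *)
Definition function_field : fieldType := {poly %/ superelliptic_poly with irr}.

Definition of_ratfun (r : {fraction {poly k}}) : function_field :=
  qfpoly_const irr r.

Definition of_const (a : k) : function_field := of_ratfun (tofrac a%:P).

(* Uniformizer of P^1 at a point; P^1(k) is option k, with None = infinity. *)
Definition uniformizer (P : option k) : {fraction {poly k}} :=
  if P is Some a then tofrac ('X - a%:P) else (tofrac 'X)^-1.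

(* A place v with v (of_ratfun (uniformizer P)) > 0 lies above P, and this     *)
(* value is then its ramification index.                                       *)
Definition ramified_over_in (P : option k) : Prop :=
  exists v : place of_const, 1 < v (of_ratfun (uniformizer P)).

End FunctionField.

(* If f is an n-th power in k[x] (for n prime and f n-th power-free: if f is   *)
(* constant), then y^n - f is reducible: the cover is n disjoint copies of     *)
(* P^1, unramified, with genus given by the formula below equal to 1 - n < 0,  *)
(* hence not a 2-rank.                                                         *)
Definition ramified_over (P : option k) : Prop :=
  exists irr : monic_irreducible_poly superelliptic_poly,
    ramified_over_in irr P.

Definition ramified_points : nat := #|` fset_set [set P | ramified_over P] |%N.

(* The division by 2 is exact for n odd. *)
Definition genus : int :=
  (((n%:Z - 1) * (ramified_points%:Z - 2)) %/ 2)%Z.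

Definition ordinary_curve : Prop :=
  exists (irr : monic_irreducible_poly superelliptic_poly) (r : nat),
    has_two_rank (@of_const irr) r /\ r%:Z = genus.

End Superelliptic.

Definition power_free (F : fieldType) (n : nat) (f : {poly F}) : Prop :=
  forall g : {poly F}, g ^+ n %| f -> size g = 1%N.

Section Counting.
Variables (F : finFieldType) (Fbar : closedFieldType).
Variables (iota : {rmorphism F -> Fbar}) (R : realType) (n : nat).

Definition curves_below (X : R) : set {poly F} :=
  [set f | power_free n f /\
           (#|F|%:R : R) ^ genus n (map_poly iota f) < X].

Definition ordinary_curves_below (X : R) : set {poly F} :=
  [set f | curves_below X f /\ ordinary_curve n (map_poly iota f)].

(* These sets are finite; fset_set would send an infinite set to the empty one. *)
Definition N_all (X : R) : nat := #|` fset_set (curves_below X)|%N.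

Definition N_ordinary (X : R) : nat :=
  #|` fset_set (ordinary_curves_below X)|%N.

End Counting.

(* Main.v *)
(** Over the algebraic closure [k] of [F], let [L] be the function field of
    [y^n = f(x)]. As [x] is not a square, [L = L^2 + x L^2], and the derivation
    [D = d/dx] maps [A^2 + x B^2] to [B^2]. A 2-torsion class of the Jacobian,
    represented by a divisor [E] with [2 E = div h], is determined by the
    logarithmic form [dh / h]: if [dg / g = dh / h] then [g / h] is a square.
    This form is holomorphic, because the divisor of [h] is even and the
    ramification indices are odd, and it solves [D w = w^2].
    The forms holomorphic at all the places above [P^1] are written down
    explicitly in the basis [y^l]; their space has dimension at most the genus.
    Hence on an ordinary curve the solutions of [D w = w^2] span it, so that [D]
    is given on it by an invertible matrix. Since [D] maps the component of index
    [2 j] to squares of elements of the component of index [j], these components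
    have the same dimension. For [j = 1] this is the relation
    [sum_(2 i > n) d_i + floor (s / n) = floor (2 s / n)], where [s = sum i d_i],
    between the degrees [d_i] of the factors [f_i].
    Given [d_2, ..., d_(n-2)] and [sum d_i], the relation leaves at most [n]
    values for [d_(n-1)]: the tuples of degrees with sum at most [M] which satisfy
    it are fewer by a factor [M]. On the other hand, for [q > 2 (n-1)^2], at least
    half of the tuples of monic polynomials of given degrees are squarefree and
    pairwise coprime, so that all tuples of degrees contribute to [N(X)] and the
    density is [O(1 / M)], where [M] tends to infinity with [X]. *)

Require Import Defs.
From HB Require Import structures.
From mathcomp Require Import all_boot all_order all_algebra all_field.
From mathcomp Require Import fingroup perm.
From mathcomp Require Import finmap.
From mathcomp Require Import all_classical all_reals all_analysis.
From mathcomp Require Import zify ring.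

Set Implicit Arguments.
Unset Strict Implicit.
Unset Printing Implicit Defensive.

Import Order.TTheory GRing.Theory Num.Theory.
Import numFieldNormedType.Exports.

Local Open Scope classical_set_scope.
Local Open Scope ring_scope.

(** * Valuations *)

(** Neither Riemann-Roch nor a description of all places of [L] enters: one-sided bounds suffice
    because they meet. The genus is given by the number of ramified points, which is bounded below
    by exhibiting a place of index [n] over each root of [f], and over infinity if [n] does not
    divide [deg f]. The forms are bounded above by means of enough places over each point, all built
    from weight filtrations of [K[y]]. The dimensions of indices [j] and [n - j] add up to that
    lower bound minus 2, so the forms have total dimension at most [r], while [2^r] distinct
    solutions of [D w = w^2] need dimension at least [r]. Indices 1 and 2 are compared because the
    ceiling of [i / n] is always 1, whereas that of [2 i / n] detects [2 i > n]. The constant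
    [2 (n-1)^2] comes from the [(n-1)^2] pairs of factors in which a repeated prime can sit: the bad
    tuples form a proportion at most [(n-1)^2 / (q-1)], which has to be at most one half. The number
    of ramified points is the sum of the degrees [d_i] up to the point at infinity; this uncertainty
    costs only a bounded power of [q]. *)

Definition vge (L : fieldType) (v : L -> int) (m : int) (t : L) : bool :=
  (t == 0) || (m <= v t).

Section Valuation.
Variables (k : closedFieldType) (L : fieldType) (c : k -> L) (v : L -> int).
Hypothesis hv : is_place c v.

Lemma val0 : v 0 = 0. Proof. by case: hv. Qed.

Lemma valM x y : x != 0 -> y != 0 -> v (x * y) = v x + v y.
Proof. by case: hv => _ + _ _ _; apply. Qed.

Lemma valC a : v (c a) = 0. Proof. by case: hv. Qed.

Lemma val1 : v 1 = 0.
Proof. by have := @valM 1 1 (oner_neq0 _) (oner_neq0 _); rewrite mulr1; lia. Qed.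

Lemma valV x : v x^-1 = - v x.
Proof.
have [->|x0] := eqVneq x 0; first by rewrite invr0 val0 oppr0.
have := @valM x x^-1 x0; rewrite invr_eq0 x0 divff // val1 => /(_ isT).
by lia.
Qed.

Lemma val_div x y : x != 0 -> y != 0 -> v (x / y) = v x - v y.
Proof. by move=> x0 y0; rewrite valM ?invr_eq0 // valV. Qed.

Lemma valN x : v (- x) = v x.
Proof.
have [->|x0] := eqVneq x 0; first by rewrite oppr0.
have N0 : (-1 : L) != 0 by rewrite oppr_eq0 oner_neq0.
have := @valM (-1) (-1) N0 N0; rewrite mulrNN mulr1 val1 => h.
by rewrite -mulN1r valM //; lia.
Qed.

Lemma valX x m : x != 0 -> v (x ^+ m) = m%:Z * v x.
Proof.
move=> x0; elim: m => [|m IH]; first by rewrite expr0 val1 mul0r.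
by rewrite exprS valM ?expf_neq0 // IH intS mulrDl mul1r.
Qed.

Lemma vgeE m x : x != 0 -> vge v m x = (m <= v x).
Proof. by rewrite /vge => /negbTE ->. Qed.

(** A place takes the value 0 at 0, where +oo is meant; [vge] restores the usual convention, so that
    ultrametric estimates survive cancellation to 0. *)
Lemma vge0 m : vge v m 0. Proof. by rewrite /vge eqxx. Qed.

Lemma vge_val x : vge v (v x) x. Proof. by rewrite /vge lexx orbT. Qed.

Lemma vgeC a : vge v 0 (c a). Proof. by rewrite /vge valC lexx orbT. Qed.

Lemma vge1 : vge v 0 1. Proof. by rewrite /vge val1 lexx orbT. Qed.

Lemma vgeW m m' x : m <= m' -> vge v m' x -> vge v m x.
Proof. by rewrite /vge => mm /orP[->//|/(le_trans mm) ->]; rewrite orbT. Qed.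

Lemma vgeN m x : vge v m (- x) = vge v m x.
Proof. by rewrite /vge oppr_eq0 valN. Qed.

Lemma vgeD m x y : vge v m x -> vge v m y -> vge v m (x + y).
Proof.
have [->|x0] := eqVneq x 0; first by rewrite add0r.
have [->|y0] := eqVneq y 0; first by rewrite addr0.
have [->|xy0] := eqVneq (x + y) 0; first by rewrite vge0.
rewrite !vgeE // => mx my; case: hv => _ _ /(_ x y x0 y0 xy0) + _ _.
by apply: le_trans; rewrite le_min mx.
Qed.

Lemma vgeB m x y : vge v m x -> vge v m y -> vge v m (x - y).
Proof. by move=> hx hy; rewrite vgeD ?vgeN. Qed.

Lemma vgeM m m' x y : vge v m x -> vge v m' y -> vge v (m + m') (x * y).
Proof.
have [->|x0] := eqVneq x 0; first by rewrite mul0r !vge0.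
have [->|y0] := eqVneq y 0; first by rewrite mulr0 !vge0.
by rewrite !vgeE ?mulf_neq0 // valM // => *; apply: lerD.
Qed.

Lemma vgeMl m x y : vge v 0 x -> vge v m y -> vge v m (x * y).
Proof. by move=> hx hy; rewrite -[m]add0r vgeM. Qed.

Lemma vgeX m x l : vge v m x -> vge v (l%:Z * m) (x ^+ l).
Proof.
move=> hx; elim: l => [|l IH]; first by rewrite expr0 mul0r vge1.
by rewrite exprS intS mulrDl mul1r vgeM.
Qed.

Lemma vge_sum m (I : Type) (r : seq I) (P : pred I) F :
  (forall i, P i -> vge v m (F i)) -> vge v m (\sum_(i <- r | P i) F i).
Proof. by move=> h; elim/big_ind: _ => //; [exact: vge0 | exact: vgeD]. Qed.

Lemma val_dominant x y : x != 0 -> vge v (v x + 1) y ->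
  x + y != 0 /\ v (x + y) = v x.
Proof.
move=> x0 hy.
have xy0 : x + y != 0.
  apply: contraTneq hy => /eqP; rewrite addrC addr_eq0 => /eqP ->.
  by rewrite vgeN vgeE //; lia.
split=> //; apply/eqP; rewrite eq_le; apply/andP; split; last first.
  rewrite -vgeE // vgeD ?vge_val //; apply: vgeW hy; lia.
rewrite leNgt; apply/negP => lt.
have : vge v (v x + 1) (x + y - y) by rewrite vgeB // vgeE //; lia.
by rewrite addrK vgeE //; lia.
Qed.

Lemma vge_mull m x y : x != 0 -> vge v m (x * y) = vge v (m - v x) y.
Proof.
move=> x0; have [->|y0] := eqVneq y 0; first by rewrite mulr0 !vge0.
by rewrite !vgeE ?mulf_neq0 // valM // lerBlDl.
Qed.

Lemma exists_val m : exists2 z : L, z != 0 & v z = m.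
Proof.
case: hv => _ _ _ _ [z z0 vz].
have [m0|m0] := leP 0 m.
  by exists (z ^+ `|m|%N); rewrite ?expf_neq0 // valX // vz; lia.
exists (z^-1 ^+ `|m|%N); rewrite ?expf_neq0 ?invr_eq0 //.
by rewrite valX ?invr_eq0 // valV vz; lia.
Qed.

End Valuation.

(** * Discrete valuations obtained from filtrations *)

Section Filtration.
Variables (k : closedFieldType) (L : fieldType) (c : k -> L).
Variable (G : int -> L -> Prop).
Hypothesis c0 : c 0 = 0.
Hypothesis G0 : forall m, G m 0.
Hypothesis GS : forall m t, G (m + 1) t -> G m t.
Hypothesis GD : forall m s t, G m s -> G m t -> G m (s + t).
Hypothesis GM : forall m m' s t, G m s -> G m' t -> G (m + m') (s * t).
Hypothesis Gprime : forall m m' s t, G m s -> G m' t ->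
  G (m + m' + 1) (s * t) -> G (m + 1) s \/ G (m' + 1) t.
Hypothesis Gex : forall t, exists m, G m t.
Hypothesis Gsep : forall t, t != 0 -> exists m, ~ G m t.
Hypothesis Gc : forall a, a != 0 -> G 0 (c a) /\ ~ G 1 (c a).
Hypothesis Gunif : exists2 t, t != 0 & G 1 t /\ ~ G 2 t.

Lemma filtrationW m m' t : m <= m' -> G m' t -> G m t.
Proof.
move=> mm; have -> : m' = m + `|m' - m|%N%:Z by lia.
elim: `|_|%N => [|j IH]; first by rewrite addr0.
by move=> h; apply: IH; apply: GS; rewrite -addrA [j%:Z + 1]addrC -intS.
Qed.

Lemma filtration_jump t : t != 0 -> exists m, G m t /\ ~ G (m + 1) t.
Proof.
move=> /Gsep[m1 n1]; have [m0 g0] := Gex t.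
have lt : m0 <= m1.
  by rewrite leNgt; apply/negP => /ltW le; apply: n1; apply: filtrationW g0.
have [j e] : exists j : nat, m1 = m0 + j%:Z by exists `|m1 - m0|%N; lia.
elim: j m0 e g0 {lt} => [|j IH] m0 e g0; first by case: n1; rewrite e addr0.
have [g|] := pselect (G (m0 + 1) t); last by exists m0; split.
by apply: (IH (m0 + 1)) => //; rewrite e intS addrA.
Qed.

Definition filtration_val (t : L) : int :=
  if t == 0 then 0 else xget 0 [set m | G m t /\ ~ G (m + 1) t].

Lemma filtration_valP t : t != 0 ->
  G (filtration_val t) t /\ ~ G (filtration_val t + 1) t.
Proof.
move=> t0; rewrite /filtration_val (negbTE t0).
case: xgetP => [m _ //|h]; have [m hm] := filtration_jump t0.
by case: (h m).
Qed.

Lemma le_filtration_val t m : t != 0 -> m <= filtration_val t <-> G m t.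
Proof.
move=> /filtration_valP[g n]; split=> [le|gm]; first exact: filtrationW g.
rewrite leNgt; apply/negP => lt; apply: n; apply: filtrationW gm; lia.
Qed.

Lemma filtration_valE t m : t != 0 -> G m t -> ~ G (m + 1) t ->
  filtration_val t = m.
Proof.
move=> t0 /(le_filtration_val _ t0) h1 h2; apply/eqP; rewrite eq_le h1 andbT.
by rewrite leNgt; apply/negP => lt; apply/h2/(le_filtration_val _ t0); lia.
Qed.

(** [G m] stands for the elements of value at least [m]. Values add up under products because of
    [Gprime]: the associated graded ring is a domain, so a product lies no deeper than its factors
    predict. *)
Lemma filtration_is_place : is_place c filtration_val.
Proof.
split.
- by rewrite /filtration_val eqxx.
- move=> x y x0 y0; have [gx nx] := filtration_valP x0.
  have [gy ny] := filtration_valP y0.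
  apply: filtration_valE; [by rewrite mulf_neq0 | exact: GM |].
  by case/(Gprime gx gy).
- move=> x y x0 y0 xy0; apply/(le_filtration_val _ xy0).
  by apply: GD; apply/le_filtration_val => //; rewrite ge_min lexx ?orbT.
- move=> a; have [->|a0] := eqVneq a 0; first by rewrite c0 /filtration_val eqxx.
  have [g1 g2] := Gc a0; apply: filtration_valE => //.
  by apply: contra_notN g2 => /eqP ->.
- have [t t0 [g1 g2]] := Gunif; exists t => //; exact: filtration_valE.
Qed.

Lemma vge_filtration_val m t :
  vge filtration_val m t <-> G m t.
Proof.
rewrite /vge; have [->|t0] := eqVneq t 0; first by split.
exact: le_filtration_val.
Qed.

End Filtration.

(** * Places of a Kummer extension *)

Section Kummer.
Variables (k : closedFieldType) (K L : fieldType).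
Variables (c : {rmorphism k -> K}) (iota : {rmorphism K -> L}).
Variables (v : K -> int) (n : nat) (f : K) (y : L).
Hypothesis hv : is_place c v.
Hypothesis n_gt0 : (0 < n)%N.
Hypothesis f_neq0 : f != 0.
Hypothesis yn : y ^+ n = iota f.
Hypothesis gen : forall t : L, exists T : {poly K}, t = (map_poly iota T).[y].
Hypothesis uniq_coord : forall T : {poly K},
  (size T <= n)%N -> (map_poly iota T).[y] = 0 -> T = 0.

Implicit Types T S : {poly K}.

Definition evy (T : {poly K}) : L := (map_poly iota T).[y].

Lemma evyD T S : evy (T + S) = evy T + evy S.
Proof. by rewrite /evy rmorphD hornerD. Qed.

Lemma evyN T : evy (- T) = - evy T.
Proof. by rewrite /evy rmorphN hornerN. Qed.

Lemma evyM T S : evy (T * S) = evy T * evy S.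
Proof. by rewrite /evy rmorphM hornerM. Qed.

Lemma evyC a : evy a%:P = iota a.
Proof. by rewrite /evy map_polyC hornerC. Qed.

Lemma evyZ a T : evy (a *: T) = iota a * evy T.
Proof. by rewrite -mul_polyC evyM evyC. Qed.

Lemma evyXn l : evy 'X^l = y ^+ l.
Proof. by rewrite /evy map_polyXn hornerXn. Qed.

Lemma evy_sum I (r : seq I) (P : pred I) (F : I -> {poly K}) :
  evy (\sum_(i <- r | P i) F i) = \sum_(i <- r | P i) evy (F i).
Proof. by rewrite /evy rmorph_sum horner_sum. Qed.

(** The remainder of [T] modulo [X^n - f], written monomial by monomial so that weights can be
    followed through the reduction. *)
Definition foldy (T : {poly K}) : {poly K} :=
  \sum_(l < size T) (T`_l * f ^+ (l %/ n)) *: 'X^(l %% n).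

Lemma evy_fold T : evy (foldy T) = evy T.
Proof.
rewrite /foldy evy_sum -[in RHS](coefK T) poly_def evy_sum.
apply: eq_bigr => l _; rewrite !evyZ !evyXn rmorphM rmorphXn -yn -exprM -mulrA.
by rewrite -exprD mulnC -divn_eq.
Qed.

Lemma size_fold T : (size (foldy T) <= n)%N.
Proof.
apply: leq_trans (size_sum _ _ _) _; apply/bigmax_leqP => l _.
apply: leq_trans (size_scale_leq _ _) _.
by rewrite size_polyXn ltn_pmod.
Qed.

Lemma evy_inj T S : (size T <= n)%N -> (size S <= n)%N -> evy T = evy S -> T = S.
Proof.
move=> hT hS e; apply/eqP; rewrite -subr_eq0; apply/eqP/uniq_coord.
  by rewrite (leq_trans (size_polyD _ _)) // geq_max hT size_polyN.
by rewrite -/(evy _) evyD evyN e subrr.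
Qed.

Lemma evy_neq0 T : (size T <= n)%N -> T != 0 -> evy T != 0.
Proof. by move=> hT; apply: contra => /eqP /(uniq_coord hT) ->. Qed.

Lemma fold_mono z l : z != 0 ->
  foldy (z *: 'X^l) = (z * f ^+ (l %/ n)) *: 'X^(l %% n).
Proof.
move=> z0; apply: evy_inj; rewrite ?size_fold //.
  by rewrite (leq_trans (size_scale_leq _ _)) // size_polyXn ltn_pmod.
rewrite evy_fold !evyZ !evyXn rmorphM rmorphXn -yn -exprM -mulrA.
by rewrite -exprD mulnC -divn_eq.
Qed.

Lemma coord t : exists2 T : {poly K}, (size T <= n)%N & t = evy T.
Proof. by have [T ->] := gen t; exists (foldy T); rewrite ?size_fold ?evy_fold. Qed.

(** * Weight filtrations on polynomials in [y] *)

Section Gauss.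
Variables (e i : int).
Hypothesis e_gt0 : 0 < e.
Hypothesis ef : e * v f = i * n%:Z.

Definition gw (m : int) (a : K) : bool := (a == 0) || (m <= e * v a).

Lemma gwE m a : a != 0 -> gw m a = (m <= e * v a).
Proof. by rewrite /gw => /negbTE ->. Qed.

Lemma gw0 m : gw m 0. Proof. by rewrite /gw eqxx. Qed.

Lemma gwW m m' a : m <= m' -> gw m' a -> gw m a.
Proof. by rewrite /gw => mm /orP[->//|/(le_trans mm) ->]; rewrite orbT. Qed.

Lemma gwN m a : gw m (- a) = gw m a.
Proof. by rewrite /gw oppr_eq0 (valN hv). Qed.

Lemma gwD m a b : gw m a -> gw m b -> gw m (a + b).
Proof.
have [->|a0] := eqVneq a 0; first by rewrite add0r.
have [->|b0] := eqVneq b 0; first by rewrite addr0.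
have [->|ab0] := eqVneq (a + b) 0; first by rewrite gw0.
rewrite !gwE // => ma mb; case: hv => _ _ /(_ a b a0 b0 ab0) + _ _.
rewrite ge_min => /orP[] h; [apply: le_trans ma _ | apply: le_trans mb _];
  by rewrite ler_pM2l.
Qed.

Lemma gwM m m' a b : gw m a -> gw m' b -> gw (m + m') (a * b).
Proof.
have [->|a0] := eqVneq a 0; first by rewrite mul0r !gw0.
have [->|b0] := eqVneq b 0; first by rewrite mulr0 !gw0.
by rewrite !gwE ?mulf_neq0 // (valM hv) // mulrDr => *; apply: lerD.
Qed.

(** A scalar [a] has weight [e * v a] and [y] has weight [i]; by [ef], [y^n] and [f] have equal
    weights, so that reduction modulo [y^n = f] respects the filtration. It is used with [e = n],
    [i = v f] at ramified points and with [e = 1], [i = 0] where [f] is a unit. *)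
Definition gauss (m : int) (T : {poly K}) : Prop :=
  forall l : nat, gw (m - i * l%:Z) T`_l.

Lemma gauss0 m : gauss m 0. Proof. by move=> l; rewrite coef0 gw0. Qed.

Lemma gaussW m m' T : m <= m' -> gauss m' T -> gauss m T.
Proof. by move=> mm h l; apply: gwW (h l); rewrite lerD2r. Qed.

Lemma gaussD m T S : gauss m T -> gauss m S -> gauss m (T + S).
Proof. by move=> hT hS l; rewrite coefD gwD. Qed.

Lemma gaussN m T : gauss m T -> gauss m (- T).
Proof. by move=> hT l; rewrite coefN gwN. Qed.

Lemma gauss_sum m I (r : seq I) (P : pred I) (F : I -> {poly K}) :
  (forall j, P j -> gauss m (F j)) -> gauss m (\sum_(j <- r | P j) F j).
Proof. by move=> h; elim/big_ind: _ => //; [exact: gauss0 | exact: gaussD]. Qed.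

Lemma gaussM m m' T S : gauss m T -> gauss m' S -> gauss (m + m') (T * S).
Proof.
move=> hT hS l; rewrite coefM; elim/big_ind: _ => [|a b|j _].
- exact: gw0.
- exact: gwD.
- have -> : m + m' - i * l%:Z = (m - i * j%:Z) + (m' - i * (l - j)%N%:Z).
    by rewrite -subzn ?leq_ord //; ring.
  exact: gwM.
Qed.

Lemma gauss_mono m z l : z != 0 ->
  gauss m (z *: 'X^l) <-> m <= e * v z + i * l%:Z.
Proof.
move=> z0; split=> [/(_ l)|h j].
  by rewrite coefZ coefXn eqxx mulr1 gwE // lerBlDr.
rewrite coefZ coefXn; case: eqP => [->|_]; last by rewrite mulr0 !gw0.
by rewrite mulr1 gwE // lerBlDr.
Qed.

Lemma gauss_fold m T : gauss m T -> gauss m (foldy T).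
Proof.
move=> hT; apply: gauss_sum => l _.
have [->|Tl] := eqVneq T`_l 0; first by rewrite mul0r scale0r; exact: gauss0.
apply/gauss_mono; first by rewrite mulf_neq0 ?expf_neq0.
have := hT l; rewrite gwE // (valM hv) ?expf_neq0 // (valX hv) //.
have -> : (l : nat)%:Z = (l %/ n)%N%:Z * n%:Z + (l %% n)%N%:Z.
  by rewrite {1}(divn_eq l n) PoszD PoszM.
have -> : e * (v T`_l + (l %/ n)%N%:Z * v f)
        = e * v T`_l + (l %/ n)%N%:Z * (e * v f) by ring.
rewrite ef lerBlDr => /le_trans; apply; rewrite le_eqVlt; apply/orP; left.
by apply/eqP; ring.
Qed.

Lemma gauss_ex T : exists m, gauss m T.
Proof.
exists (- \sum_(l < size T) `|e * v T`_l + i * (l : nat)%:Z|) => l.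
have [->|Tl] := eqVneq T`_l 0; first exact: gw0.
rewrite gwE //.
have hl : (l < size T)%N by rewrite ltnNge; apply: contra Tl => ?; rewrite nth_default.
rewrite (bigD1 (Ordinal hl)) //= lerBlDr.
rewrite opprD -[leRHS]addr0 lerD //; first by rewrite lerNl -normrN ler_norm.
by rewrite oppr_le0 sumr_ge0.
Qed.

Definition gaussL (m : int) (t : L) : Prop := exists2 T : {poly K}, gauss m T & t = evy T.

(** An element of [L] has many representatives, but folding any of them keeps its weight and
    produces the reduced one: the weight can be read there. *)
Lemma gaussL_evy m T : (size T <= n)%N -> gaussL m (evy T) <-> gauss m T.
Proof.
move=> hT; split=> [[S gS e']|]; last by exists T.
have -> : T = foldy S by apply: evy_inj; rewrite ?size_fold ?evy_fold.
exact: gauss_fold.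
Qed.

Lemma gaussLW m m' t : m <= m' -> gaussL m' t -> gaussL m t.
Proof. by move=> mm [T gT ->]; exists T => //; exact: gaussW gT. Qed.

Lemma gaussL0 m : gaussL m 0.
Proof. by exists 0; [exact: gauss0 | rewrite /evy rmorph0 horner0]. Qed.

Lemma gaussLD m s t : gaussL m s -> gaussL m t -> gaussL m (s + t).
Proof.
by move=> [S gS ->] [T gT ->]; exists (S + T); rewrite ?evyD //; exact: gaussD.
Qed.

Lemma gaussLN m t : gaussL m t -> gaussL m (- t).
Proof. by move=> [T gT ->]; exists (- T); rewrite ?evyN //; exact: gaussN. Qed.

Lemma gaussLM m m' s t : gaussL m s -> gaussL m' t -> gaussL (m + m') (s * t).
Proof.
by move=> [S gS ->] [T gT ->]; exists (S * T); rewrite ?evyM //; exact: gaussM.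
Qed.

Lemma gaussL_ex t : exists m, gaussL m t.
Proof. by have [T ->] := gen t; have [m h] := gauss_ex T; exists m, T. Qed.

Lemma gaussL_sep t : t != 0 -> exists m, ~ gaussL m t.
Proof.
have [T hT ->] := coord t => t0.
have T0 : T != 0 by apply: contraNneq t0 => ->; rewrite /evy rmorph0 horner0.
pose l := (size T).-1; have Tl : T`_l != 0 by rewrite -/(lead_coef T) lead_coef_eq0.
exists (e * v T`_l + i * l%:Z + 1) => /(gaussL_evy _ hT)/(_ l).
by rewrite gwE //; lia.
Qed.

Lemma gaussL_mono m z l : z != 0 ->
  gaussL m (evy (z *: 'X^l)) <-> m <= e * v z + i * l%:Z.
Proof.
move=> z0; split=> [|h]; last by exists (z *: 'X^l) => //; apply/gauss_mono.
rewrite -evy_fold => /(gaussL_evy _ (size_fold _)).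
rewrite fold_mono // => /gauss_mono.
rewrite mulf_neq0 ?expf_neq0 // => /(_ isT).
rewrite (valM hv) ?expf_neq0 // (valX hv) //.
have -> : l%:Z = (l %/ n)%N%:Z * n%:Z + (l %% n)%N%:Z.
  by rewrite {1}(divn_eq l n) PoszD PoszM.
have -> : e * (v z + (l %/ n)%N%:Z * v f)
        = e * v z + (l %/ n)%N%:Z * (e * v f) by ring.
rewrite ef => /le_trans; apply; rewrite le_eqVlt; apply/orP; left.
by apply/eqP; ring.
Qed.

Lemma gaussL_iota m z : z != 0 -> gaussL m (iota z) <-> m <= e * v z.
Proof.
by move=> z0; rewrite -evyC -[z%:P]mulr1 mul_polyC (gaussL_mono _ 0) // mulr0 addr0.
Qed.

End Gauss.

(** * Points where [n] does not divide the order of [f] *)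

Section Ramified.
Hypothesis n_prime : prime n.
Hypothesis n_ndvd : ~~ (n%:Z %| v f)%Z.

Let i := v f.
Let e := n%:Z.
Let e_gt0 : 0 < e. Proof. by rewrite /e ltz_nat. Qed.
Let ef : e * v f = i * n%:Z. Proof. by rewrite mulrC. Qed.
Local Notation gauss := (gauss e i).
Local Notation gaussL := (gaussL e i).

(* Since [n] does not divide [i = v f], the weights of the monomials           *)
(* [z y^l], [l < n], are pairwise distinct: only one of them can be minimal.   *)
Lemma gauss_lead m T : (size T <= n)%N -> gauss m T -> ~ gauss (m + 1) T ->
  exists l, [/\ T`_l != 0, e * v T`_l + i * l%:Z = m
              & gauss (m + 1) (T - T`_l *: 'X^l)].
Proof.
move=> hT gT /existsNP[l /negP]; rewrite negb_or -ltNge => /andP[Tl lt].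
have := gT l; rewrite (gwE) // => le.
have el : e * v T`_l + i * l%:Z = m.
  by move: le lt; move: (e * _) (i * _) => A B; lia.
exists l; split=> // j; rewrite coefB coefZ coefXn.
have [->|jl] := eqVneq j l; first by rewrite mulr1 subrr gw0.
rewrite mulr0 subr0; have [->|Tj] := eqVneq T`_j 0; first exact: gw0.
have := gT j; rewrite !(gwE) // => lej.
suff : e * v T`_j + i * j%:Z != m.
  by move: lej; move: (e * _) (i * _) => A B; lia.
apply/negP => /eqP; rewrite -el => /(congr1 (fun z => z - e * v T`_j - i * l%:Z)).
have -> : e * v T`_l + i * l%:Z - e * v T`_j - i * l%:Z
        = (v T`_l - v T`_j) * e by ring.
have -> : e * v T`_j + i * j%:Z - e * v T`_j - i * l%:Z
        = i * (j%:Z - l%:Z) by ring.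
move=> h; have : (n%:Z %| i * (j%:Z - l%:Z))%Z by rewrite h dvdz_mull.
have hsz q : T`_q != 0 -> (q < n)%N.
  move=> Tq; apply: leq_trans hT; rewrite ltnNge.
  by apply: contra Tq => ?; rewrite nth_default.
have := hsz _ Tj; have := hsz _ Tl.
rewrite !dvdzE abszM Euclid_dvdM //= => ln jn /orP[].
  by move=> ?; case/negP: n_ndvd; rewrite dvdzE.
by move=> /dvdn_leq; move/eqP: jl; lia.
Qed.

(** If both factors have exact weights [m] and [m'], the product of their leading monomials differs
    from [s * t] by terms of weight at least [m + m' + 1]. Being a monomial, it has exact weight
    [m + m'] by [gaussL_mono], a contradiction. *)
Lemma gaussL_prime m m' s t : gaussL m s -> gaussL m' t ->
  gaussL (m + m' + 1) (s * t) -> gaussL (m + 1) s \/ gaussL (m' + 1) t.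
Proof.
have [S hS ->] := coord s; have [T hT ->] := coord t.
move=> /(gaussL_evy e_gt0 ef _ hS) gS /(gaussL_evy e_gt0 ef _ hT) gT gST.
have [h|nS] := pselect (gauss (m + 1) S); first by left; exists S.
have [h|nT] := pselect (gauss (m' + 1) T); first by right; exists T.
have [a [Sa ea gS']] := gauss_lead hS gS nS.
have [b [Tb eb gT']] := gauss_lead hT gT nT.
have : gaussL (m + m' + 1) (evy ((S`_a * T`_b) *: 'X^(a + b))).
  have -> : (S`_a * T`_b) *: 'X^(a + b) =
     S * T - (S - S`_a *: 'X^a) * T - S`_a *: 'X^a * (T - T`_b *: 'X^b).
    by rewrite exprD -!mul_polyC polyCM; ring.
  rewrite !evyD !evyN evyM; apply: (gaussLD e_gt0); last first.
    apply: gaussLN; exists (S`_a *: 'X^a * (T - T`_b *: 'X^b)) => //.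
    by rewrite -addrA; apply: (gaussM e_gt0) => //; apply/gauss_mono => //; rewrite ea.
  apply: (gaussLD e_gt0) => //.
  apply: gaussLN; exists ((S - S`_a *: 'X^a) * T) => //.
  by rewrite addrAC; apply: (gaussM e_gt0).
have Sab : S`_a * T`_b != 0 by rewrite mulf_neq0.
move/(gaussL_mono e_gt0 ef _ _ Sab); rewrite (valM hv) // PoszD !mulrDr.
by lia.
Qed.

(** As [w] is read off the weight filtration itself, a lower bound on the value of [evy T] bounds
    every coefficient of [T] separately. *)
Lemma ramified_place : exists w : L -> int,
  [/\ is_place (fun a => iota (c a)) w,
      forall z, z != 0 -> w (iota z) = n%:Z * v z
    & forall m T, (size T <= n)%N -> vge w m (evy T) ->
        forall l, T`_l != 0 -> m <= n%:Z * v T`_l + v f * l%:Z].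
Proof.
pose w := filtration_val gaussL.
have GS m t : gaussL (m + 1) t -> gaussL m t by apply: gaussLW; lia.
have Gsep t : t != 0 -> exists m, ~ gaussL m t by exact: gaussL_sep.
have Gex t : exists m, gaussL m t by exact: gaussL_ex.
exists w; split.
- apply: (filtration_is_place (G := gaussL)) => //.
  + by rewrite !rmorph0.
  + by move=> m; exact: gaussL0.
  + exact: gaussLD.
  + exact: gaussLM.
  + exact: gaussL_prime.
  + move=> a a0; have ca0 : c a != 0 by rewrite fmorph_eq0.
    have h m := gaussL_iota e_gt0 ef m ca0; rewrite (valC hv) mulr0 in h.
    by split; [apply/h | move/h].
  (* A uniformizer is sought among the monomials [z * y^l]: by Bezout one of them has weight 1. *)
  + have [u uP] : exists u : int * nat, e * u.1 + i * u.2%:Z = 1.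
      have cop : coprimez e i.
        by rewrite coprimezE /= prime_coprime //; move: n_ndvd; rewrite dvdzE.
      have [a [b]] := Bezoutz e i; rewrite (eqP cop) => ab.
      (* shift b by a multiple of n to make it nonnegative *)
      exists (a - i * (absz b)%:Z, absz (b + e * (absz b)%:Z)) => /=.
      have b0 : 0 <= b + e * (absz b)%:Z by have := e_gt0; nia.
      by rewrite (gez0_abs b0) -[RHS]ab; ring.
    have [z z0 vz] := exists_val hv u.1.
    exists (evy (z *: 'X^(u.2))).
      rewrite evyZ evyXn mulf_neq0 ?fmorph_eq0 // expf_neq0 //.
      apply: contraNneq f_neq0 => y0; rewrite -(fmorph_eq0 iota) -yn y0.
      by rewrite expr0n; case: (n) n_gt0.
    have h m := gaussL_mono e_gt0 ef m u.2 z0; rewrite vz uP in h.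
    by split; [apply/h | move/h].
- move=> z z0; apply: filtration_valE => //; rewrite ?fmorph_eq0 //.
    by apply/gaussL_iota.
  by move/(iffLR (gaussL_iota e_gt0 ef _ z0)); rewrite /e; lia.
- move=> m T hT /vge_filtration_val.
  move=> /(_ (gaussL0 _ _) GS Gex Gsep)/(gaussL_evy e_gt0 ef _ hT) h l Tl.
  by have := h l; rewrite gwE //; rewrite -/i -/e; lia.
Qed.

End Ramified.

(** * Points where [f] is a unit *)

Section Unramified.
Hypothesis vf : v f = 0.
Hypothesis nk : n%:R != 0 :> k.
Hypothesis residue : forall a, vge v 0 a -> exists r : k, vge v 1 (a - c r).

Local Notation gauss := (gauss 1 0).
Local Notation gaussL := (gaussL 1 0).
Let e_gt0 : 0 < 1 :> int. Proof. by []. Qed.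
Let ef : 1 * v f = 0 * n%:Z. Proof. by rewrite vf mulr0 mul0r. Qed.

Lemma gauss_vge m T : gauss m T <-> forall l : nat, vge v m T`_l.
Proof. by split=> h l; have := h l; rewrite /gw /vge mul0r subr0 mul1r. Qed.

Lemma gaussL_shift m a t : a != 0 -> gaussL m t -> gaussL (v a + m) (iota a * t).
Proof.
move=> a0; apply: (gaussLM e_gt0).
by apply/(gaussL_iota e_gt0 ef) => //; rewrite mul1r.
Qed.

Lemma vge_horner m T a : vge v 0 a -> gauss m T -> vge v m T.[a].
Proof.
move=> ha /gauss_vge hT; rewrite horner_coef; apply: (vge_sum hv) => l _.
rewrite -[m]addr0; apply: (vgeM hv) => //.
by have := vgeX hv l ha; rewrite mulr0.
Qed.

Section OneRoot.
Variable b : k.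
Hypothesis hb : vge v 1 (f - c b ^+ n).

Let cb0 : vge v 0 (c b). Proof. exact: (vgeC hv). Qed.

Lemma root_neq0 : b != 0.
Proof.
apply: contraL hb => /eqP ->.
by rewrite rmorph0 expr0n; case: (n) n_gt0 => //= *; rewrite subr0 vgeE // vf.
Qed.

(** This is [(X^n - b^n) / (X - b)]. Over the residue field it vanishes at the other [n]-th roots of
    the residue of [f] but not at [b], since [n] is invertible. Inverting its value at [y] therefore
    isolates the place where [y] reduces to [b]. *)
Definition cofactor : {poly K} := \sum_(j < n) (c b)%:P ^+ (n.-1 - j) * 'X^j.

Lemma cofactorE : cofactor * ('X - (c b)%:P) = 'X^n - (c b ^+ n)%:P.
Proof.
by rewrite -[LHS]opprK -mulrN opprB mulrC -subrXX opprB polyC_exp.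
Qed.

Lemma gauss_cofactor : gauss 0 cofactor.
Proof.
apply: (gauss_sum e_gt0) => j _; rewrite -polyC_exp mul_polyC.
have cb : c b != 0 by rewrite fmorph_eq0 root_neq0.
apply/gauss_mono; first exact: expf_neq0.
by rewrite (valX hv) // (valC hv) mulr0.
Qed.

Lemma horner_cofactor : cofactor.[c b] = c (n%:R * b ^+ n.-1).
Proof.
rewrite /cofactor horner_sum rmorphM rmorph_nat rmorphXn mulr_natl.
transitivity (\sum_(j < n) c b ^+ n.-1); last by rewrite sumr_const card_ord.
apply: eq_bigr => j _; rewrite hornerM -polyC_exp hornerC hornerXn -exprD subnK //.
by rewrite -ltnS prednK.
Qed.

Lemma val_cofactor : cofactor.[c b] != 0 /\ v cofactor.[c b] = 0.
Proof.
rewrite horner_cofactor (valC hv) fmorph_eq0 mulf_neq0 // expf_neq0 //.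
exact: root_neq0.
Qed.

Lemma gauss_div_XsubC T : gauss 0 T -> exists2 U : {poly K}, gauss 0 U
  & T = U * ('X - (c b)%:P) + T.[c b]%:P.
Proof.
elim/poly_ind: T => [_|T a IH].
  by exists 0; [exact: gauss0 | rewrite mul0r horner0 addr0].
move=> h; have hT : gauss 0 T.
  apply/gauss_vge => l; have /gauss_vge/(_ l.+1) := h.
  by rewrite coefD coefMX coefC addr0.
have [U hU eT] := IH hT; exists (U * 'X + T.[c b]%:P).
  apply/gauss_vge => l; rewrite coefD coefMX coefC.
  case: l => [|l] /=; rewrite ?add0r ?addr0; first exact: vge_horner.
    by move/gauss_vge: hU; apply.
by rewrite hornerMXaddC {1}eT polyCD polyCM; ring.
Qed.

(** Evaluation at [y = b] makes sense on residues: folding replaces [y^n] by [f], which is congruent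
    to [b^n]. *)
Lemma gauss_horner_fold T : gauss 0 T -> vge v 1 (T.[c b] - (foldy T).[c b]).
Proof.
move=> /gauss_vge hT; rewrite horner_coef /foldy horner_sum -sumrB.
apply: (vge_sum hv) => l _; rewrite hornerZ hornerXn {2}(divn_eq l n) exprD.
rewrite mulnC exprM -mulrA -mulrBr -mulrBl; apply: (vgeMl hv) => //.
rewrite mulrC; apply: (vgeMl hv); first by have := vgeX hv (l %% n)%N cb0; rewrite mulr0.
rewrite -(vgeN hv) opprB subrXX mulrC; apply: (vgeMl hv) => //.
apply: (vge_sum hv) => j _.
have h0 : vge v 0 f by rewrite vgeE // vf.
have h1 : vge v 0 (c b ^+ n) by have := vgeX hv n cb0; rewrite mulr0.
apply: (vgeMl hv).
  by have := vgeX hv ((l %/ n).-1 - j)%N h0; rewrite mulr0.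
by have := vgeX hv j h1; rewrite mulr0.
Qed.

Lemma gaussL_horner T : gauss 0 T -> gaussL 1 (evy T) -> vge v 1 T.[c b].
Proof.
move=> hT [S hS e].
have hS0 : gauss 0 S by apply: gaussW hS.
have eF : foldy T = foldy S.
  by apply: evy_inj; rewrite ?size_fold // !evy_fold.
have -> : T.[c b] = (T.[c b] - (foldy T).[c b])
    - (S.[c b] - (foldy S).[c b]) + S.[c b] by rewrite eF; ring.
apply: (vgeD hv); last exact: vge_horner.
by apply: (vgeB hv); exact: gauss_horner_fold.
Qed.

(** Up to a term of weight 1, [T] is a multiple of [X - b], and the cofactor times [X - b] takes at
    [y] the value [f - b^n], of weight at least 1. So whatever vanishes at [y = b] is, after
    localization, divisible by a uniformizer of [v]. *)
Lemma gaussL_cofactor T : gauss 0 T -> vge v 1 T.[c b] ->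
  gaussL 1 (evy (cofactor * T)).
Proof.
move=> hT Tb; have [U hU ->] := gauss_div_XsubC hT.
rewrite mulrDr [U * _]mulrC mulrA cofactorE evyD.
have h1 a : vge v 1 a -> gaussL 1 (evy a%:P).
  have [->|a0] := eqVneq a 0; first by rewrite evyC rmorph0 => _; exact: gaussL0.
  by rewrite vgeE // evyC => ?; apply/(gaussL_iota e_gt0 ef) => //; rewrite mul1r.
apply: (gaussLD e_gt0).
  have -> : evy (('X^n - (c b ^+ n)%:P) * U) = evy (f - c b ^+ n)%:P * evy U.
    by rewrite evyM evyD evyN evyXn yn !evyC rmorphB.
  rewrite -[X in gaussL X]addr0; apply: (gaussLM e_gt0); first exact: h1.
  by exists U.
rewrite evyM mulrC -[X in gaussL X]addr0; apply: (gaussLM e_gt0); first exact: h1.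
by exists cofactor => //; exact: gauss_cofactor.
Qed.

(* The localization of the Gauss filtration at the maximal ideal [(pi, y - b)]. *)
Definition locG (m : int) (t : L) : Prop :=
  exists N, gaussL m (evy cofactor ^+ N * t).

Lemma gaussL_cofactorX N : gaussL 0 (evy cofactor ^+ N).
Proof.
elim: N => [|N IH].
  by rewrite expr0 -(rmorph1 iota); apply/gaussL_iota; rewrite ?oner_neq0 // (val1 hv).
rewrite exprS -[X in gaussL X]addr0; apply: (gaussLM e_gt0) => //.
by exists cofactor => //; exact: gauss_cofactor.
Qed.

Lemma locG_add m t N N' : gaussL m (evy cofactor ^+ N * t) ->
  gaussL m (evy cofactor ^+ (N' + N) * t).
Proof.
by move=> h; rewrite exprD -mulrA -[X in gaussL X]add0r;
  apply: (gaussLM e_gt0) => //; exact: gaussL_cofactorX.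
Qed.

Lemma gaussL_locG m t : gaussL m t -> locG m t.
Proof. by exists 0%N; rewrite expr0 mul1r. Qed.

Lemma locG_M m m' s t : locG m s -> locG m' t -> locG (m + m') (s * t).
Proof.
by move=> [N h] [N' h']; exists (N + N')%N; rewrite exprD mulrACA; exact: gaussLM.
Qed.

Lemma locG_D m s t : locG m s -> locG m t -> locG m (s + t).
Proof.
move=> [N h] [N' h']; exists (N + N')%N; rewrite mulrDr; apply: (gaussLD e_gt0).
  by rewrite addnC; exact: locG_add.
exact: locG_add.
Qed.

Lemma evy_cofactorX N : evy cofactor ^+ N = evy (cofactor ^+ N).
Proof. by rewrite /evy rmorphXn horner_exp. Qed.

Lemma gauss_cofactorX N : gauss 0 (cofactor ^+ N).
Proof.
elim: N => [|N IH]; last first.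
  by rewrite exprS -[X in gauss X]addr0; apply: (gaussM e_gt0) => //; exact: gauss_cofactor.
apply/gauss_vge => l; rewrite expr0 coef1.
by case: eqP => _; [exact: vge1 hv | exact: vge0].
Qed.

Lemma locG_horner T : gauss 0 T -> locG 1 (evy T) -> vge v 1 T.[c b].
Proof.
move=> hT [N]; rewrite evy_cofactorX -evyM => h.
have [S0 S1] := val_cofactor.
have : vge v 1 (cofactor ^+ N * T).[c b].
  apply: gaussL_horner => //; rewrite -[X in gauss X]addr0.
  by apply: (gaussM e_gt0) => //; exact: gauss_cofactorX.
rewrite hornerM horner_exp (vge_mull hv) ?expf_neq0 //.
by rewrite (valX hv) // S1 mulr0 subr0.
Qed.

Lemma locG1 : ~ locG 1 1.
Proof.
have -> : 1 = evy 1%:P by rewrite evyC rmorph1.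
move/locG_horner; rewrite hornerC vgeE ?oner_neq0 // (val1 hv) => h.
by have := h (gauss_cofactorX 0).
Qed.

Lemma locG_iota m z : z != 0 -> locG m (iota z) <-> m <= v z.
Proof.
move=> z0; split=> [h|le]; last first.
  by apply: gaussL_locG; apply/(gaussL_iota e_gt0 ef) => //; rewrite mul1r.
rewrite leNgt; apply/negP => lt; apply: locG1.
have -> : 1 = iota z^-1 * iota z by rewrite -rmorphM mulVf // rmorph1.
have [N h'] := h; exists N; rewrite mulrCA.
apply: (@gaussLW 1 0 _ (v z^-1 + m)); first by rewrite (valV hv); lia.
by apply: gaussL_shift => //; rewrite invr_eq0.
Qed.

Lemma locG_sep t : t != 0 -> exists m, ~ locG m t.
Proof.
move=> t0; have [m h] := gaussL_ex 1 0 t^-1; exists (1 - m) => h'.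
by apply: locG1; rewrite -(divff t0) -(subrK m 1); apply: locG_M => //; apply: gaussL_locG.
Qed.

(** Scaling by elements of [K] and clearing cofactors turns both factors into polynomials of weight
    0. For these, lying in [locG 1] means that the value at [b] has zero residue, and values at [b]
    are multiplicative. *)
Lemma locG_prime m m' s t : locG m s -> locG m' t ->
  locG (m + m' + 1) (s * t) -> locG (m + 1) s \/ locG (m' + 1) t.
Proof.
have norm a u : locG a u -> exists z N T,
    [/\ z != 0, v z = - a, gauss 0 T & iota z * (evy cofactor ^+ N * u) = evy T].
  move=> [N h]; have [z z0 vz] := exists_val hv (- a).
  have := gaussL_shift z0 h; rewrite vz addNr => -[T hT e].
  by exists z, N, T.
have unnorm a u z N T : z != 0 -> v z = - a -> gauss 0 T ->
    iota z * (evy cofactor ^+ N * u) = evy T -> vge v 1 T.[c b] -> locG (a + 1) u.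
  move=> z0 vz hT e Tb; exists N.+1.
  have -> : evy cofactor ^+ N.+1 * u = iota z^-1 * evy (cofactor * T).
    by rewrite evyM -e fmorphV exprS; field; rewrite fmorph_eq0.
  have -> : a = v z^-1 by rewrite (valV hv) vz opprK.
  by apply: gaussL_shift; rewrite ?invr_eq0 //; exact: gaussL_cofactor.
move=> hs ht hst.
have [z [N [S [z0 vz hS eS]]]] := norm _ _ hs.
have [z' [N' [T [z'0 vz' hT eT]]]] := norm _ _ ht.
have : vge v 1 (S * T).[c b].
  apply: locG_horner.
    by rewrite -[X in gauss X]addr0; apply: (gaussM e_gt0).
  have -> : evy (S * T) = iota (z * z') * evy cofactor ^+ (N + N') * (s * t).
    by rewrite evyM -eS -eT rmorphM exprD; ring.
  rewrite -[X in locG X](_ : (- m - m') + 0 + (m + m' + 1) = 1); last by lia.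
  apply: locG_M => //; apply: locG_M; last exact/gaussL_locG/gaussL_cofactorX.
  by apply/locG_iota; rewrite ?mulf_neq0 // (valM hv) // vz vz'.
rewrite hornerM => h.
have [hSb|nS] := boolP (vge v 1 S.[c b]); first by left; exact: unnorm eS _.
have [hTb|nT] := boolP (vge v 1 T.[c b]); first by right; exact: unnorm eT _.
have S0 : S.[c b] != 0 by apply: contraNneq nS => ->; rewrite vge0.
have T0 : T.[c b] != 0 by apply: contraNneq nT => ->; rewrite vge0.
exfalso; move: h nS nT; rewrite (vge_mull hv) //.
by rewrite !vgeE //; move: (v S.[c b]) (v T.[c b]) => p q; lia.
Qed.

Definition unramified_val : L -> int := filtration_val locG.

Let GS m t : locG (m + 1) t -> locG m t.
Proof. by move=> [N h]; exists N; apply: gaussLW h; lia. Qed.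

Let Gex t : exists m, locG m t.
Proof. by have [m h] := gaussL_ex 1 0 t; exists m; apply: gaussL_locG. Qed.

Let G0 m : locG m 0.
Proof. by apply: gaussL_locG; exact: gaussL0. Qed.

Lemma unramified_val_is_place : is_place (fun a => iota (c a)) unramified_val.
Proof.
apply: (filtration_is_place (G := locG)) => //.
- by rewrite !rmorph0.
- exact: locG_D.
- exact: locG_M.
- exact: locG_prime.
- exact: locG_sep.
- move=> a a0; have ca0 : c a != 0 by rewrite fmorph_eq0.
  split; first by apply/locG_iota; rewrite ?(valC hv).
  by move/(iffLR (locG_iota _ ca0)); rewrite (valC hv).
- have [z z0 vz] := exists_val hv 1; exists (iota z); rewrite ?fmorph_eq0 //.
  split; first by apply/locG_iota; rewrite ?vz.
  by move/(iffLR (locG_iota _ z0)); rewrite vz.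
Qed.

Lemma vge_unramified m t : vge unramified_val m t <-> locG m t.
Proof. by apply: vge_filtration_val => //; exact: locG_sep. Qed.

Lemma unramified_val_iota z : z != 0 -> unramified_val (iota z) = v z.
Proof.
move=> z0; apply: filtration_valE; rewrite ?fmorph_eq0 //.
- exact: locG_sep.
- by apply/locG_iota.
- by move/(iffLR (locG_iota _ z0)); lia.
Qed.

End OneRoot.

Lemma residue_root : exists2 bs : seq k, uniq bs /\ size bs = n
  & exists r, 'X^n - r%:P = \prod_(b <- bs) ('X - b%:P)
    /\ forall b, b \in bs -> vge v 1 (f - c b ^+ n).
Proof.
have [|r hr] := @residue f; first by rewrite vgeE // vf.
have r0 : r != 0.
  by apply: contraL hr => /eqP ->; rewrite rmorph0 subr0 vgeE // vf.
have [bs] := closed_field_poly_normal ('X^n - r%:P).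
have mon : 'X^n - r%:P \is monic by rewrite monicXnsubC.
rewrite (monicP mon) scale1r => e; exists bs; last exists r.
  split; last by have := size_XnsubC r n_gt0; rewrite e size_prod_XsubC => -[].
  rewrite -separable_prod_XsubC -e unlock.
  apply: Pdiv.ClosedField.root_coprimep => x; rewrite /root !hornerE.
  rewrite subr_eq0 => /eqP xn; rewrite derivB derivC subr0 derivXn hornerMn hornerXn.
  rewrite -mulr_natl mulf_neq0 // expf_neq0 //; apply: contraNneq r0 => x0.
  by rewrite -xn x0 expr0n; case: (n) n_gt0.
split=> // b; rewrite -root_prod_XsubC -e /root !hornerE subr_eq0.
by move=> /eqP bn; rewrite -rmorphXn bn.
Qed.

(** Let [mu < m] be the exact weight of [T]. Scaled to weight 0, [T] reduces to a nonzero polynomial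
    [R] over [k] with fewer than [n + 1] coefficients; positivity at the place attached to each root
    [b] makes [R] vanish at [n] distinct points, which is impossible. *)
Lemma unramified_coord m T : (size T <= n)%N ->
  (forall w, is_place (fun a => iota (c a)) w ->
     (forall z, z != 0 -> w (iota z) = v z) -> vge w m (evy T)) ->
  forall l, T`_l != 0 -> m <= v T`_l.
Proof.
move=> hT h.
suff /gauss_vge g : gauss m T by move=> l Tl; have := g l; rewrite vgeE.
have [T0|T0] := eqVneq T 0; first by rewrite T0; exact: gauss0.
have t0 := evy_neq0 hT T0.
have [|||mu [gmu nmu]] := @filtration_jump _ gaussL _ _ _ _ t0.
- by move=> a u; apply: gaussLW; lia.
- exact: gaussL_ex.
- by move=> u; exact: gaussL_sep.
have {}gmu := iffLR (gaussL_evy e_gt0 ef _ hT) gmu.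
have [le|lt] := leP m mu; first exact: gaussW gmu.
exfalso; have [bs [ubs sbs] [r [_ hbs]]] := residue_root.
have [z z0 vz] := exists_val hv (- mu).
have gT1 : gauss 0 (z *: T).
  apply/gauss_vge => l; rewrite coefZ (vge_mull hv) // vz sub0r opprK.
  by move/gauss_vge: gmu; apply.
have /choice[rho hrho] : forall l : nat, exists r, vge v 1 ((z *: T)`_l - c r).
  by move=> l; apply: residue; move/gauss_vge: gT1; apply.
have Tb b : b \in bs -> vge v 1 (z *: T).[c b].
  move=> hb; have hb' := hbs _ hb; apply: (locG_horner hb') => //.
  have := h _ (unramified_val_is_place hb') (unramified_val_iota hb').
  move/(vge_unramified hb') => [N hN]; exists N.
  rewrite evyZ mulrCA; apply: (@gaussLW 1 0 _ (v z + m)); first by lia.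
  exact: gaussL_shift.
pose R := \poly_(l < n) rho l.
have R0 : R != 0.
  apply/negP => /eqP R0; apply: nmu; exists T => //; apply/gauss_vge => l.
  have [ln|ln] := ltnP l n; last by rewrite nth_default ?vge0 // (leq_trans hT).
  have := hrho l; have := congr1 (fun p : {poly k} => p`_l) R0.
  rewrite coef_poly ln coef0 => ->; rewrite rmorph0 subr0 coefZ (vge_mull hv) //.
  by rewrite vz opprK addrC.
have : all (root R) bs.
  apply/allP => b hb; apply/eqP.
  have e : (z *: T).[c b] - c R.[b] = \sum_(l < n) ((z *: T)`_l - c (rho l)) * c b ^+ l.
    rewrite (@horner_coef_wide _ n) ?(leq_trans (size_scale_leq _ _)) //.
    rewrite horner_poly rmorph_sum -sumrB; apply: eq_bigr => l _.
    by rewrite rmorphM rmorphXn mulrBl.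
  have : vge v 1 (c R.[b]).
    rewrite -[c _](subKr (z *: T).[c b]); apply: (vgeB hv); first exact: Tb.
    rewrite e; apply: (vge_sum hv) => l _; rewrite mulrC; apply: (vgeMl hv) => //.
    by have := vgeX hv l (vgeC hv b); rewrite mulr0.
  by rewrite /vge (valC hv) orbF fmorph_eq0 => /eqP.
move=> /(max_poly_roots R0)/(_ ubs); rewrite sbs ltnNge.
by rewrite (leq_trans (size_poly _ _)).
Qed.

Lemma unramified_place : exists2 w, is_place (fun a => iota (c a)) w &
  forall z, z != 0 -> w (iota z) = v z.
Proof.
have [bs [_ sbs] [r [_ hbs]]] := residue_root.
case: bs sbs hbs => [n0|b bs _ hbs]; first by move: n_gt0; rewrite -n0.
have hb := hbs b (mem_head _ _); exists (unramified_val b).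
  exact: unramified_val_is_place.
exact: unramified_val_iota.
Qed.

(** At [w] the function [y] reduces to some root [b]. Then [w] is nonnegative on the valuation ring
    of [unramified_val b], hence zero on its units, and so it is [e0] times that valuation. Since
    [w] takes the value 1, [e0 = 1]. *)
Lemma unramified_index w e0 : is_place (fun a => iota (c a)) w -> 0 < e0 ->
  (forall z, z != 0 -> w (iota z) = e0 * v z) -> e0 = 1.
Proof.
move=> hw e0_gt0 we.
have y0 : y != 0.
  apply: contraNneq f_neq0 => y0; rewrite -(fmorph_eq0 iota) -yn y0.
  by rewrite expr0n; case: (n) n_gt0.
have wy : w y = 0.
  have := valX hw n y0; rewrite yn we // vf mulr0; have := n_gt0; nia.
have wi m z : 0 <= m -> vge v m z -> vge w m (iota z).
  move=> m0; have [->|z0] := eqVneq z 0; first by rewrite rmorph0 !vge0.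
  by rewrite !vgeE ?fmorph_eq0 // we // => ?; nia.
have [bs [_ sbs] [r [er hbs]]] := residue_root.
have [b hb wb] : exists2 b, b \in bs & vge w 1 (y - iota (c b)).
  apply/hasP; apply: contraT => /hasPn nb.
  have : ~~ vge w 1 (\prod_(b <- bs) (y - iota (c b))).
    elim: (bs) nb => [|b s IH] nb.
      by rewrite big_nil vgeE ?oner_neq0 // (val1 hw).
    rewrite big_cons.
    have h1 : ~~ vge w 1 (y - iota (c b)) by apply: nb; rewrite mem_head.
    have h2 : ~~ vge w 1 (\prod_(b <- s) (y - iota (c b))).
      by apply: IH => a ha; apply: nb; rewrite inE ha orbT.
    have z1 : y - iota (c b) != 0 by apply: contraNneq h1 => ->; rewrite vge0.
    have z2 : \prod_(b <- s) (y - iota (c b)) != 0.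
      by apply: contraNneq h2 => ->; rewrite vge0.
    by move: h1 h2; rewrite !vgeE ?mulf_neq0 // (valM hw) //; lia.
  have -> : \prod_(b <- bs) (y - iota (c b)) = iota (f - c r).
    transitivity (evy (map_poly c (\prod_(b <- bs) ('X - b%:P)))).
      rewrite rmorph_prod /evy rmorph_prod horner_prod; apply: eq_bigr => b _.
      by rewrite /= map_polyXsubC /= map_polyXsubC hornerXsubC.
    rewrite -er rmorphB /= map_polyXn map_polyC evyD evyN evyXn evyC yn rmorphB.
    by [].
  move=> /negP[]; apply: wi => //.
  case: bs er sbs hbs {nb} => [_ n0|b bs er _ hbs]; first by move: n_gt0; rewrite -n0.
  have -> : r = b ^+ n; last by rewrite rmorphXn; apply: hbs; rewrite mem_head.
  have := congr1 (fun p => p.[b]) er; rewrite big_cons !hornerE subrr mul0r.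
  by move=> /eqP; rewrite subr_eq0 => /eqP.
have hb' := hbs _ hb.
(* The cofactor is a unit at [w] too, so that the denominators allowed in [locG b 0] are
   harmless. *)
have ws : evy (cofactor b) != 0 /\ w (evy (cofactor b)) = 0.
  have [U hU e] := gauss_div_XsubC b (gauss_cofactor hb').
  have [S0 S1] := val_cofactor hb'.
  have -> : evy (cofactor b) = iota (cofactor b).[c b] + evy U * (y - iota (c b)).
    by rewrite {1}e evyD evyM evyD evyN !evyC /evy map_polyX hornerX addrC.
  have wS : w (iota (cofactor b).[c b]) = 0 by rewrite we // S1 mulr0.
  rewrite -wS; apply: (val_dominant hw); first by rewrite fmorph_eq0.
  rewrite wS add0r; apply: (vgeMl hw) => //.
  rewrite /evy horner_coef.
  apply: (vge_sum hw) => l _; apply: (vgeMl hw).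
    by rewrite coef_map; apply: wi => //; move/gauss_vge: hU; apply.
  by rewrite vgeE ?expf_neq0 // (valX hw) // wy mulr0.
have pos t : locG b 0 t -> vge w 0 t.
  move=> [N [T gT e]]; have := vge_mull hw 0 t (expf_neq0 N ws.1).
  rewrite (valX hw) ?ws.1 // ws.2 mulr0 subr0 => <-; rewrite e.
  rewrite /evy horner_coef.
  apply: (vge_sum hw) => l _; apply: (vgeMl hw).
    by rewrite coef_map; apply: wi => //; move/gauss_vge: gT; apply.
  by rewrite vgeE ?expf_neq0 // (valX hw) // wy mulr0.
have hu := unramified_val_is_place hb'.
have zero t : t != 0 -> unramified_val b t = 0 -> w t = 0.
  move=> t0 ut; apply/eqP; rewrite eq_le; apply/andP; split.
    rewrite -oppr_ge0 -(valV hw) -vgeE ?invr_eq0 //; apply: pos.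
    by apply/(vge_unramified hb'); rewrite vgeE ?invr_eq0 // (valV hu) ut.
  by rewrite -vgeE //; apply: pos; apply/(vge_unramified hb'); rewrite vgeE // ut.
case: (hw) => _ _ _ _ [t t0 wt].
have [z z0 vz] := exists_val hv (- unramified_val b t).
have : w (iota z * t) = 0.
  apply: zero; first by rewrite mulf_neq0 ?fmorph_eq0.
  by rewrite (valM hu) ?fmorph_eq0 // (unramified_val_iota hb') // vz addNr.
rewrite (valM hw) ?fmorph_eq0 // we // vz wt => h.
move: h; move: (unramified_val b t) => u eu.
have u_gt0 : 0 < u by nia.
by nia.
Qed.

End Unramified.
End Kummer.

Section KummerPlaces.
Variables (k : closedFieldType) (K L : fieldType).
Variables (c : {rmorphism k -> K}) (iota : {rmorphism K -> L}).
Variables (v : K -> int) (n : nat) (f : K) (y : L).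
Hypothesis hv : is_place c v.
Hypothesis f_neq0 : f != 0.
Hypothesis yn : y ^+ n = iota f.
Hypothesis gen : forall t : L, exists T : {poly K}, t = (map_poly iota T).[y].
Hypothesis uniq_coord : forall T : {poly K},
  (size T <= n)%N -> (map_poly iota T).[y] = 0 -> T = 0.
Hypothesis n_prime : prime n.
Hypothesis nk : n%:R != 0 :> k.
Hypothesis residue : forall a, vge v 0 a -> exists r : k, vge v 1 (a - c r).

Let n_gt0 : (0 < n)%N. Proof. exact: prime_gt0. Qed.

(** The substitution of [z * X] for [X]. With [n * v z = - v f], replacing [y] by [y * iota z]
    reduces a point where [n] divides [v f] to the case where [f] is a unit. *)
Definition rescale (z : K) (T : {poly K}) : {poly K} :=
  \poly_(l < size T) (T`_l * z ^+ l).

Lemma coef_rescale z T l : (rescale z T)`_l = T`_l * z ^+ l.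
Proof.
by rewrite coef_poly; case: ltnP => // h; rewrite nth_default // mul0r.
Qed.

Lemma horner_rescale z T :
  (map_poly iota (rescale z T)).[y] = (map_poly iota T).[y * iota z].
Proof.
rewrite (@horner_coef_wide _ (size T)) ?size_map_poly ?size_poly //.
rewrite horner_coef size_map_poly; apply: eq_bigr => l _.
by rewrite !coef_map /= coef_rescale rmorphM rmorphXn exprMn -mulrA [_ * y ^+ _]mulrC.
Qed.

Section Rescaled.
Variable z : K.
Hypothesis z0 : z != 0.
Hypothesis vz : n%:Z * v z = - v f.

Let y' := y * iota z.
Let f' := f * z ^+ n.

Lemma rescaled_neq0 : f' != 0.
Proof. by rewrite mulf_neq0 ?expf_neq0. Qed.

Lemma rescaled_yn : y' ^+ n = iota f'.
Proof. by rewrite exprMn yn rmorphM rmorphXn. Qed.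

Lemma rescaled_val : v f' = 0.
Proof. by rewrite (valM hv) ?expf_neq0 // (valX hv) // vz addrN. Qed.

Lemma rescaled_gen t : exists T : {poly K}, t = (map_poly iota T).[y'].
Proof.
have [T ->] := gen t; exists (rescale z^-1 T); rewrite -horner_rescale.
congr (_ .[_]); congr map_poly; apply/polyP => l.
by rewrite !coef_rescale -mulrA -exprMn mulVf // expr1n mulr1.
Qed.

Lemma rescaled_uniq (T : {poly K}) :
  (size T <= n)%N -> (map_poly iota T).[y'] = 0 -> T = 0.
Proof.
move=> hT; rewrite -horner_rescale => /uniq_coord h.
have {}h : rescale z T = 0 by apply: h; rewrite (leq_trans (size_poly _ _)).
apply/polyP => l; have := congr1 (fun p : {poly K} => p`_l) h.
rewrite coef_rescale coef0 => /eqP; rewrite mulf_eq0 expf_eq0 (negbTE z0) andbF.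
by rewrite orbF => /eqP.
Qed.

Lemma rescaled_coord m (T : {poly K}) : (size T <= n)%N ->
  (forall w, is_place (fun a => iota (c a)) w ->
     (forall a, a != 0 -> w (iota a) = v a) -> vge w m (evy iota y T)) ->
  forall l, T`_l != 0 -> m <= v T`_l - v z * l%:Z.
Proof.
move=> hT h l Tl.
have hS : (size (rescale z^-1 T) <= n)%N by rewrite (leq_trans (size_poly _ _)).
have eS : evy iota y' (rescale z^-1 T) = evy iota y T.
  rewrite /evy -horner_rescale; congr (_ .[_]); congr map_poly; apply/polyP => j.
  by rewrite !coef_rescale -mulrA -exprMn mulVf // expr1n mulr1.
have zl : z^-1 ^+ l != 0 by rewrite expf_neq0 // invr_eq0.
have := unramified_coord hv n_gt0 rescaled_neq0 rescaled_yn rescaled_gen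
  rescaled_uniq rescaled_val nk residue hS.
rewrite eS => /(_ m h l); rewrite coef_rescale mulf_neq0 // => /(_ isT).
by rewrite (valM hv) // (valX hv) ?invr_eq0 // (valV hv) mulrN mulrC.
Qed.

Lemma rescaled_place : exists2 w, is_place (fun a => iota (c a)) w &
  forall a, a != 0 -> w (iota a) = v a.
Proof.
exact: (unramified_place hv n_gt0 rescaled_neq0 rescaled_yn rescaled_gen
  rescaled_uniq rescaled_val nk residue).
Qed.

End Rescaled.

Lemma rescaling : (n%:Z %| v f)%Z -> exists2 z : K, z != 0 & n%:Z * v z = - v f.
Proof.
move=> /dvdzP[q vf]; have [z z0 vz] := exists_val hv (- q).
by exists z => //; rewrite vz vf mulrN mulrC.
Qed.

Lemma kummer_place : exists w e,
  [/\ is_place (fun a => iota (c a)) w, e = 1 \/ e = n%:Z,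
      ~~ (n%:Z %| v f)%Z -> e = n%:Z
    & forall a, a != 0 -> w (iota a) = e * v a].
Proof.
have [dvd|ndvd] := boolP (n%:Z %| v f)%Z.
  have [z z0 vz] := rescaling dvd; have [w hw we] := rescaled_place z0 vz.
  by exists w, 1; split=> // [|a a0]; [left | rewrite mul1r we].
have [w [hw we _]] := ramified_place hv n_gt0 f_neq0 yn gen uniq_coord n_prime ndvd.
by exists w, n%:Z; split=> //; right.
Qed.

(** At a place of index [e] the differential [dx] has order [e - 1 - 2 * e * d], with [d = 1] above
    infinity and [d = 0] elsewhere: the hypothesis is holomorphy of [evy T dx]. In the unramified
    case the stronger bound [2 * d] on the order of each term is obtained; it is weakened to the
    shape of the ramified case so that one inequality serves both. *)
Lemma kummer_coord (T : {poly K}) (d : int) : (size T <= n)%N ->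
  (forall w e, is_place (fun a => iota (c a)) w -> e = 1 \/ e = n%:Z ->
     (forall a, a != 0 -> w (iota a) = e * v a) ->
     vge w (1 - e + 2 * e * d) (evy iota y T)) ->
  forall l : nat, T`_l != 0 ->
    1 - n%:Z + 2 * n%:Z * d <= n%:Z * v T`_l + v f * l%:Z.
Proof.
move=> hT h l Tl; have [dvd|ndvd] := boolP (n%:Z %| v f)%Z.
  have [z z0 vz] := rescaling dvd.
  have : 2 * d <= v T`_l - v z * l%:Z.
    apply: (rescaled_coord z0 vz hT) => // w hw we.
    have := h w 1 hw (or_introl erefl); rewrite subrr add0r mulr1; apply=> a a0.
    by rewrite mul1r we.
  have -> : v f = - (n%:Z * v z) by rewrite vz opprK.
  have : 0 < n%:Z by rewrite ltz_nat.
  move: (v T`_l) (v z) (l%:Z) (n%:Z) => p q r s s0 le.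
  have -> : s * p + - (s * q) * r = s * (p - q * r) by ring.
  have -> : 2 * s * d = s * (2 * d) by ring.
  by nia.
have [w [hw we coordw]] :=
  ramified_place hv n_gt0 f_neq0 yn gen uniq_coord n_prime ndvd.
apply: coordw Tl => //; exact: h (or_intror erefl) _.
Qed.

End KummerPlaces.

(** * Rational functions *)

Section RationalFunctions.
Variable k : closedFieldType.
Local Notation K := {fraction {poly k}}.
Implicit Types (P : option k) (p q u : {poly k}) (t : K).

Lemma frac_numden t : exists p q, q != 0 /\ t = tofrac p / tofrac q.
Proof.
elim/quotW: t => r; exists (frac r).1, (frac r).2; split.
  exact: denom_ratioP.
rewrite -[RHS]/(FracField.mul _ (FracField.inv _)) !piE.
apply/eqmodP; rewrite /= FracField.equivfE /FracField.mulf /FracField.invf.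
have d0 := denom_ratioP r.
by rewrite !numden_Ratio ?oner_neq0 ?mul1r ?mulr1 // mulrC.
Qed.

Definition ord_poly P p : int :=
  if P is Some a then (mup a p)%:Z else 1 - (size p)%:Z.

Lemma ord_polyM P p q : p != 0 -> q != 0 ->
  ord_poly P (p * q) = ord_poly P p + ord_poly P q.
Proof.
move=> p0 q0; case: P => [a|] /=; first by rewrite mupM.
rewrite size_mul //; move: p0 q0; rewrite -!size_poly_gt0.
by move: (size p) (size q) => a b; lia.
Qed.

Lemma ord_polyD P p q : p != 0 -> q != 0 -> p + q != 0 ->
  Num.min (ord_poly P p) (ord_poly P q) <= ord_poly P (p + q).
Proof.
move=> p0 q0 pq0; case: P => [a|] /=; last first.
  rewrite ge_min !lerD2l !lerN2 !lez_nat -leq_max; exact: size_polyD.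
rewrite ge_min !lez_nat !mup_geq //.
have [le|/ltnW le] := leqP (mup a p) (mup a q); apply/orP; [left|right];
  by apply: dvdp_add; rewrite -mup_geq.
Qed.

Lemma ord_polyC P a : a != 0 -> ord_poly P a%:P = 0.
Proof.
move=> a0; case: P => [b|] /=; last by rewrite size_polyC a0.
by rewrite mupNroot // rootC.
Qed.

Definition ord P t : int := if t == 0 then 0 else
  let r := generic_quotient.repr t in ord_poly P (frac r).1 - ord_poly P (frac r).2.

Lemma ord_frac P p q : p != 0 -> q != 0 ->
  ord P (tofrac p / tofrac q) = ord_poly P p - ord_poly P q.
Proof.
move=> p0 q0; rewrite /ord mulf_eq0 invr_eq0 !tofrac_eq0 (negbTE p0) (negbTE q0) /=.
set t := _ / _; set p' := (frac _).1; set q' := (frac _).2.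
have q'0 : q' != 0 by exact: denom_ratioP.
have et : t = tofrac p' / tofrac q'.
  rewrite -[LHS]reprK -[RHS]/(FracField.mul _ (FracField.inv _)) !piE.
  apply/eqmodP; rewrite /= FracField.equivfE /FracField.mulf /FracField.invf.
  by rewrite !numden_Ratio ?oner_neq0 ?mul1r ?mulr1 // mulrC.
have e : p * q' = p' * q.
  apply/eqP; rewrite -tofrac_eq !tofracM; apply/eqP.
  move/eqP: et; rewrite /t eqr_div ?tofrac_eq0 // => /eqP ->.
  by rewrite mulrC.
have p'0 : p' != 0.
  have : p * q' != 0 by rewrite mulf_neq0.
  by rewrite e mulf_eq0 negb_or => /andP[].
by have := congr1 (ord_poly P) e; rewrite !ord_polyM //; lia.
Qed.

Lemma ord_tofrac P p : p != 0 -> ord P (tofrac p) = ord_poly P p.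
Proof.
move=> p0; rewrite -[tofrac p]divr1 -tofrac1 ord_frac ?oner_neq0 //.
by rewrite -[1]/(1%:P) ord_polyC ?oner_neq0 // subr0.
Qed.

Definition ratconst : {rmorphism k -> K} := (@tofrac {poly k}) \o polyC.

Lemma frac_numden_neq0 t : t != 0 ->
  exists p q, [/\ p != 0, q != 0 & t = tofrac p / tofrac q].
Proof.
have [p [q [q0 ->]]] := frac_numden t.
rewrite mulf_eq0 negb_or tofrac_eq0 => /andP[p0 _]; by exists p, q.
Qed.

Lemma uniformizer_neq0 P : uniformizer P != 0.
Proof. by case: P => [a|]; rewrite ?invr_eq0 tofrac_eq0 ?polyXsubC_eq0 ?polyX_eq0. Qed.

Lemma ord_uniformizer P : ord P (uniformizer P) = 1.
Proof.
case: P => [a|] /=.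
  rewrite ord_tofrac ?polyXsubC_eq0 //= -['X - _]expr1.
  by rewrite mup_XsubCX eqxx.
rewrite -div1r -tofrac1 ord_frac ?oner_neq0 ?polyX_eq0 //=.
by rewrite size_poly1 size_polyX.
Qed.

Lemma ord_is_place P : is_place ratconst (ord P).
Proof.
split.
- by rewrite /ord eqxx.
- move=> s t /frac_numden_neq0[p [q [p0 q0 ->]]] /frac_numden_neq0[p' [q' [p'0 q'0 ->]]].
  rewrite mulf_div -!tofracM !ord_frac ?mulf_neq0 // !ord_polyM //; lia.
- move=> s t /frac_numden_neq0[p [q [p0 q0 ->]]] /frac_numden_neq0[p' [q' [p'0 q'0 ->]]].
  rewrite addf_div ?tofrac_eq0 // -!tofracM -tofracD => h.
  have n0 : p * q' + p' * q != 0.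
    by apply: contraNneq h => ->; rewrite tofrac0 mul0r.
  rewrite !ord_frac ?mulf_neq0 //.
  have := @ord_polyD P (p * q') (p' * q).
  rewrite !mulf_neq0 // !ord_polyM // => /(_ isT isT n0); rewrite !ge_min.
  move: (ord_poly P p) (ord_poly P q) (ord_poly P p') (ord_poly P q') => x x' y y'.
  by move: (ord_poly P _) => z /orP[] le; apply/orP; [left|right]; lia.
- move=> a; have [->|a0] := eqVneq a 0; first by rewrite rmorph0 /ord eqxx.
  by rewrite ord_tofrac ?polyC_eq0 // ord_polyC.
- by exists (uniformizer P); [exact: uniformizer_neq0 | exact: ord_uniformizer].
Qed.

Lemma ord_residue P t : vge (ord P) 0 t ->
  exists r, vge (ord P) 1 (t - ratconst r).
Proof.
have [->|] := eqVneq t 0.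
  by exists 0; rewrite rmorph0 subr0 vge0.
move=> /frac_numden_neq0[p [q [p0 q0 ->]]].
rewrite vgeE ?mulf_neq0 ?invr_eq0 ?tofrac_eq0 // ord_frac // => le.
suff [r hr] : exists r, r%:P * q = p \/ ord_poly P q + 1 <= ord_poly P (p - r%:P * q).
  have q0' : tofrac q != 0 by rewrite tofrac_eq0.
  have e : tofrac p / tofrac q - ratconst r = tofrac (p - r%:P * q) / tofrac q.
    by rewrite tofracB tofracM mulrBl mulfK.
  exists r; rewrite e; have [->|n0] := eqVneq (p - r%:P * q) 0.
    by rewrite tofrac0 mul0r vge0.
  case: hr => [h|h]; first by rewrite h subrr eqxx in n0.
  by rewrite vgeE ?mulf_neq0 ?invr_eq0 ?tofrac_eq0 // ord_frac //; lia.
case: P le => [a|] /= le.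
  have : (mup a q <= mup a p)%N by lia.
  rewrite mup_geq // => /dvdpP[p1 ep].
  have : (mup a q <= mup a q)%N by [].
  rewrite mup_geq // => /dvdpP[q1 eq].
  have q1a : q1.[a] != 0.
    apply/negP => /factor_theorem[q2 e2].
    have : ('X - a%:P) ^+ (mup a q).+1 %| q.
      by rewrite {2}eq e2 -mulrA -exprS dvdp_mull.
    by rewrite -mup_geq // ltnn.
  exists (p1.[a] / q1.[a]); set r := _ / _.
  have [->|n0] := eqVneq (r%:P * q) p; [by left | right].
  have n0' : p - r%:P * q != 0 by rewrite subr_eq0 eq_sym.
  suff : ((mup a q).+1 <= mup a (p - r%:P * q))%N by rewrite -lez_nat -addn1 PoszD.
  rewrite mup_geq //.
  have -> : p - r%:P * q = (p1 - r%:P * q1) * ('X - a%:P) ^+ mup a q.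
    by rewrite mulrBl -mulrA -ep -eq.
  rewrite exprS dvdp_mul // dvdp_XsubCl /root !hornerE /r divfK //.
  by rewrite subrr.
have aux (i j : nat) : 0 <= 1 - i%:Z - (1 - j%:Z) -> (i <= j)%N by lia.
have le' : (size p <= size q)%N by exact: aux.
(* The value at infinity of a fraction without pole there: it is 0 when the degree of [p] is smaller
   than that of [q]. *)
exists (p`_(size q).-1 / lead_coef q); set r := _ / _.
have [->|n0] := eqVneq (r%:P * q) p; [by left | right].
have aux' (i j : nat) : (i < j)%N -> 1 - j%:Z + 1 <= 1 - i%:Z by lia.
apply: aux'.
have sq : (0 < size q)%N by rewrite size_poly_gt0.
rewrite -(prednK sq) ltnS; apply/leq_sizeP => j hj.
rewrite coefB coefCM; move: hj; rewrite leq_eqVlt => /orP[/eqP <-|hj].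
  by rewrite -/(lead_coef q) /r divfK ?lead_coef_eq0 // subrr.
rewrite !nth_default ?mulr0 ?subr0 //; first by rewrite -(prednK sq).
by rewrite (leq_trans le') // -(prednK sq).
Qed.

Lemma poly_of_ord (D : nat) t :
  (forall a, vge (ord (Some a)) 0 t) -> vge (ord None) (1 - D%:Z) t ->
  exists2 u : {poly k}, (size u <= D)%N & t = tofrac u.
Proof.
move=> ha; have [->|] := eqVneq t 0.
  by move=> _; exists 0; rewrite ?size_poly0 ?tofrac0.
move=> /frac_numden_neq0[p0 [q0 [p00 q00 et]]].
have [g [p [q [g0 cpq ep eq]]]] : exists g p q : {poly k},
    [/\ g != 0, coprimep p q, p0 = g * p & q0 = g * q].
  exists (gcdp p0 q0), (p0 %/ gcdp p0 q0), (q0 %/ gcdp p0 q0).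
  have g0 : gcdp p0 q0 != 0 by rewrite gcdp_eq0 negb_and p00.
  split=> //; first by rewrite coprimep_div_gcd // p00.
    by rewrite mulrC divpK // dvdp_gcdl.
  by rewrite mulrC divpK // dvdp_gcdr.
have pn0 : p != 0 by move: p00; rewrite ep mulf_eq0 negb_or => /andP[].
have qn0 : q != 0 by move: q00; rewrite eq mulf_eq0 negb_or => /andP[].
have {}et : t = tofrac p / tofrac q.
  rewrite et ep eq !tofracM -mulf_div divff ?mul1r ?tofrac_eq0 //.
have tn0 : t != 0 by rewrite et mulf_neq0 ?invr_eq0 ?tofrac_eq0.
have sq : size q == 1%N.
  apply: contraT => /closed_rootP[a qa].
  have := ha a; rewrite vgeE // et ord_frac //=.
  have : (0 < mup a q)%N by rewrite -XsubC_dvd // dvdp_XsubCl.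
  rewrite (@mupNroot _ _ p); first by lia.
  have cqp : coprimep q p by rewrite coprimep_sym.
  by have := @Pdiv.ClosedField.coprimepP _ q p cqp a qa; rewrite /root.
have [c c0 qc] : exists2 c, c != 0 & q = c%:P.
  by move/size_poly1P: sq.
have et' : t = tofrac (c^-1%:P * p).
  rewrite et qc tofracM mulrC; congr (_ * _).
  apply: (mulfI (x := tofrac c%:P)); first by rewrite tofrac_eq0 polyC_eq0.
  by rewrite divff ?tofrac_eq0 ?polyC_eq0 // -tofracM -polyCM divff // tofrac1.
rewrite vgeE // => h; exists (c^-1%:P * p) => //; move: h.
have n0 : c^-1%:P * p != 0 by rewrite mulf_neq0 // polyC_eq0 invr_eq0.
have aux (i j : nat) : 1 - i%:Z <= 1 - j%:Z -> (j <= i)%N by lia.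
by rewrite et' ord_tofrac //= => /aux.
Qed.

Lemma vge_ord_mul P m t p : t != 0 -> p != 0 ->
  vge (ord P) m (t * tofrac p) = (m <= ord P t + ord_poly P p).
Proof.
move=> t0 p0; rewrite mulrC (vge_mull (ord_is_place P)) ?tofrac_eq0 //.
by rewrite vgeE // ord_tofrac // lerBlDr.
Qed.

Section Restriction.
Variables (L : fieldType) (iota : {rmorphism K -> L}) (w : L -> int).
Hypothesis hw : is_place (fun a => iota (ratconst a)) w.

Lemma val_poly_ge0 a p : vge w 0 (iota (tofrac ('X - a%:P))) ->
  vge w 0 (iota (tofrac p)).
Proof.
move=> ha; have hX : vge w 0 (iota (tofrac 'X)).
  have -> : 'X = ('X - a%:P) + a%:P by rewrite subrK.
  by rewrite tofracD rmorphD; apply: (vgeD hw) => //; exact: (vgeC hw).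
elim/poly_ind: p => [|p b IH]; first by rewrite tofrac0 rmorph0 vge0.
rewrite tofracD tofracM rmorphD rmorphM; apply: (vgeD hw); last exact: (vgeC hw).
exact: (vgeMl hw).
Qed.

(** Polynomials not vanishing at [a] are units at [w], because they differ from a nonzero constant
    by a multiple of [X - a]. So only the multiplicity at [a] contributes. *)
Lemma place_over_point a z : 0 < w (iota (uniformizer (Some a))) -> z != 0 ->
  w (iota z) = w (iota (uniformizer (Some a))) * ord (Some a) z.
Proof.
set e := w _ => e_gt0.
have XA0 : iota (tofrac ('X - a%:P)) != 0.
  by rewrite fmorph_eq0 tofrac_eq0 polyXsubC_eq0.
have pos p : vge w 0 (iota (tofrac p)).
  by apply: (@val_poly_ge0 a); rewrite vgeE //; exact: ltW.
have unit p : p.[a] != 0 -> w (iota (tofrac p)) = 0.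
  move=> pa; have [u eu] : exists u, p - p.[a]%:P = u * ('X - a%:P).
    by apply/factor_theorem; rewrite /root !hornerE subrr.
  have -> : p = p.[a]%:P + u * ('X - a%:P) by rewrite -eu addrC subrK.
  have wa := valC hw p.[a]; rewrite tofracD rmorphD -[RHS]wa.
  apply: (val_dominant hw _ _).2; first by rewrite fmorph_eq0 tofrac_eq0 polyC_eq0.
  rewrite [X in vge w (X + _)]wa add0r tofracM rmorphM.
  by apply: (vgeMl hw) => //; rewrite vgeE // -gtz0_ge1.
have poly p : p != 0 -> w (iota (tofrac p)) = e * (mup a p)%:Z.
  move=> p0; have : (mup a p <= mup a p)%N by [].
  rewrite mup_geq // => /dvdpP[q eq].
  have qa : q.[a] != 0.
    apply/negP => /factor_theorem[q2 e2].
    have : ('X - a%:P) ^+ (mup a p).+1 %| p.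
      by rewrite {2}eq e2 -mulrA -exprS dvdp_mull.
    by rewrite -mup_geq // ltnn.
  have q0 : q != 0 by apply: contraNneq qa => ->; rewrite horner0.
  rewrite {1}eq tofracM rmorphM (valM hw) ?fmorph_eq0 ?tofrac_eq0 ?expf_neq0 ?polyXsubC_eq0 //.
  by rewrite unit // add0r tofracXn rmorphXn (valX hw) // mulrC.
move=> /frac_numden_neq0[p [q [p0 q0 ->]]].
rewrite ord_frac //= fmorph_div (val_div hw) ?fmorph_eq0 ?tofrac_eq0 //.
by rewrite !poly // mulrBr.
Qed.

End Restriction.
End RationalFunctions.

(** * Derivation in characteristic two *)

Section SquareDecomposition.
Variables (k : closedFieldType) (E : fieldType) (c : {rmorphism k -> E}) (X : E).
Hypothesis two0 : 2%:R = 0 :> E.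

Lemma addrr_two0 (a : E) : a + a = 0.
Proof. by rewrite -mulr2n -mulr_natr two0 mulr0. Qed.

Lemma sqrD_two0 (a b : E) : (a + b) ^+ 2 = a ^+ 2 + b ^+ 2.
Proof. by rewrite sqrrD mulr2n addrr_two0 addr0. Qed.

Definition sqdec (h : E) : Prop := exists A B, h = A ^+ 2 + X * B ^+ 2.

Lemma sqdecD h h' : sqdec h -> sqdec h' -> sqdec (h + h').
Proof.
move=> [A [B ->]] [A' [B' ->]]; exists (A + A'), (B + B').
by rewrite !sqrD_two0; ring.
Qed.

Lemma mul_sqdec A B A' B' :
  (A ^+ 2 + X * B ^+ 2) * (A' ^+ 2 + X * B' ^+ 2)
  = (A * A' + X * (B * B')) ^+ 2 + X * (A * B' + B * A') ^+ 2.
Proof. by rewrite !sqrD_two0; ring. Qed.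

Lemma sqdecM h h' : sqdec h -> sqdec h' -> sqdec (h * h').
Proof. by move=> [A [B ->]] [A' [B' ->]]; rewrite mul_sqdec; do 2!eexists. Qed.

Lemma sqdec_sqr a : sqdec (a ^+ 2).
Proof. by exists a, 0; rewrite expr0n mulr0 addr0. Qed.

Lemma sqdecV h : sqdec h -> sqdec h^-1.
Proof.
have [->|h0] := eqVneq h 0; first by rewrite invr0.
have -> : h^-1 = h * h^-1 ^+ 2 by rewrite expr2 mulrA divff // mul1r.
by move=> ?; apply: sqdecM => //; exact: sqdec_sqr.
Qed.

Lemma const_sqr a : exists b, a = b ^+ 2 :> k.
Proof.
have : size ('X^2 - a%:P) != 1%N by rewrite size_XnsubC.
by move/closed_rootP => [b /rootP]; rewrite !hornerE => /eqP;
  rewrite subr_eq0 => /eqP <-; exists b.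
Qed.

Lemma sqdec_const a : sqdec (c a).
Proof. by have [b ->] := const_sqr a; rewrite rmorphXn; exact: sqdec_sqr. Qed.

Lemma sqdec_X : sqdec X.
Proof. by exists 0, 1; rewrite expr0n expr1n mulr1 add0r. Qed.

(** Writing [a = b^2], the shift is absorbed by the square part, [A' = A + b B], while [B] stays the
    same: the derivation can be computed with [X - a], a local parameter of the line at [a]. *)
Lemma sqdec_X_shift a h : sqdec h -> exists A B A' : E,
  h = A ^+ 2 + X * B ^+ 2 /\ h = A' ^+ 2 + (X - c a) * B ^+ 2.
Proof.
move=> [A [B eh]]; have [b eb] := const_sqr a.
exists A, B, (A + c b * B); split=> //.
by rewrite sqrD_two0 eh eb rmorphXn; ring.
Qed.

(* The derivation of [E] with respect to [X], defined on [E = E^2 + X E^2]     *)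
(* when [X] is not a square: it maps [A^2 + X B^2] to [B^2].                   *)
Definition derX (h : E) : E :=
  xget 0 [set d | exists A B, h = A ^+ 2 + X * B ^+ 2 /\ d = B ^+ 2].

Hypothesis X_nsqr : forall a, X != a ^+ 2.
Hypothesis all_sqdec : forall h, sqdec h.

(** The value does not depend on the decomposition: two decompositions with different [B] would
    exhibit [X] as the square of a quotient. *)
Lemma derXE A B : derX (A ^+ 2 + X * B ^+ 2) = B ^+ 2.
Proof.
rewrite /derX; case: xgetP => [d _ [A' [B' [e ->]]]|]; last first.
  by move=> /(_ (B ^+ 2))[]; exists A, B.
have [->//|nB] := eqVneq B' B; have B0 : B' - B != 0 by rewrite subr_eq0.
have oppE (a : E) : - a = a by apply/eqP; rewrite eq_sym -addr_eq0 addrr_two0.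
case/negP: (X_nsqr ((A + A') / (B' - B))); apply/eqP.
apply: (mulIf (expf_neq0 2 B0)); rewrite -exprMn divfK //.
rewrite -[- B]oppE opprK !sqrD_two0 mulrDr.
have -> : X * B ^+ 2 = A ^+ 2 + (A ^+ 2 + X * B ^+ 2).
  by rewrite addrA addrr_two0 add0r.
rewrite e.
transitivity (A ^+ 2 + A' ^+ 2 + (X * B' ^+ 2 + X * B' ^+ 2)); first by ring.
by rewrite addrr_two0 addr0.
Qed.

Lemma derX0 : derX 0 = 0.
Proof. by have := derXE 0 0; rewrite !expr0n mulr0 addr0. Qed.

Lemma derXD g h : derX (g + h) = derX g + derX h.
Proof.
have [A [B ->]] := all_sqdec g; have [A' [B' ->]] := all_sqdec h.
rewrite !derXE -sqrD_two0 -(derXE (A + A') (B + B')).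
by congr derX; rewrite !sqrD_two0; ring.
Qed.

Lemma derX_sqrM a h : derX (a ^+ 2 * h) = a ^+ 2 * derX h.
Proof.
have [A [B ->]] := all_sqdec h; rewrite derXE -exprMn -(derXE (a * A) (a * B)).
by congr derX; ring.
Qed.

Lemma derXM g h : derX (g * h) = g * derX h + h * derX g.
Proof.
have [A [B ->]] := all_sqdec g; have [A' [B' ->]] := all_sqdec h.
rewrite mul_sqdec !derXE !sqrD_two0.
transitivity (A ^+ 2 * B' ^+ 2 + B ^+ 2 * A' ^+ 2
  + (X * B ^+ 2 * B' ^+ 2 + X * B ^+ 2 * B' ^+ 2)); last by ring.
by rewrite addrr_two0; ring.
Qed.

Lemma derX_eq0 h : derX h = 0 -> exists a, h = a ^+ 2.
Proof.
have [A [B ->]] := all_sqdec h; rewrite derXE => ->.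
by exists A; rewrite mulr0 addr0.
Qed.

(** With [derX h = B^2] the quotient is [(B / h)^2 * h], and squares are constants of the
    derivation. *)
Lemma derX_log h : derX (derX h / h) = (derX h / h) ^+ 2.
Proof.
have [->|h0] := eqVneq h 0; first by rewrite invr0 mulr0 derX0 expr0n.
have [B eB] : exists B, derX h = B ^+ 2.
  by have [A [B ->]] := all_sqdec h; exists B; rewrite derXE.
have -> : derX h / h = (B / h) ^+ 2 * h by rewrite eB; field.
by rewrite derX_sqrM eB; field.
Qed.

Lemma derX_log_inj g h : g != 0 -> h != 0 -> derX g / g = derX h / h ->
  exists2 s, s != 0 & g / h = s ^+ 2.
Proof.
move=> g0 h0 e.
have /derX_eq0[s es] : derX (g * h) = 0.
  rewrite derXM; have -> : derX h = derX g / g * h by rewrite e; field.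
  rewrite [h * derX g](_ : _ = g * (derX g / g * h)); last by field.
  exact: addrr_two0.
exists (s / h); last by rewrite exprMn -es; field.
rewrite mulf_neq0 ?invr_eq0 //; apply: contraTneq (mulf_neq0 g0 h0) => s0.
by rewrite es s0 expr0n eqxx.
Qed.

End SquareDecomposition.

Section Parity.
Variables (k : closedFieldType) (E : fieldType) (c : k -> E) (w : E -> int).
Hypothesis hw : is_place c w.

(** [A^2] has even value and [u B^2] odd value, so they cannot cancel: the value [2 m] of their sum
    is the smaller of the two, and by parity it stays below the value of [u B^2] by at least 1. *)
Lemma odd_part_dominated (h A B u : E) (m e : int) : h != 0 -> u != 0 ->
  h = A ^+ 2 + u * B ^+ 2 -> w h = 2 * m -> w u = e -> ~~ (2 %| e)%Z ->
  vge w (1 - e) (B ^+ 2 / h).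
Proof.
move=> h0 u0 eh wh wu odde; have [->|B0] := eqVneq B 0.
  by rewrite expr0n mul0r vge0.
rewrite vgeE ?mulf_neq0 ?invr_eq0 ?expf_neq0 // (val_div hw) ?expf_neq0 //.
rewrite (valX hw) // wh.
have ne (a : int) : e + 2 * a != 0.
  apply: contra odde => /eqP ea; apply/dvdzP; exists (- a); lia.
have wuB : w (u * B ^+ 2) = e + 2 * w B.
  by rewrite (valM hw) ?expf_neq0 // (valX hw) // wu.
suff : 2 * m <= e + 2 * w B by have := ne (w B - m); lia.
rewrite leNgt; apply/negP => lt.
have [A0|A0] := eqVneq A 0.
  by move: wh; rewrite eh A0 expr0n add0r wuB; have := ne (w B - m); lia.
have [] := val_dominant hw (x := u * B ^+ 2) (y := - h).
- by rewrite mulf_neq0 ?expf_neq0.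
- by rewrite (vgeN hw) vgeE // wuB wh; lia.
move=> _; rewrite wuB.
have -> : u * B ^+ 2 - h = - A ^+ 2 by rewrite eh; ring.
rewrite (valN hw) (valX hw) //; have := ne (w B - w A); lia.
Qed.

End Parity.

Section SuperellipticField.
Variables (k : closedFieldType) (n : nat) (f : {poly k}).
Hypothesis n_gt0 : (0 < n)%N.
Variable irr : monic_irreducible_poly (superelliptic_poly n f).
Local Notation K := {fraction {poly k}}.
Local Notation L := (function_field irr).

Fact of_ratfun_is_zmod_morphism : zmod_morphism (of_ratfun irr).
Proof. exact: (@qpolyC_is_zmod_morphism K). Qed.

Fact of_ratfun_is_monoid_morphism : monoid_morphism (of_ratfun irr).
Proof. exact: (@qpolyC_is_monoid_morphism K). Qed.

HB.instance Definition _ :=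
  GRing.isZmodMorphism.Build K L (of_ratfun irr) of_ratfun_is_zmod_morphism.
HB.instance Definition _ :=
  GRing.isMonoidMorphism.Build K L (of_ratfun irr) of_ratfun_is_monoid_morphism.

Definition yL : L := in_qpoly (superelliptic_poly n f) 'X.

Local Notation iota := (of_ratfun irr : {rmorphism K -> L}).

Lemma size_superelliptic : size (mk_monic (superelliptic_poly n f)) = n.+1.
Proof. by rewrite (mk_monicE irr) /superelliptic_poly size_XnsubC. Qed.

Lemma horner_yL (T : {poly K}) :
  (map_poly iota T).[yL] = in_qpoly (superelliptic_poly n f) T.
Proof. by rewrite -[T in RHS]comp_polyXr in_qpoly_comp_horner. Qed.

Lemma yL_gen (t : L) : exists T : {poly K}, t = (map_poly iota T).[yL].
Proof.
exists (polyn t); rewrite horner_yL; apply: val_inj.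
by rewrite /= Pdiv.CommonRing.rmodp_small // size_mk_monic.
Qed.

Lemma yL_uniq (T : {poly K}) :
  (size T <= n)%N -> (map_poly iota T).[yL] = 0 -> T = 0.
Proof.
move=> hT; rewrite horner_yL => /(congr1 (@polyn _ _)).
by rewrite /= Pdiv.CommonRing.rmodp_small // size_superelliptic.
Qed.

Lemma yL_exp : yL ^+ n = iota (tofrac f).
Proof.
have := horner_yL (superelliptic_poly n f); rewrite /superelliptic_poly.
rewrite rmorphB /= map_polyXn map_polyC !hornerE => e.
apply/eqP; rewrite -subr_eq0 e; apply/eqP/val_inj => /=.
by rewrite (mk_monicE irr) Pdiv.RingMonic.rmodpp // irr.
Qed.

End SuperellipticField.

Section CharTwo.
Variables (k : closedFieldType) (n : nat) (f : {poly k}).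
Hypothesis n_prime : prime n.
Hypothesis n_odd : odd n.
Hypothesis two0 : 2%:R = 0 :> k.
Hypothesis f_neq0 : f != 0.
Local Notation K := {fraction {poly k}}.
Variables (L : fieldType) (iota : {rmorphism K -> L}) (y : L).
Hypothesis yn : y ^+ n = iota (tofrac f).
Hypothesis gen : forall t : L, exists T : {poly K}, t = (map_poly iota T).[y].
Hypothesis uniq_coord : forall T : {poly K},
  (size T <= n)%N -> (map_poly iota T).[y] = 0 -> T = 0.
Local Notation cL := (fun a => iota (ratconst k a)).

Let n_gt0 : (0 < n)%N. Proof. exact: prime_gt0. Qed.

Lemma odd_natr_neq0 : n%:R != 0 :> k.
Proof.
rewrite -(odd_double_half n) n_odd -muln2 natrD natrM two0 mulr0 addr0.
exact: oner_neq0.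
Qed.

Let fK0 : tofrac f != 0 :> K. Proof. by rewrite tofrac_eq0. Qed.

Lemma two0K : 2%:R = 0 :> K.
Proof. by rewrite -(rmorph_nat (@ratconst k)) two0 rmorph0. Qed.

Lemma two0L : 2%:R = 0 :> L.
Proof. by rewrite -(rmorph_nat iota) two0K rmorph0. Qed.

Definition ratX : K := tofrac 'X.

Lemma sqdec_ratfun r : sqdec ratX r.
Proof.
have sqP (p : {poly k}) : sqdec ratX (tofrac p).
  elim/poly_ind: p => [|p a IH].
    by rewrite tofrac0 -(rmorph0 (@ratconst k)); exact: sqdec_const.
  rewrite tofracD tofracM; apply: (sqdecD two0K); last first.
    by rewrite -[tofrac _]/(ratconst k a); exact: sqdec_const.
  by apply: (sqdecM two0K) => //; exact: sqdec_X.
have [p [q [q0 ->]]] := frac_numden r.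
by apply: (sqdecM two0K) => //; apply: (sqdecV two0K).
Qed.

Lemma sqdec_iota r : sqdec (iota ratX) (iota r).
Proof.
have [a [b ->]] := sqdec_ratfun r; exists (iota a), (iota b).
by rewrite rmorphD rmorphXn rmorphM rmorphXn.
Qed.

(** As [j + n] is even and [y^n] lies in [K], an odd power of [y] is a square up to a factor from
    [K]. *)
Lemma y_sqr j : odd j ->
  y ^+ j = (y ^+ (j + n)./2) ^+ 2 * iota (tofrac f)^-1.
Proof.
move=> oj; rewrite -exprM muln2 halfK oddD oj n_odd subn0 exprD yn.
by rewrite -mulrA -rmorphM divff // rmorph1 mulr1.
Qed.

Lemma sqdec_L t : sqdec (iota ratX) t.
Proof.
have sqC r := sqdec_iota r.
have sqy : sqdec (iota ratX) y.
  have := @y_sqr 1 isT; rewrite expr1 => ->.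
  by apply: (sqdecM two0L) => //; exact: sqdec_sqr.
have [T ->] := gen t; elim/poly_ind: T => [|T r IH].
  by rewrite rmorph0 horner0 -(rmorph0 iota).
rewrite rmorphD rmorphM /= map_polyX map_polyC hornerMXaddC.
by apply: (sqdecD two0L); [exact: (sqdecM two0L) | exact: sqC].
Qed.

Lemma exists_place P : exists w e,
  [/\ is_place cL w, e = 1 \/ e = n%:Z,
      ~~ (n%:Z %| ord P (tofrac f))%Z -> e = n%:Z
    & forall a, a != 0 -> w (iota a) = e * ord P a].
Proof.
exact: (kummer_place (ord_is_place P) fK0 yn gen uniq_coord n_prime odd_natr_neq0
  (@ord_residue _ P)).
Qed.

Lemma ratX_neq0 : ratX != 0.
Proof. by rewrite tofrac_eq0 polyX_eq0. Qed.

Lemma odd_index e : e = 1 \/ e = n%:Z -> ~~ (2 %| e)%Z.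
Proof. by case=> ->; rewrite dvdzE //= dvdn2 n_odd. Qed.

(** Some place above 0 has index 1 or [n], both odd, and this index is the value of [X] there. *)
Lemma ratX_nsqr t : iota ratX != t ^+ 2.
Proof.
have [w [e [hw e1n _ we]]] := exists_place (Some 0).
have := we _ ratX_neq0.
have -> : ord (Some 0) ratX = 1.
  have -> : ratX = uniformizer (Some (0 : k)) by rewrite /= subr0.
  exact: ord_uniformizer.
rewrite mulr1 => wX; apply: contra (odd_index e1n) => /eqP e2.
have t0 : t != 0.
  by apply: contraTneq ratX_neq0 => t0; rewrite -(fmorph_eq0 iota) e2 t0 expr0n eqxx.
by rewrite -wX e2 (valX hw) // dvdz_mulr.
Qed.

Definition dL : L -> L := derX (iota ratX).

Local Notation dLE := (derXE two0L ratX_nsqr).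

Lemma dL_iota r : exists s, dL (iota r) = iota s.
Proof.
have [a [b ->]] := sqdec_ratfun r; exists (b ^+ 2).
by rewrite rmorphD rmorphXn rmorphM rmorphXn /dL dLE.
Qed.

(** Each [y^j] is a square times an element of [K], and the derivation is linear over squares and
    preserves [K]. So the decomposition of [L] by powers of [y] is respected. *)
Lemma dL_mono r j : exists s, dL (iota r * y ^+ j) = iota s * y ^+ j.
Proof.
have dM := derX_sqrM two0L ratX_nsqr sqdec_L.
have [oj|ej] := boolP (odd j).
  rewrite y_sqr // [iota r * _]mulrCA -rmorphM /dL dM.
  have [s es] := dL_iota (r * (tofrac f)^-1); rewrite -/dL es.
  by exists (s * tofrac f); rewrite mulrCA -rmorphM mulfK // mulrC.
rewrite -(odd_double_half j) (negbTE ej) add0n -muln2 exprM mulrC /dL dM.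
by have [s es] := dL_iota r; exists s; rewrite -/dL es mulrC.
Qed.

(* The form [dx] has no zero on the projective line, and a double pole at      *)
(* infinity.                                                                   *)
Definition half_pole (P : option k) : int := if P is None then 1 else 0.

(** Decompose [h = A^2 + u B^2] with [u] a uniformizer of the line, whose value [e] is odd. At a
    finite point [B^2] is [dL h] by [sqdec_X_shift]. At infinity [u = 1 / X] comes with [(X B)^2]
    instead, and the factor [X^2] accounts for the term [2 * e]. *)
Lemma log_derivative_bound P w e h m : is_place cL w ->
  e = 1 \/ e = n%:Z -> (forall a, a != 0 -> w (iota a) = e * ord P a) ->
  h != 0 -> w h = 2 * m -> vge w (1 - e + 2 * e * half_pole P) (dL h / h).
Proof.
move=> hw /odd_index odde we h0 wh.
case: P we => [a|] we.
  have [A [B [A' [eh eh']]]] := sqdec_X_shift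
    (iota \o ratconst k) two0L a (sqdec_L h).
  rewrite mulr0 addr0 {1}eh /dL dLE.
  have u0 := uniformizer_neq0 (Some a).
  have eu : iota ratX - iota (ratconst k a) = iota (uniformizer (Some a)).
    by rewrite -rmorphB /= tofracB.
  rewrite /= in eh'; rewrite eu in eh'.
  apply: (odd_part_dominated hw h0 _ eh' wh _ odde); first by rewrite fmorph_eq0.
  by rewrite we // ord_uniformizer mulr1.
have [A [B eh]] := sqdec_L h; rewrite {1}eh /dL dLE mulr1.
have X0 : iota ratX != 0 by rewrite fmorph_eq0 ratX_neq0.
have u0 := uniformizer_neq0 (None : option k).
have wu : w (iota ratX)^-1 = e.
  by rewrite -fmorphV (we _ u0) ord_uniformizer mulr1.
have eh' : h = A ^+ 2 + (iota ratX)^-1 * (iota ratX * B) ^+ 2.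
  by rewrite {1}eh; field.
have := odd_part_dominated hw h0 _ eh' wh wu odde.
rewrite invr_eq0 X0 => /(_ isT).
rewrite exprMn -mulrA (vge_mull hw) ?expf_neq0 // (valX hw) //.
have -> : w (iota ratX) = - e by rewrite -wu (valV hw) opprK.
by apply: vgeW; lia.
Qed.

Lemma divisor_class_eq (D E : place cL -> int) :
  lin_equiv D E -> divisor_class D = divisor_class E.
Proof.
move=> [h h0 hP]; apply/seteqP; split=> F [dF [g g0 gP]]; split=> //.
  exists (g / h); first by rewrite mulf_neq0 ?invr_eq0.
  move=> P; have := gP P; have := hP P; case: P => v hv /= eh eg.
  by rewrite (val_div hv) // -eg -eh; ring.
exists (g * h); first by rewrite mulf_neq0.
move=> P; have := gP P; have := hP P; case: P => v hv /= eh eg.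
by rewrite (valM hv) // -eg -eh; ring.
Qed.

(* The 2-torsion of the Jacobian embeds into the logarithmic differential      *)
(* forms [dh / h], which are holomorphic when the divisor of [h] is even.      *)
Lemma torsion_log_derivatives r : has_two_rank cL r ->
  exists w : 'I_(2 ^ r) -> L, [/\ injective w,
    forall i, dL (w i) = w i ^+ 2
  & forall i (T : {poly K}), (size T <= n)%N -> w i = evy iota y T ->
    forall P (l : nat), T`_l != 0 ->
      1 - n%:Z + 2 * n%:Z * half_pole P <=
      n%:Z * ord P T`_l + ord P (tofrac f) * l%:Z].
Proof.
rewrite /has_two_rank => /card_esym/card_set_bijP[F [Fsub Finj _]].
have /choice[Dh hDh] : forall i : 'I_(2 ^ r), exists Dh : (place cL -> int) * L,
    [/\ F i = divisor_class Dh.1, Dh.2 != 0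
      & forall P : place cL, Dh.1 P *+ 2 = ord_at P Dh.2].
  move=> i; have [|D [_ _ [h h0 hP]] e] := Fsub i; first exact: ltn_ord.
  by exists (D, h).
exists (fun i => dL (Dh i).2 / (Dh i).2); split.
- move=> i j e; have [Fi hi0 hi] := hDh i; have [Fj hj0 hj] := hDh j.
  have [s s0 es] := derX_log_inj two0L ratX_nsqr sqdec_L hi0 hj0 e.
  apply/val_inj/Finj; rewrite ?inE /= ?ltn_ord // Fi Fj; apply: divisor_class_eq.
  exists s => // P; have := hi P; have := hj P; case: P => v hv /= ej ei.
  have := congr1 v es; rewrite (val_div hv) // (valX hv) // -ei -ej.
  by move: ((Dh i).1 _) ((Dh j).1 _) (v s) => p q u; rewrite !mulr2n; lia.
- by move=> i; apply: (derX_log two0L ratX_nsqr sqdec_L).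
- move=> i T hT wT P; have [_ h0 hP] := hDh i.
  apply: (kummer_coord (ord_is_place P) fK0 yn gen uniq_coord n_prime odd_natr_neq0
    (@ord_residue _ P) hT).
  move=> w e hw e1n we; rewrite -wT.
  apply: (log_derivative_bound (m := (Dh i).1 (Place hw)) hw e1n we h0).
  by have /= <- := hP (Place hw); move: (_ (Place hw)) => p; rewrite mulr2n; lia.
Qed.

End CharTwo.

(** * Holomorphic forms and the Cartier operator *)

Section FrobeniusMatrix.
Variables (k : closedFieldType) (L : fieldType) (c : {rmorphism k -> L}).
Hypothesis char2 : 2%N \in [pchar k].
Hypothesis two0 : 2%:R = 0 :> L.
Variable D : L -> L.
Hypothesis D0 : D 0 = 0.
Hypothesis DD : forall s t, D (s + t) = D s + D t.
Hypothesis Dc : forall a t, D (c a * t) = c a * D t.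
Variables (N : nat) (e : 'I_N -> L).
Hypothesis e_free : forall a : 'I_N -> k,
  \sum_l c (a l) * e l = 0 -> forall l, a l = 0.

Lemma D_sum I (s : seq I) (F : I -> L) :
  D (\sum_(i <- s) F i) = \sum_(i <- s) D (F i).
Proof. by elim/big_rec2: _ => // i t t' _ <-; rewrite DD. Qed.

Lemma sqr_sum_two0 I (s : seq I) (F : I -> L) :
  (\sum_(i <- s) F i) ^+ 2 = \sum_(i <- s) F i ^+ 2.
Proof.
elim/big_rec2: _ => [|i t t' _ <-]; first by rewrite expr0n.
by rewrite sqrD_two0.
Qed.

(** As all coefficients are squares, a linear relation between squares is the square of a linear
    relation. *)
Lemma sqr_free I (s : seq I) (q : I -> k) (u : I -> L) :
  \sum_(i <- s) c (q i) * u i ^+ 2 = 0 ->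
  exists2 z, (forall i, q i = z i ^+ 2) & \sum_(i <- s) c (z i) * u i = 0.
Proof.
move=> h; have /choice[z hz] : forall i, exists z, q i = z ^+ 2.
  by move=> i; exact: const_sqr.
exists z => //; apply/eqP; rewrite -[_ == 0](expf_eq0 _ 2) sqr_sum_two0 -[X in _ == X]h.
by apply/eqP/eq_bigr => i _; rewrite hz exprMn rmorphXn.
Qed.

Variables (r : nat) (W : 'I_(2 ^ r) -> L).
Hypothesis W_inj : injective W.
Hypothesis W_der : forall i, D (W i) = W i ^+ 2.
Hypothesis W_span : forall i, exists a : 'I_N -> k, W i = \sum_l c (a l) * e l.
Hypothesis le_Nr : (N <= r)%N.

(* Solutions of [D w = w^2] that are linearly independent over F_2 are so over *)
(* k: in a maximal free family of solutions the coefficients [x] of the other  *)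
(* solutions satisfy [x = x^2].                                                *)
Lemma solution_basis : exists2 B : 'M[k]_N, B \in unitmx &
  forall p, D (\sum_l c (B p l) * e l) = (\sum_l c (B p l) * e l) ^+ 2.
Proof.
have /choice[a ha] := W_span.
pose M := \matrix_(i < 2 ^ r, l < N) a i l.
have [s [g [gfree gfull gN]]] : exists s (g : 'I_s -> 'I_(2 ^ r)),
    [/\ row_free (rowsub g M), (M <= rowsub g M)%MS & (s <= N)%N].
  exists (\rank M), (maxrankfun M); split; first exact: maxrowsub_free.
    by rewrite eq_maxrowsub.
  exact: rank_leq_col.
pose B := rowsub g M.
have WB p : W (g p) = \sum_l c (B p l) * e l.
  by rewrite ha; apply: eq_bigr => l _; rewrite !mxE.
have /choice[x hx] : forall i, exists x : 'rV[k]_s, row i M = x *m B.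
  move=> i; have /submxP[X eX] := gfull; exists (row i X).
  by rewrite {1}eX row_mul.
have comb (u : 'rV[k]_s) :
    \sum_p c (u 0 p) * W (g p) = \sum_l c ((u *m B) 0 l) * e l.
  under eq_bigr => p _ do rewrite WB mulr_sumr.
  rewrite exchange_big; apply: eq_bigr => l _; rewrite mxE rmorph_sum mulr_suml.
  by apply: eq_bigr => p _; rewrite rmorphM mulrA.
have Wx i : W i = \sum_p c (x i 0 p) * W (g p).
  rewrite comb ha -hx; apply: eq_bigr => l _; by rewrite !mxE.
have x01 i p : x i 0 p ^+ 2 = x i 0 p.
  have := W_der i; rewrite {1}Wx D_sum.
  under eq_bigr => j _ do rewrite Dc W_der.
  rewrite {1}Wx sqr_sum_two0; under [X in _ = X]eq_bigr => j _ do rewrite exprMn.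
  move=> /eqP; rewrite -subr_eq0 -sumrB => /eqP h.
  have [|z hz] := @sqr_free _ (index_enum 'I_s) (fun j => x i 0 j - x i 0 j ^+ 2) (W \o g).
    by rewrite -[RHS]h; apply: eq_bigr => j _; rewrite rmorphB rmorphXn mulrBl.
  move=> hz0; have : (\row_j z j) *m B = 0.
    apply/rowP => l; rewrite [RHS]mxE.
    apply: (e_free (a := fun l => ((\row_j z j) *m B) 0 l)).
    by rewrite -comb -[RHS]hz0; apply: eq_bigr => j _; rewrite mxE.
  move=> /eqP; rewrite mulmx_free_eq0 // => /eqP /rowP/(_ p); rewrite !mxE => zp.
  by have := hz p; rewrite zp expr0n => /eqP; rewrite subr_eq0 => /eqP.
(* The coordinates of a solution are 0 or 1, so the [2^r] distinct solutions inject into the subsets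
   of a family of [s] elements. *)
have sr : (r <= s)%N.
  have : (#|'I_(2 ^ r)| <= #|{set 'I_s}|)%N; last first.
    by rewrite card_ord -cardsT -powersetT card_powerset cardsT card_ord leq_exp2l.
  apply: (@leq_card _ _ (fun i => [set p | x i 0 p != 0]%SET)) => i j /setP eij.
  apply: W_inj; rewrite !Wx; apply: eq_bigr => p _; congr (c _ * _).
  have b01 l : x l 0 p = (x l 0 p != 0)%:R.
    have [->//|n0] := eqVneq (x l 0 p) 0.
    by apply: (mulfI n0); rewrite mulr1 -expr2 x01.
  by rewrite b01 [RHS]b01; have := eij p; rewrite !inE => ->.
have sN : s = N by apply/eqP; rewrite eqn_leq gN (leq_trans le_Nr).
move: g gfree gfull @B WB {hx comb x Wx x01 gN sr}; rewrite sN => g gfree _ B WB.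
exists B; first by rewrite -row_free_unit.
by move=> p; rewrite -WB W_der.
Qed.

(** In a basis of solutions the derivation sends each basis vector to its square. Changing the basis
    by [B] gives [Q] as the inverse of [B] times [B] with its entries squared, and both factors are
    invertible. *)
Lemma frobenius_matrix : exists2 Q : 'M[k]_N, Q \in unitmx &
  forall l, D (e l) = \sum_m c (Q l m) * e m ^+ 2.
Proof.
have [B Bu hB] := solution_basis.
pose F := pFrobenius_aut char2.
exists (invmx B *m map_mx F B); first by rewrite unitmx_mul unitmx_inv Bu map_unitmx.
pose de := \col_l D (e l); pose e2 := \col_l e l ^+ 2.
have Bde : map_mx c B *m de = map_mx c (map_mx F B) *m e2.
  apply/colP => p; rewrite !mxE.
  transitivity (D (\sum_l c (B p l) * e l)).
    by rewrite D_sum; apply: eq_bigr => l _; rewrite !mxE Dc.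
  rewrite hB sqr_sum_two0; apply: eq_bigr => l _.
  by rewrite !mxE /F pFrobenius_autE exprMn rmorphXn.
have ede : de = map_mx c (invmx B *m map_mx F B) *m e2.
  rewrite map_mxM -mulmxA -Bde mulmxA -map_mxM mulVmx // map_mx1 mul1mx.
  by [].
move=> l; have /colP/(_ l) := ede; rewrite !mxE => ->.
by apply: eq_bigr => m _; rewrite !mxE.
Qed.

End FrobeniusMatrix.

(** A nonzero term in the expansion of the determinant is a permutation along which all entries are
    nonzero; it carries [S] onto [T]. *)
Lemma unitmx_card_eq (F : fieldType) (N : nat) (Q : 'M[F]_N) (S T : {set 'I_N}) :
  Q \in unitmx -> (forall l m, Q l m != 0 -> (l \in S) = (m \in T)) ->
  #|S| = #|T|.
Proof.
rewrite unitmxE unitfE /determinant => detQ ST.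
have [s hs] : exists s : {perm 'I_N}, \prod_l Q l (s l) != 0.
  apply/existsP; apply: contraNT detQ => /existsPn h; apply/eqP.
  by apply: big1 => s _; have := h s; rewrite negbK => /eqP ->; rewrite mulr0.
have {}hs l : Q l (s l) != 0.
  by apply: contraNneq hs => h; rewrite (bigD1 l) //= h mul0r.
rewrite -(card_imset (mem S) (@perm_inj _ s)); congr #|pred_of_set _|.
apply/setP => m; apply/imsetP/idP => [[l lS ->]|mT]; first by rewrite -(ST _ _ (hs l)).
exists ((s^-1)%g m); last by rewrite permKV.
by rewrite (ST _ _ (hs _)) permKV.
Qed.

Definition ceil_mul (n i j : nat) : nat := (i * j + n.-1) %/ n.

Lemma prodf_neq0_seq (R : idomainType) (I : eqType) (s : seq I) (F : I -> R) :
  (forall i, i \in s -> F i != 0) -> \prod_(i <- s) F i != 0.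
Proof. by move=> h; rewrite prodf_seq_neq0; apply/allP => i /h. Qed.

Lemma sqr_mul_eq0 (E : fieldType) (a b : E) : b != 0 -> a ^+ 2 * b = 0 -> a = 0.
Proof.
by move=> b0 /eqP; rewrite mulf_eq0 (negbTE b0) orbF expf_eq0 => /eqP.
Qed.

Section HolomorphicForms.
Variables (k : closedFieldType) (n : nat) (f : {poly k}).
Hypothesis n_prime : prime n.
Hypothesis n_odd : odd n.
Hypothesis char2 : 2%N \in [pchar k].
Hypothesis f_neq0 : f != 0.
Local Notation K := {fraction {poly k}}.
Variables (L : fieldType) (iota : {rmorphism K -> L}) (y : L).
Hypothesis yn : y ^+ n = iota (tofrac f).
Hypothesis gen : forall t : L, exists T : {poly K}, t = (map_poly iota T).[y].
Hypothesis uniq_coord : forall T : {poly K},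
  (size T <= n)%N -> (map_poly iota T).[y] = 0 -> T = 0.
Variable rs : seq k.
Hypothesis rs_uniq : uniq rs.
Hypothesis rsP : forall a, root f a = (a \in rs).

Let n_gt0 : (0 < n)%N. Proof. exact: prime_gt0. Qed.
Let n_gt2 : (2 < n)%N. Proof. by case: (n) n_prime n_odd => [|[|[|]]]. Qed.
Let two0 : 2%:R = 0 :> k. Proof. exact: pcharf0 char2. Qed.
Let fK0 : tofrac f != 0 :> K. Proof. by rewrite tofrac_eq0. Qed.

(** A common denominator of the coefficients of [y^j] in holomorphic forms: the inequality at [a]
    allows there a pole of order at most [j * mup a f / n], rounded up. *)
Definition den (j : nat) : {poly k} :=
  \prod_(a <- rs) ('X - a%:P) ^+ ceil_mul n (mup a f) j.

(** The number of coefficients of a numerator over [den j]: the condition at infinity requires order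
    at least [j * deg f %/ n + 2], so the numerator has degree at most
    [deg (den j) - (j * deg f %/ n) - 2]. Truncated subtraction gives 0 when this bound is
    negative. *)
Definition form_dim (j : nat) : nat :=
  ((\sum_(a <- rs) ceil_mul n (mup a f) j) - (j * (size f).-1 %/ n).+1)%N.

Lemma den_neq0 j : den j != 0.
Proof.
by apply: prodf_neq0_seq => a _; rewrite expf_neq0 // polyXsubC_eq0.
Qed.

Lemma mup_den a j : mup a (den j) = ceil_mul n (mup a f) j.
Proof.
rewrite /den; have [ars|ars] := boolP (a \in rs); last first.
  have -> : mup a f = 0%N by rewrite mupNroot // rsP.
  rewrite /ceil_mul mul0n add0n divn_small ?prednK //.
  rewrite mupNroot // /root horner_prod; apply: prodf_neq0_seq => b brs.
  rewrite horner_exp expf_neq0 // hornerXsubC subr_eq0.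
  by apply: contraNneq ars => ->.
rewrite (big_rem a) //= mupM ?expf_neq0 ?polyXsubC_eq0 //; last first.
  by apply: prodf_neq0_seq => b _; rewrite expf_neq0 // polyXsubC_eq0.
rewrite mup_XsubCX eqxx -[RHS]addn0; congr (_ + _)%N.
rewrite mupNroot // /root horner_prod.
apply: prodf_neq0_seq => b; rewrite mem_rem_uniq // inE => /andP[ba _].
by rewrite horner_exp expf_neq0 // hornerXsubC subr_eq0 eq_sym.
Qed.

Lemma size_den j : size (den j) = (\sum_(a <- rs) ceil_mul n (mup a f) j).+1.
Proof.
rewrite /den; elim: rs => [|a s IH]; first by rewrite !big_nil size_poly1.
rewrite !big_cons size_mul ?expf_neq0 ?polyXsubC_eq0 //; last first.
  by apply: prodf_neq0_seq => b _; rewrite expf_neq0 // polyXsubC_eq0.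
by rewrite size_exp_XsubC IH addSn addnS.
Qed.

Lemma coord_numerator (T : {poly K}) (l : nat) :
  (forall P, T`_l != 0 -> 1 - n%:Z + 2 * n%:Z * half_pole P <=
      n%:Z * ord P T`_l + ord P (tofrac f) * l%:Z) ->
  exists2 u : {poly k}, (size u <= form_dim l)%N
    & T`_l = tofrac u / tofrac (den l).
Proof.
move=> h; have [->|Tl] := eqVneq T`_l 0.
  by exists 0; rewrite ?size_poly0 // tofrac0 mul0r.
have d0 : tofrac (den l) != 0 :> K by rewrite tofrac_eq0 den_neq0.
have [||u su eu] := @poly_of_ord k (form_dim l) (T`_l * tofrac (den l)).
- move=> a; have := h (Some a) Tl.
  rewrite (vge_ord_mul _ _ Tl (den_neq0 l)) (ord_tofrac _ f_neq0) /=.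
  rewrite mup_den mulr0 addr0 /ceil_mul.
  move: (ord _ _) (mup a f) => o i.
  have := divn_eq (i * l + n.-1) n; have := ltn_pmod (i * l + n.-1) n_gt0.
  move: (_ %% _)%N (_ %/ _)%N => rr q; move: n n_gt0 => N N0.
  by move=> h1 h2 h3; nia.
- have := h None Tl.
  rewrite (vge_ord_mul _ _ Tl (den_neq0 l)) (ord_tofrac _ f_neq0) /=.
  rewrite size_den mulr1 /form_dim.
  have sf : (0 < size f)%N by rewrite size_poly_gt0.
  move: (\sum_(a <- rs) _)%N => S; move: (ord _ _) => o.
  have := divn_eq (l * (size f).-1) n; have := ltn_pmod (l * (size f).-1) n_gt0.
  move: (_ %% _)%N (_ %/ _)%N => rr q; move: (size f) sf => s s0.
  move: n n_gt0 => N N0 h1 h2 h3.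
  have : q%:Z + 2 <= o by nia.
  lia.
- by exists u => //; rewrite -eu mulfK.
Qed.

Local Notation I := {l : 'I_n & 'I_(form_dim l)}.
Let formT : finType := I.

Definition form (x : I) : L :=
  iota (tofrac 'X^(tagged x) / tofrac (den (tag x))) * y ^+ (tag x : 'I_n).

Definition form_numerator (a : I -> k) (l : 'I_n) : {poly k} :=
  \sum_(m < form_dim l) a (Tagged _ m) *: 'X^m.

Definition form_poly (a : I -> k) : {poly K} :=
  \poly_(j < n) (if insub j is Some l then
     tofrac (form_numerator a l) / tofrac (den l) else 0).

Lemma coef_form_poly a (l : 'I_n) :
  (form_poly a)`_l = tofrac (form_numerator a l) / tofrac (den l).
Proof. by rewrite coef_poly ltn_ord valK. Qed.

Lemma form_sum a : \sum_x iota (ratconst k (a x)) * form x = evy iota y (form_poly a).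
Proof.
rewrite /evy (@horner_coef_wide _ n) ?size_map_poly ?size_poly //.
transitivity (\sum_(l < n) \sum_(m < form_dim l)
    iota (ratconst k (a (Tagged _ m))) * form (Tagged _ m)).
  by rewrite sig_big_dep; apply: eq_bigr => -[l m].
apply: eq_bigr => l _; rewrite coef_map /= coef_form_poly rmorphM.
rewrite /form_numerator !rmorph_sum mulr_suml mulr_suml; apply: eq_bigr => m _.
rewrite /form /= -mul_polyC tofracM !rmorphM /ratconst /=; ring.
Qed.

Lemma form_poly_eq0 a (l : 'I_n) : (form_poly a)`_l = 0 ->
  forall m : 'I_(form_dim l), a (Tagged (fun l : 'I_n => 'I_(form_dim l)) m) = 0.
Proof.
rewrite coef_form_poly => /eqP; rewrite mulf_eq0 invr_eq0 !tofrac_eq0.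
rewrite (negbTE (den_neq0 l)) orbF => /eqP h m.
have := congr1 (fun p : {poly k} => p`_m) h.
rewrite /form_numerator coef0 coef_sum (bigD1 m) //= coefZ coefXn eqxx mulr1.
rewrite big1 ?addr0 // => j jm; rewrite coefZ coefXn.
by case: eqP => [/val_inj e|_]; [rewrite e eqxx in jm | rewrite mulr0].
Qed.

Lemma form_free a : \sum_x iota (ratconst k (a x)) * form x = 0 ->
  forall x, a x = 0.
Proof.
rewrite form_sum => h0 [l m].
have h : form_poly a = 0 by apply: uniq_coord h0; exact: size_poly.
by apply: form_poly_eq0; rewrite h coef0.
Qed.

Lemma double_mod_inj (i j : 'I_n) : (2 * i %% n = 2 * j %% n)%N -> i = j.
Proof.
have [lt_i lt_j] := (ltn_ord i, ltn_ord j).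
wlog le : i j lt_i lt_j / (i <= j)%N.
  move=> H e; have [le|/ltnW le] := leqP i j; first exact: H.
  by apply/esym/H.
move=> /eqP; rewrite eq_sym (eqn_mod_dvd n) ?leq_mul2l // -mulnBr.
rewrite Euclid_dvdM // => /orP[|].
  by move/(dvdn_leq (isT : 0 < 2)%N); rewrite leqNgt n_gt2.
have [->//|ne] := eqVneq i j; move=> /dvdn_leq.
have : (i != j :> nat) by [].
by move: lt_i lt_j le; move: (i : nat) (j : nat) => a b; lia.
Qed.

(** The square of a form of index [j] has index [2 j] modulo [n], and doubling is injective modulo
    [n]. Written as the square of one form, the sum therefore has no contributions that merge, and
    every [j] whose double is not [l] has zero coordinate. *)
Lemma form_square_support (q : I -> k) s (l : nat) : (l < n)%N ->
  \sum_x iota (ratconst k (q x)) * form x ^+ 2 = iota s * y ^+ l ->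
  forall x, q x != 0 -> l = (2 * tag x %% n)%N.
Proof.
move=> ln e; have two0L' : 2%:R = 0 :> L by exact: (two0L two0 iota).
have /choice[z hz] : forall x, exists z, q x = z ^+ 2 by move=> x; exact: const_sqr.
pose T := form_poly z.
have eT : evy iota y T ^+ 2 = iota s * y ^+ l.
  rewrite -e -form_sum sqr_sum_two0 //; apply: eq_bigr => x _.
  by rewrite exprMn hz !rmorphXn.
pose T2 := \sum_(j < n) (T`_j ^+ 2 * tofrac f ^+ (2 * j %/ n)) *: 'X^(2 * j %% n).
have sT2 : (size T2 <= n)%N.
  apply: leq_trans (size_sum _ _ _) _; apply/bigmax_leqP => j _.
  apply: leq_trans (size_scale_leq _ _) _.
  by rewrite size_polyXn ltn_pmod.
have eT2 : T2 = s *: 'X^l.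
  apply: (evy_inj uniq_coord) => //.
    by rewrite (leq_trans (size_scale_leq _ _)) // size_polyXn.
  rewrite evyZ evyXn -eT {2}/evy (@horner_coef_wide _ n) ?size_map_poly ?size_poly //.
  rewrite sqr_sum_two0 // /T2 evy_sum; apply: eq_bigr => j _.
  rewrite coef_map /= evyZ evyXn rmorphM !rmorphXn -yn -exprM -mulrA -exprD exprMn.
  by rewrite [(n * _)%N]mulnC -divn_eq mulnC exprM.
move=> [j m] qx /=; apply/eqP; apply: contraNT qx => lj.
rewrite hz expf_eq0 /=; apply/eqP; apply: form_poly_eq0.
have := congr1 (fun p : {poly K} => p`_(2 * j %% n)) eT2.
rewrite coefZ coefXn eq_sym (negbTE lj) mulr0 /T2 coef_sum (bigD1 j) //=.
rewrite coefZ coefXn eqxx mulr1 big1 ?addr0 => [|i ij].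
  by apply: sqr_mul_eq0; rewrite expf_neq0.
rewrite coefZ coefXn; case: eqP => [h|_]; last by rewrite mulr0.
by rewrite (double_mod_inj (esym h)) eqxx in ij.
Qed.

Lemma card_form_tag (j : 'I_n) : #|[set x : I | tag x == j]%SET| = form_dim j.
Proof.
rewrite -[RHS]card_ord -cardsT.
have <- : [set Tagged (fun l : 'I_n => 'I_(form_dim l)) m | m in [set: 'I_(form_dim j)]%SET]%SET
        = [set x : I | tag x == j]%SET.
  apply/setP => -[l m]; rewrite inE /=; apply/imsetP/eqP => [[m' _ e]|e].
    by have := congr1 tag e.
  by subst l; exists m; rewrite ?inE.
rewrite card_imset // => m m' e.
by move/eqP: e; rewrite eq_Tagged => /eqP.
Qed.

Lemma card_form : #|formT| = (\sum_(l < n) form_dim l)%N.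
Proof.
rewrite card_tagged sumnE big_map big_enum; apply: eq_bigr => l _.
by rewrite card_ord.
Qed.

(* If the 2-rank reaches the dimension of the space of forms, the Cartier      *)
(* operator is bijective; it maps the eigenspace of index [2j] into that of    *)
(* index [j], so that these have the same dimension.                           *)
Lemma ordinary_form_dim r :
  has_two_rank (fun a => iota (ratconst k a)) r ->
  (\sum_(l < n) form_dim l <= r)%N -> form_dim 2 = form_dim 1.
Proof.
move=> hr leNr.
have [W [Winj Wder Wb]] :=
  torsion_log_derivatives n_prime n_odd two0 f_neq0 yn gen uniq_coord hr.
have n3 := n_gt2.
rewrite -card_form in leNr.
pose e (m : 'I_#|formT|) := form (enum_val m : formT).
have two0L' : 2%:R = 0 :> L by exact: (two0L two0 iota).
have nsq := ratX_nsqr n_prime n_odd two0 f_neq0 yn gen uniq_coord.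
have sqL := sqdec_L n_odd two0 f_neq0 yn gen.
pose cc : {rmorphism k -> L} := iota \o ratconst k.
have reindex_sum (F : I -> L) : \sum_x F x = \sum_(m < #|formT|) F (enum_val m).
  exact: (reindex enum_val (onW_bij _ (@enum_val_bij formT))).
have [|||||Q Qu hQ] := @frobenius_matrix k L cc char2 two0L' (dL iota) _ _ _ _ e _
  r W Winj Wder _ leNr.
- exact: (derX0 two0L' nsq).
- exact: (derXD two0L' nsq sqL).
- move=> a t; have [b ->] := const_sqr a.
  by rewrite rmorphXn; exact: (derX_sqrM two0L' nsq sqL).
- move=> a h m.
  have := @form_free (a \o enum_rank).
  rewrite reindex_sum; under eq_bigr => j _ do rewrite /= enum_valK.
  by move=> /(_ h (enum_val m)); rewrite /= enum_valK.
- move=> i; have [T sT eT] := coord n_gt0 yn gen (W i).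
  have /choice[u hu] : forall l : 'I_n, exists u : {poly k},
      (size u <= form_dim l)%N /\ T`_l = tofrac u / tofrac (den l).
    move=> l; have [|u su eu] := @coord_numerator T l; last by exists u.
    by move=> P; exact: (Wb i T sT eT P l).
  pose a (x : I) := (u (tag x))`_(tagged x).
  exists (a \o enum_val).
  transitivity (\sum_x iota (ratconst k (a x)) * form x); last by rewrite reindex_sum.
  rewrite form_sum eT.
  congr (evy iota y _); apply/polyP => j; have [jn|jn] := ltnP j n; last first.
    by rewrite !nth_default // ?(leq_trans (size_poly _ _)) // (leq_trans sT).
  rewrite -[j]/(val (Ordinal jn)) coef_form_poly; have [su ->] := hu (Ordinal jn).
  congr (tofrac _ / _); rewrite /form_numerator /a /=.
  rewrite -[LHS](coefK (u (Ordinal jn))) poly_def.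
  rewrite (big_ord_widen _ (fun m => (u (Ordinal jn))`_m *: 'X^m) su).
  rewrite big_mkcond /=; apply: eq_bigr => m _; case: ltnP => // h.
  by rewrite nth_default // scale0r.
(* The derivation keeps the index of a form, whereas [hQ] expands the result in squares, whose
   indices are doubled. *)
have supp l m : Q l m != 0 ->
    tag (enum_val l) = (2 * tag (enum_val m) %% n)%N :> nat.
  move=> Qlm; have [s hs] := dL_mono n_prime n_odd two0 f_neq0 yn gen uniq_coord
    (tofrac 'X^(tagged (enum_val l)) / tofrac (den (tag (enum_val l)))) (tag (enum_val l)).
  have := hQ l; rewrite {1}/e /form hs => /esym e1.
  have e2 : \sum_x iota (ratconst k (Q l (enum_rank x))) * form x ^+ 2
     = iota s * y ^+ tag (enum_val l).
    by rewrite reindex_sum -e1; apply: eq_bigr => j _; rewrite /= enum_valK.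
  by have := form_square_support (ltn_ord _) e2 (x := enum_val m); rewrite enum_valK; apply.
have n1 : (1 < n)%N by exact: ltnW.
have cardS (j : 'I_n) : #|[set m : 'I_#|formT| | tag (enum_val m) == j]%SET| = form_dim j.
  rewrite -card_form_tag -[RHS](on_card_preimset (f := enum_val : 'I_#|formT| -> formT)
    (onW_bij _ (@enum_val_bij formT))).
  by apply: eq_card => m; rewrite !inE.
have := unitmx_card_eq (S := [set m | tag (enum_val m) == Ordinal n3]%SET)
  (T := [set m | tag (enum_val m) == Ordinal n1]%SET) Qu.
rewrite !cardS /=; apply=> l m /supp; rewrite !inE => e1.
have lt := ltn_ord (tag (enum_val m)).
rewrite -!val_eqE /= e1; move: (val (tag (enum_val m))) lt => t lt.
have [le|le] := ltnP (2 * t)%N n; first by rewrite modn_small //; lia.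
have -> : (2 * t %% n = 2 * t - n)%N.
  by rewrite -{1}(subnK le) modnDr modn_small //; lia.
by move: n_odd; lia.
Qed.

End HolomorphicForms.

(** * Ramification and the genus *)

Section CardFsetSet.
Variable T : choiceType.
Implicit Types (S : set T) (s : seq T).

Lemma finite_set_seq S s : (forall x, S x -> x \in s) -> finite_set S.
Proof.
by move=> h; apply: (@sub_finite_set _ _ [set` s]).
Qed.

Lemma card_fset_set_le S s : (forall x, S x -> x \in s) ->
  (#|` fset_set S| <= size s)%N.
Proof.
move=> h; have fS := finite_set_seq h.
apply: uniq_leq_size; first exact: fset_uniq.
by move=> x; rewrite in_fset_set // inE => /h.
Qed.

Lemma card_fset_set_ge S s : finite_set S -> uniq s -> (forall x, x \in s -> S x) ->
  (size s <= #|` fset_set S|)%N.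
Proof.
move=> fS us h; apply: uniq_leq_size => // x /h xS.
by rewrite in_fset_set // inE.
Qed.

End CardFsetSet.

Lemma sum_mup_roots (k : closedFieldType) (p : {poly k}) (rs : seq k) : p != 0 -> uniq rs ->
  (forall a, root p a -> a \in rs) -> (\sum_(a <- rs) mup a p)%N = (size p).-1.
Proof.
move=> p0 urs hrs; have [s es] := closed_field_poly_normal p.
have lc0 : lead_coef p != 0 by rewrite lead_coef_eq0.
have mupE a : mup a p = count_mem a s.
  by rewrite es -mul_polyC mupMr ?mu_prod_XsubC // rootC.
have srs z : z \in s -> z \in rs.
  by move=> zs; apply: hrs; rewrite es rootZ // root_prod_XsubC.
have -> : (size p).-1 = size s by rewrite es size_scale // size_prod_XsubC.
transitivity (\sum_(a <- rs) count_mem a s)%N; first by apply: eq_bigr.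
under eq_bigr => a _ do rewrite -sum1_count big_mkcond.
rewrite exchange_big /= -[RHS]sum1_size big_seq [RHS]big_seq.
apply: eq_bigr => z /srs zrs; rewrite -big_mkcond /= sum1_count.
by rewrite (eq_count (a2 := pred1 z)) ?count_uniq_mem ?zrs // => a /=; rewrite eq_sym.
Qed.

Section Ramification.
Variables (k : closedFieldType) (n : nat) (f : {poly k}).
Hypothesis n_prime : prime n.
Hypothesis n_odd : odd n.
Hypothesis char2 : 2%N \in [pchar k].
Hypothesis f_neq0 : f != 0.
Variable rs : seq k.
Hypothesis rs_uniq : uniq rs.
Hypothesis rsP : forall a, root f a = (a \in rs).

Let n_gt0 : (0 < n)%N. Proof. exact: prime_gt0. Qed.
Let n_gt2 : (2 < n)%N. Proof. by case: (n) n_prime n_odd => [|[|[|]]]. Qed.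
Let two0 : 2%:R = 0 :> k. Proof. exact: pcharf0 char2. Qed.

Lemma unramified_over a : ~~ root f a -> ~ ramified_over n f (Some a).
Proof.
move=> fa [irr [v]]; case: v => w hw /= w1.
pose iota : {rmorphism {fraction {poly k}} -> function_field irr} := of_ratfun irr.
have e_gt0 : 0 < w (iota (uniformizer (Some a))) by rewrite (lt_trans _ w1).
have we z : z != 0 -> w (iota z) = w (iota (uniformizer (Some a))) * ord (Some a) z.
  by apply: place_over_point.
have vf : ord (Some a) (tofrac f) = 0 by rewrite ord_tofrac //= mupNroot.
have fK0 : tofrac f != 0 :> {fraction {poly k}} by rewrite tofrac_eq0.
have := unramified_index (ord_is_place (Some a)) n_gt0 fK0 (yL_exp irr)
  (@yL_gen _ _ _ irr) (@yL_uniq _ _ _ n_gt0 irr) vf (odd_natr_neq0 n_odd two0)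
  (@ord_residue _ (Some a)) hw e_gt0 we.
by move: w1; rewrite -/(w (iota _)) => + e1; rewrite [w _]e1.
Qed.

Lemma ramified_overP P : ramified_over n f P -> P \in None :: [seq Some a | a <- rs].
Proof.
case: P => [a|]; last by rewrite mem_head.
move=> h; rewrite inE /=; apply/mapP; exists a => //; rewrite -rsP.
by apply: contraT => /unramified_over.
Qed.

Lemma ramified_points_le : (ramified_points n f <= (size rs).+1)%N.
Proof. by rewrite -(size_map Some rs); exact: (card_fset_set_le ramified_overP). Qed.

Hypothesis mup_lt : forall a, (mup a f < n)%N.

(** Over a point where [n] does not divide the order of [f], some place has index [n]. At a root
    this order lies strictly between 0 and [n]; at infinity it is minus the degree. *)
Lemma ramified_points_ge (irr : monic_irreducible_poly (superelliptic_poly n f)) :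
  (size rs + ~~ (n %| (size f).-1) <= ramified_points n f)%N.
Proof.
have fin := finite_set_seq ramified_overP.
have ex P := exists_place n_prime n_odd two0 f_neq0 (yL_exp irr)
  (@yL_gen _ _ _ irr) (@yL_uniq _ _ _ n_gt0 irr) P.
have ram P : ~~ (n%:Z %| ord P (tofrac f))%Z -> ramified_over n f P.
  have [w [e [hw _ en we]]] := ex P => /en e_n; exists irr, (Place hw).
  rewrite [X in 1 < X](we _ (uniformizer_neq0 P)) ord_uniformizer mulr1 e_n.
  by rewrite ltz_nat prime_gt1.
pose s := if (n %| (size f).-1)%N then [::] else [:: None : option k].
have -> : (size rs + ~~ (n %| (size f).-1))%N = size ([seq Some a | a <- rs] ++ s).
  by rewrite size_cat size_map /s; case: (_ %| _)%N.
apply: card_fset_set_ge => //.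
  rewrite cat_uniq map_inj_uniq ?rs_uniq; last by move=> ? ? [].
  rewrite /s; case: (_ %| _)%N => //=; rewrite andbT orbF.
  by apply/mapP => -[].
move=> P; rewrite mem_cat => /orP[/mapP[a ars ->]|].
  apply: ram; rewrite ord_tofrac //= dvdzE /=.
  by rewrite gtnNdvd ?mup_lt // -XsubC_dvd // dvdp_XsubCl rsP.
rewrite /s; case: ifPn => // nd; rewrite inE => /eqP ->.
apply: ram; rewrite ord_tofrac //= dvdzE /=.
have sf : (0 < size f)%N by rewrite size_poly_gt0.
suff -> : absz (1 - (size f)%:Z) = (size f).-1 by [].
by move: (size f) sf => s' s'0; lia.
Qed.

Lemma sum_mup : (\sum_(a <- rs) mup a f)%N = (size f).-1.
Proof. by apply: sum_mup_roots => // a; rewrite rsP. Qed.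

Let S j := (\sum_(a <- rs) ceil_mul n (mup a f) j)%N.

Let mup_gt0 a : a \in rs -> (0 < mup a f)%N.
Proof. by rewrite -rsP -XsubC_dvd // dvdp_XsubCl. Qed.

Lemma ceil_mul_ge i j : (0 < i < n)%N -> (0 < j < n)%N ->
  (i * j < n * ceil_mul n i j)%N.
Proof.
move=> /andP[i0 i_n] /andP[j0 jn]; rewrite /ceil_mul.
have nd : ~~ (n %| i * j)%N by rewrite Euclid_dvdM // !gtnNdvd.
have := divn_eq (i * j + n.-1) n; have := ltn_pmod (i * j + n.-1) n_gt0.
have ne q : (i * j)%N <> (q * n)%N by move=> h; rewrite h dvdn_mull in nd.
move: (_ %% _)%N (_ %/ _)%N => r q h1 h2; have := ne q.
by move: (i * j)%N (n) n_gt0 h1 h2 => a b; rewrite [(b * q)%N]mulnC; nia.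
Qed.

(** The fractions [i j / n] and [i (n - j) / n] add up to [i] and are not integers, so rounding both
    up adds exactly 1. *)
Lemma ceil_mul_opp i j : (0 < i < n)%N -> (0 < j < n)%N ->
  (ceil_mul n i j + ceil_mul n i (n - j) = i.+1)%N.
Proof.
move=> hi hj; have /andP[j0 jn] := hj.
have hj' : (0 < n - j < n)%N by lia.
have := ceil_mul_ge hi hj; have := ceil_mul_ge hi hj'.
have up a b : (n * ceil_mul n a b < a * b + n)%N.
  rewrite /ceil_mul; have := divn_eq (a * b + n.-1) n.
  move: (_ %% _)%N (_ %/ _)%N => r q; move: (a * b)%N => c.
  by rewrite [(n * q)%N]mulnC; lia.
have := up i j; have := up i (n - j)%N.
have e : (i * j + i * (n - j) = n * i)%N by rewrite -mulnDr subnKC 1?ltnW // mulnC.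
move: (ceil_mul _ _ _) (ceil_mul _ _ _) e => A B; move: (i * j)%N (i * (n - j))%N => u v.
by move: n_gt0 => n0 *; nia.
Qed.

(** This makes the truncated subtraction in [form_dim] exact: at each root the rounding is strict,
    hence so is the inequality between the sums. *)
Lemma form_dim_ge j : rs != [::] -> (0 < j < n)%N ->
  (j * (size f).-1 %/ n < S j)%N.
Proof.
move=> rs0 hj; rewrite ltn_divLR // -sum_mup big_distrr /= /S big_distrl /=.
case: rs rs0 mup_gt0 => // a s _ gt0; rewrite !big_cons.
have lt b : b \in a :: s -> (j * mup b f < ceil_mul n (mup b f) j * n)%N.
  move=> hb; rewrite mulnC [X in (_ < X)%N]mulnC.
  by apply: ceil_mul_ge => //; rewrite gt0 //= mup_lt.
rewrite -addSn leq_add ?lt ?mem_head //.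
rewrite big_seq [X in (_ <= X)%N]big_seq leq_sum // => b hb.
by rewrite ltnW // lt // inE hb orbT.
Qed.

(** Pairing [j] with [n - j] removes all floors and ceilings: the ceilings add up to [mup a f + 1]
    at each root, the floors to the degree, less 1 if [n] does not divide it. The total dimension
    follows without computing any single one. *)
Lemma form_dim_opp j : rs != [::] -> (0 < j < n)%N ->
  (form_dim n f rs j + form_dim n f rs (n - j))%:Z
  = (size rs)%:Z + (~~ (n %| (size f).-1)%N)%:Z - 2.
Proof.
move=> rs0 hj; have hj' : (0 < n - j < n)%N by lia.
have := form_dim_ge rs0 hj; have := form_dim_ge rs0 hj'.
rewrite /form_dim -!/(S _).
have eS : (S j + S (n - j) = size rs + (size f).-1)%N.
  rewrite /S -big_split /= -sum_mup -sum1_size -big_split /=.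
  rewrite big_seq [RHS]big_seq; apply: eq_bigr => a ars.
  by rewrite ceil_mul_opp // mup_gt0 // mup_lt.
have eF : (j * (size f).-1 %/ n + (n - j) * (size f).-1 %/ n + ~~ (n %| (size f).-1)
    = (size f).-1)%N.
  move: ((size f).-1) => d.
  have e : (j * d + (n - j) * d = d * n)%N by rewrite -mulnDl subnKC 1?ltnW 1?mulnC; lia.
  have dv : (n %| j * d)%N = (n %| d)%N.
    by rewrite Euclid_dvdM // gtnNdvd //; lia.
  have := divn_eq (j * d) n; have := ltn_pmod (j * d) n_gt0.
  have := divn_eq ((n - j) * d) n; have := ltn_pmod ((n - j) * d) n_gt0.
  have r0 : (j * d %% n == 0)%N = (n %| d)%N by rewrite -dv.
  move: r0 e; move: (j * d)%N ((n - j) * d)%N => u v r0.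
  move: r0; move: (u %% n)%N (u %/ n)%N (v %% n)%N (v %/ n)%N => ru qu rv qv.
  move=> r0 e rvn ev run eu.
  have ed : d = (qu + qv + (ru + rv) %/ n)%N.
    by rewrite -divnMDl // -[LHS](mulnK d n_gt0) -e ev eu; congr (_ %/ _)%N; ring.
  rewrite [RHS]ed; congr (_ + _)%N; move: r0; case: (n %| d)%N => /= [/eqP -> | /negbT r0].
    by rewrite divn_small.
  have lt2 : ((ru + rv) %/ n < 2)%N by rewrite ltn_divLR //; lia.
  have [x0|//] : ((ru + rv) %/ n = 0 \/ 1 = (ru + rv) %/ n)%N.
    by move: lt2; case: (_ %/ _)%N => [|[|]]; [left | right |].
  have : (d * n = (qu + qv) * n)%N by rewrite {1}ed x0 addn0.
  by rewrite -e ev eu mulnDl; lia.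
move: (S j) (S (n - j)) (j * _ %/ n)%N ((n - j) * _ %/ n)%N eS eF => s s' q q'.
by case: (n %| _)%N => /=; lia.
Qed.

Lemma form_dim0 : form_dim n f rs 0 = 0%N.
Proof.
rewrite /form_dim big1 ?sub0n // => a _.
by rewrite /ceil_mul muln0 add0n divn_small // prednK.
Qed.

Lemma sum_form_dim : rs != [::] ->
  2 * (\sum_(l < n) form_dim n f rs l)%N%:Z
  = (n%:Z - 1) * ((size rs)%:Z + (~~ (n %| (size f).-1)%N)%:Z - 2).
Proof.
move=> rs0; have e : (\sum_(l < n) form_dim n f rs l
    = \sum_(1 <= l < n) form_dim n f rs l)%N.
  by rewrite -(big_mkord xpredT) big_ltn // form_dim0 add0n.
have e' : (\sum_(1 <= l < n) form_dim n f rs l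
    = \sum_(1 <= l < n) form_dim n f rs (n - l))%N.
  rewrite big_nat_rev /=; apply: eq_big_nat => l hl; congr form_dim; lia.
have e2 : (2 * \sum_(l < n) form_dim n f rs l
    = \sum_(1 <= l < n) (form_dim n f rs l + form_dim n f rs (n - l)))%N.
  by rewrite big_split /= -e' e mul2n addnn.
transitivity (2 * \sum_(l < n) form_dim n f rs l)%N%:Z; first by rewrite PoszM.
rewrite e2 (big_morph Posz PoszD (erefl _)).
rewrite big_nat; under eq_bigr => l hl do rewrite form_dim_opp //.
rewrite -big_nat; move: (_ + _ - 2) => b.
by rewrite sumr_const_nat -mulr_natl natz -subzn // prime_gt0.
Qed.

(** The relation is [form_dim 2 = form_dim 1] with the ceilings evaluated; the truncated
    subtractions are removed by [form_dim_ge]. *)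
Lemma ordinary_curve_relation : ordinary_curve n f ->
  (size rs <= ramified_points n f)%N /\
  (count (fun a => n < 2 * mup a f)%N rs + (size f).-1 %/ n
   = 2 * (size f).-1 %/ n)%N.
Proof.
move=> [irr [r [hr rg]]]; have ge := ramified_points_ge irr.
split; first by rewrite (leq_trans _ ge) // leq_addr.
(* Without roots at most infinity could ramify, and the genus would be negative, hence not a
   2-rank. *)
have rs0 : rs != [::].
  apply/negP => /eqP rs0; have := ramified_points_le; rewrite rs0 /=.
  move: rg; rewrite /genus; move: (ramified_points n f) => m rg m1.
  have : 0 <= (((n%:Z - 1) * (m%:Z - 2)) %/ 2)%Z by rewrite -rg.
  rewrite lez_divRL // mul0r => h; have := n_gt2; nia.
(* The exact total of the dimensions meets the lower bound on the genus, which on an ordinary curve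
   is [r]. *)
have hN : (\sum_(l < n) form_dim n f rs l <= r)%N.
  have := sum_form_dim rs0; rewrite -lez_nat rg /genus => e.
  rewrite lez_divRL // mulrC e ler_wpM2l //; first by have := n_gt0; lia.
  move: ge; move: (ramified_points n f) (_ %| _)%N => m b; case: b => /=; lia.
have := ordinary_form_dim n_prime n_odd char2 f_neq0 (yL_exp irr)
  (@yL_gen _ _ _ irr) (@yL_uniq _ _ _ n_gt0 irr) rs_uniq rsP hr hN.
have h1 : (0 < 1 < n)%N by rewrite prime_gt1.
have h2 : (0 < 2 < n)%N by rewrite n_gt2.
have := form_dim_ge rs0 h1; have := form_dim_ge rs0 h2; rewrite /form_dim -!/(S _).
(* For [0 < i < n] the ceiling of [i / n] is 1. *)
have -> : S 1 = size rs.
  rewrite -sum1_size /S big_seq [RHS]big_seq; apply: eq_bigr => a ars.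
  have := ceil_mul_ge (i := mup a f) (j := 1); rewrite mup_gt0 // mup_lt h1 => /(_ isT isT).
  rewrite /ceil_mul muln1; have := mup_lt a; have := mup_gt0 ars.
  move: (mup a f) => i i0 i_n _.
  rewrite -[X in (X %/ _)%N](_ : n + i.-1 = _)%N; last by lia.
  by rewrite divnDl ?dvdnn // divnn n_gt0 divn_small //; lia.
(* The ceiling of [2 i / n] is 2 if [2 i > n] and 1 if [2 i < n]; equality is excluded as [n] is
   odd. *)
have -> : (S 2 = size rs + count (fun a => n < 2 * mup a f) rs)%N.
  rewrite -sum1_size -sum1_count [X in (_ = _ + X)%N]big_mkcond -big_split /= /S.
  rewrite big_seq [RHS]big_seq; apply: eq_bigr => a ars.
  have := mup_lt a; have := mup_gt0 ars; rewrite /ceil_mul.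
  move: (mup a f) => i i0 i_n; rewrite [(2 * i)%N]mulnC.
  have ne : (i * 2 != n)%N by apply: contraL n_odd => /eqP <-; rewrite oddM andbF.
  case: ltnP => h.
    rewrite -[X in (X %/ _)%N](_ : 2 * n + (i * 2 - n).-1 = _)%N; last by lia.
    by rewrite divnMDl // divn_small //; lia.
  rewrite -[X in (X %/ _)%N](_ : 1 * n + (i * 2).-1 = _)%N; last by lia.
  by rewrite divnMDl // divn_small //; lia.
rewrite mul1n; lia.
Qed.

End Ramification.

(** * Power-free polynomials *)

Section Factorization.
Variable F : finFieldType.
Hypothesis char2 : 2%N \in [pchar F].
Implicit Types (p f u : {poly F}).

Lemma finfield_sqr (a : F) : exists b, a = b ^+ 2.
Proof.
have inj : injective (pFrobenius_aut char2) by exact: fmorph_inj.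
have [g _ gK] := injF_bij inj.
by exists (g a); rewrite -pFrobenius_autE gK.
Qed.

Lemma deriv_eq0_sqr p : p^`() = 0 -> exists u, p = u ^+ 2.
Proof.
move=> dp; have /choice[rt hrt] := finfield_sqr.
have pchar2 : 2%N \in [pchar {poly F}] by rewrite pchar_poly.
exists (\poly_(i < size p) rt p`_(2 * i)%N).
rewrite -(pFrobenius_autE pchar2) poly_def rmorph_sum.
under eq_bigr => i _ do
  rewrite /= pFrobenius_autE exprZn -hrt -exprM [(i * 2)%N]mulnC.
apply/polyP => j; rewrite coef_sum.
have odd0 i : odd i -> p`_i = 0.
  case: i => // i oi; have := congr1 (fun r : {poly F} => r`_i) dp.
  rewrite coef_deriv coef0 -mulr_natr -(odd_double_half i.+1) oi -mul2n natrD natrM.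
  by rewrite (pcharf0 char2) mul0r addr0 mulr1.
have [oj|ej] := boolP (odd j).
  rewrite odd0 // big1 // => i _; rewrite coefZ coefXn.
  by case: eqP => [h|]; rewrite ?mulr0 //; rewrite h oddM in oj.
have [lt|le] := ltnP j (size p); last first.
  rewrite nth_default // big1 // => i _; rewrite coefZ coefXn.
  by case: eqP => [<-|]; rewrite ?mulr0 // mulr1 nth_default.
have hj : (j./2 < size p)%N.
  have := odd_double_half j; move: lt; rewrite -addnn.
  by move: (size p) (j./2) (odd j) => s h b; lia.
have ej2 : (2 * j./2 = j)%N by rewrite mul2n -[RHS]odd_double_half (negbTE ej).
rewrite (bigD1 (Ordinal hj)) //= coefZ coefXn ej2 eqxx mulr1 big1 ?addr0 // => i ne.
rewrite coefZ coefXn; case: eqP => [h|]; rewrite ?mulr0 //.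
by case/eqP: ne; apply: val_inj => /=; rewrite h mul2n doubleK.
Qed.

Lemma irreducible_deriv_neq0 p : irreducible_poly p -> p^`() != 0.
Proof.
move=> [sp irr]; apply/negP => /eqP /deriv_eq0_sqr[u pu].
have u0 : u != 0 by apply: contraTneq sp => u0; rewrite pu u0 expr0n size_poly0.
have su : size u != 1%N.
  by apply: contraTneq sp => su; rewrite pu expr2 size_mul // su.
have /eqp_size : u %= p by apply: irr => //; rewrite pu dvdp_mulr.
rewrite pu expr2 size_mul //; move: su u0; rewrite -size_poly_gt0.
by move: (size u) => s; lia.
Qed.

Lemma irreducible_coprime_deriv p : irreducible_poly p -> coprimep p p^`().
Proof.
move=> irr; have d0 := irreducible_deriv_neq0 irr.
rewrite irreducible_poly_coprime //; apply/negP => /(dvdp_leq d0).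
rewrite leqNgt lt_size_deriv //; apply: contraTneq irr.1 => ->.
by rewrite size_poly0.
Qed.

Lemma irreducible_dvdM p a b : irreducible_poly p -> p %| a * b ->
  (p %| a) || (p %| b).
Proof.
move=> irr pab; have [//|npa] := boolP (p %| a).
have cpa : coprimep p a by rewrite irreducible_poly_coprime.
by move: pab; rewrite (Gauss_dvdpr _ cpa).
Qed.

Lemma irreducible_dvd_prod p (I : finType) (A : pred I) (g : I -> {poly F}) :
  irreducible_poly p -> p %| \prod_(i | A i) g i -> exists2 i, A i & p %| g i.
Proof.
move=> irr; elim/big_rec: _ => [|i x Ai IH].
  rewrite dvdp1 => /eqP sp; by have := irr.1; rewrite sp.
by move=> /(irreducible_dvdM irr)/orP[pi|/IH //]; exists i.
Qed.

Lemma exists_irreducible_factor f : size f != 1%N -> f != 0 ->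
  exists p, [/\ p \is monic, irreducible_poly p & p %| f].
Proof.
have [N] := ubnP (size f); elim: N f => // N IH f; rewrite ltnS => sN sf f0.
have lc : lead_coef f != 0 by rewrite lead_coef_eq0.
have sf1 : (1 < size f)%N by rewrite ltn_neqAle eq_sym sf size_poly_gt0.
have [irr|] := pselect (forall q : {poly F}, size q != 1 -> q %| f -> q %= f).
  exists ((lead_coef f)^-1 *: f); split.
  - by rewrite monicE lead_coefZ mulVf.
  - split=> [|q sq]; first by rewrite size_scale ?invr_eq0.
    rewrite dvdpZr ?invr_eq0 // => /(irr _ sq) qf.
    by rewrite (eqp_trans qf) // eqp_sym eqp_scale // invr_eq0.
  - by rewrite dvdpZl ?invr_eq0.
move=> /existsNP[q /not_implyP[sq /not_implyP[qf /negP nqf]]].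
have q0 : q != 0 by apply: contraNneq f0 => q0; rewrite q0 dvd0p in qf.
have lt : (size q < size f)%N.
  rewrite ltn_neqAle dvdp_leq // andbT.
  by apply: contra nqf => e; rewrite -dvdp_size_eqp.
have [p [pm pirr pq]] := IH q (leq_trans lt sN) sq q0.
by exists p; split=> //; exact: dvdp_trans pq qf.
Qed.

(** Take [p] irreducible dividing [f = u p] and its derivative. Then [p] divides [u p'], hence [u],
    because it is coprime to [p']. *)
Lemma nonseparable_square f : f != 0 -> ~~ separable_poly f ->
  exists p, [/\ p \is monic, irreducible_poly p & p ^+ 2 %| f].
Proof.
move=> f0; rewrite unlock /coprimep => sg.
have g0 : gcdp f f^`() != 0 by rewrite gcdp_eq0 (negbTE f0).
have [p [pm pirr pg]] := exists_irreducible_factor sg g0.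
exists p; split=> //.
have /dvdpP[u fu] := dvdp_trans pg (dvdp_gcdl _ _).
have := dvdp_trans pg (dvdp_gcdr _ _).
have h : p %| u^`() * p by exact: dvdp_mull.
rewrite fu derivM (dvdp_addr _ h).
rewrite (Gauss_dvdpl _ (irreducible_coprime_deriv pirr)) => /dvdpP[t ->].
by rewrite -mulrA -expr2 dvdp_mull.
Qed.

(** Indices start at 0: [g i] is the factor [f_(i+1)], of exponent [i + 1]. *)
Definition powprod (N : nat) (g : 'I_N -> {poly F}) : {poly F} :=
  \prod_i g i ^+ i.+1.

(** Induction on the degree, removing one irreducible factor [p]. Putting [p] back, it enters the
    factor of exponent 1 if it is new; otherwise it moves from [g i] to the next one, which leaves
    the product of the [g i] unchanged. It cannot leave the last one, since [p^n] would divide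
    [f]. *)
Lemma power_free_factorization n f : (1 < n)%N -> f != 0 -> power_free n f ->
  exists c (g : 'I_n.-1 -> {poly F}), [/\ c != 0, forall i, g i \is monic,
    separable_poly (\prod_i g i) & f = c *: powprod g].
Proof.
move=> n1; have [N] := ubnP (size f); elim: N f => // N IH f; rewrite ltnS => sN f0 pf.
have [/size_poly1P[c c0 fc]|sf] := boolP (size f == 1%N).
  exists c, (fun _ => 1); split=> // [i||]; first exact: monic1.
    by rewrite big1 // unlock coprime1p.
  by rewrite /powprod big1 ?alg_polyC // => i _; rewrite expr1n.
have [p [pm pirr pf1]] := exists_irreducible_factor sf f0.
have /dvdpP[f1 ef] := pf1.
have f10 : f1 != 0 by apply: contraNneq f0 => h; rewrite ef h mul0r.
have p0 : p != 0 by rewrite monic_neq0.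
have lt : (size f1 < N)%N.
  apply: leq_trans sN; rewrite ef size_mul //; have := pirr.1.
  by move: (size f1) (size p) => a b; lia.
have [|c [g [c0 gm gsep ef1]]] := IH f1 lt f10.
  by move=> u hu; apply: pf; rewrite ef dvdp_mulr.
have [/(irreducible_dvd_prod pirr)[i _ /dvdpP[u gu]]|np] := boolP (p %| \prod_i g i); last first.
  have N0 : (0 < n.-1)%N by rewrite -subn1 subn_gt0.
  pose i0 := Ordinal N0.
  pose g' i := if i == i0 then g i * p else g i.
  have g'0 i : i != i0 -> g' i = g i by rewrite /g' => /negbTE ->.
  exists c, g'; split=> //.
  - by move=> i; rewrite /g'; case: eqP => // _; rewrite monicMl.
  - have -> : \prod_i g' i = \prod_i g i * p.
      rewrite (bigD1 i0) //= [in RHS](bigD1 i0) //= /g' eqxx mulrAC; congr (_ * _ * _).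
      by apply: eq_bigr => i /g'0.
    rewrite separable_mul gsep /= coprimep_sym irreducible_poly_coprime // np andbT.
    by rewrite unlock irreducible_coprime_deriv.
  - rewrite ef ef1 -scalerAl; congr (_ *: _).
    rewrite /powprod (bigD1 i0) //= [in RHS](bigD1 i0) //= /g' eqxx !expr1 mulrAC.
    by congr (_ * _ * _); apply: eq_bigr => i /g'0; rewrite /g' => ->.
have um : u \is monic by move: (gm i); rewrite gu monicMr.
have [lti|gei] := ltnP i.+1 n.-1; last first.
  have : p ^+ n %| f.
    have -> : n = i.+2 by have := ltn_ord i; move: gei; lia.
    rewrite exprS ef mulrC dvdp_mul // ef1 dvdpZr // /powprod (bigD1 i) //= gu.
    by rewrite exprMn -mulrA dvdp_mull // dvdp_mulr.
  by move=> /pf sp; have := pirr.1; rewrite sp.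
pose i' := Ordinal lti.
have ii' : i' != i by rewrite -val_eqE /= neq_ltn ltnSn orbT.
pose g' j := if j == i then u else if j == i' then g j * p else g j.
have g'0 j : (j != i) && (j != i') -> g' j = g j.
  by rewrite /g' => /andP[/negbTE -> /negbTE ->].
have [g'i g'i'] : g' i = u /\ g' i' = g i' * p by rewrite /g' !eqxx (negbTE ii').
exists c, g'; split=> //.
- move=> j; rewrite /g'; case: eqP => // _; case: eqP => // _; by rewrite monicMl.
- have -> // : \prod_j g' j = \prod_j g j.
  rewrite (bigD1 i) //= (bigD1 i') //= [in RHS](bigD1 i) //= [in RHS](bigD1 i') //=.
  have -> : \prod_(j | (j != i) && (j != i')) g' j
    = \prod_(j | (j != i) && (j != i')) g j by apply: eq_bigr => j; exact: g'0.
  rewrite g'i g'i' gu.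
  by move: (\prod_(j | _) _) => P; ring.
- rewrite ef ef1 -scalerAl; congr (_ *: _).
  rewrite /powprod (bigD1 i) //= (bigD1 i') //= [in RHS](bigD1 i) //= [in RHS](bigD1 i') //=.
  have -> : \prod_(j | (j != i) && (j != i')) g' j ^+ j.+1
    = \prod_(j | (j != i) && (j != i')) g j ^+ j.+1.
    by apply: eq_bigr => j /g'0 ->.
  rewrite g'i g'i' gu.
  rewrite !exprMn [p ^+ i.+2]exprS.
  set P := (X in _ * (_ * X) * _ = _); set P' := (X in _ = _ * (_ * X)).
  by have -> : P' = P by []; ring.
Qed.

End Factorization.

Section RootData.
Variables (F : finFieldType) (Fbar : closedFieldType).
Variable iota : {rmorphism F -> Fbar}.
Local Notation im := (map_poly iota).

Lemma separable_mup (p : {poly Fbar}) a : separable_poly p -> root p a -> mup a p = 1%N.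
Proof.
move=> sp pa; have p0 : p != 0.
  by apply: contraTneq sp => ->; rewrite unlock deriv0 coprimep0 eqp01.
apply/eqP; rewrite eqn_leq -XsubC_dvd // dvdp_XsubCl pa andbT mup_leq //.
apply/negP => /dvdpP[u pu]; move: sp; rewrite unlock => /Pdiv.ClosedField.coprimepP/(_ a pa).
rewrite pu expr2 mulrA derivM derivM derivXsubC !hornerE.
by rewrite !(subrr, mulr0, mul0r, addr0) eqxx.
Qed.

Lemma mup_prod (I : finType) (g : I -> {poly Fbar}) a : (forall i, g i != 0) ->
  mup a (\prod_i g i) = (\sum_i mup a (g i))%N.
Proof.
move=> g0; suff [] : mup a (\prod_i g i) = (\sum_i mup a (g i))%N
    /\ \prod_i g i != 0 by [].
elim/big_rec2: _ => [|i m p _ [<- p0]]; first by rewrite mupNroot ?oner_eq0 // rootC oner_eq0.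
by rewrite mupM // mulf_neq0.
Qed.

Lemma mupX (p : {poly Fbar}) a e : p != 0 -> mup a (p ^+ e) = (e * mup a p)%N.
Proof.
move=> p0; elim: e => [|e IH]; first by rewrite expr0 mul0n mupNroot // rootC oner_eq0.
by rewrite exprS mupM ?expf_neq0 // IH mulSn.
Qed.

Section Data.
Variables (N : nat) (c : F) (g : 'I_N -> {poly F}).
Hypothesis c0 : c != 0.
Hypothesis g_monic : forall i, g i \is monic.
Hypothesis g_sep : separable_poly (\prod_i g i).
Let f := c *: powprod g.
Variable rs : seq Fbar.
Hypothesis rs_uniq : uniq rs.
Hypothesis rsP : forall a, root (im f) a = (a \in rs).

Let g0 i : (im (g i)) != 0.
Proof. by rewrite map_poly_eq0 monic_neq0. Qed.

Lemma powprod_neq0 : f != 0.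
Proof.
rewrite scaler_eq0 negb_or c0; apply/prodf_neq0 => i _.
by rewrite expf_neq0 // monic_neq0.
Qed.

Lemma mup_powprod a : mup a (im f) = (\sum_(i < N) i.+1 * mup a (im (g i)))%N.
Proof.
rewrite /f map_polyZ -mul_polyC mupMr; last by rewrite rootC fmorph_eq0.
have h i : im (g i ^+ i.+1) != 0 by rewrite rmorphXn /= expf_neq0.
rewrite /powprod rmorph_prod (mup_prod _ h).
by apply: eq_bigr => i _; rewrite rmorphXn /= mupX.
Qed.

(* Over the algebraic closure the factors [g i] are separable and pairwise     *)
(* coprime: each root of [f] is a simple root of exactly one of them.          *)
Lemma root_component a : a \in rs -> exists i0 : 'I_N,
  forall i, mup a (im (g i)) = (i == i0).
Proof.
move=> ars; have sep : separable_poly (im (\prod_i g i)) by rewrite separable_map.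
have ra : root (im (\prod_i g i)) a.
  move: ars; rewrite -rsP /f map_polyZ rootZ ?fmorph_eq0 // /powprod !rmorph_prod.
  rewrite /root !horner_prod => /prodf_eq0[i _]; rewrite rmorphXn horner_exp.
  by rewrite expf_eq0 => /andP[_ h]; apply/prodf_eq0; exists i.
have := separable_mup sep ra; rewrite rmorph_prod mup_prod // => h1.
have [i0 hi0] : exists i0, mup a (im (g i0)) != 0%N.
  apply/existsP; apply: contra_eqT h1 => /existsPn h.
  by rewrite big1 // => i _; apply/eqP; have := h i; rewrite negbK.
exists i0 => i; move: h1; rewrite (bigD1 i0) //=; have [->|ne] := eqVneq i i0.
  by move: hi0; move: (mup a _) (\sum_(_ | _) _)%N => x z; lia.
rewrite (bigD1 i) //=; move: hi0.
by move: (mup a (im (g i0))) (mup a (im (g i))) (\sum_(_ | _) _)%N => x x' z; lia.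
Qed.

Lemma mup_component a i0 : (forall i, mup a (im (g i)) = (i == i0)) ->
  mup a (im f) = i0.+1.
Proof.
move=> h; rewrite mup_powprod (bigD1 i0) //= h eqxx muln1 big1 ?addn0 // => i ne.
by rewrite h (negbTE ne) muln0.
Qed.

Lemma count_roots (phi : pred nat) :
  count (fun a => phi (mup a (im f))) rs
  = (\sum_(i < N | phi i.+1) (size (g i)).-1)%N.
Proof.
rewrite -sum1_count big_mkcond.
transitivity (\sum_(a <- rs) \sum_(i < N | phi i.+1) mup a (im (g i)))%N.
  rewrite big_seq [RHS]big_seq; apply: eq_bigr => a ars.
  have [i0 h] := root_component ars; rewrite (mup_component h).
  have [p0|p0] := boolP (phi i0.+1).
    rewrite (bigD1 i0) //= h eqxx big1 // => i /andP[_ ne].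
    by rewrite h (negbTE ne).
  by rewrite big1 // => i pi; rewrite h; case: eqP => // e; rewrite -e pi in p0.
rewrite exchange_big /=; apply: eq_bigr => i _.
rewrite sum_mup_roots ?size_map_poly // => a ra; rewrite -rsP /f map_polyZ.
rewrite rootZ ?fmorph_eq0 // /powprod rmorph_prod /root horner_prod.
by apply/prodf_eq0; exists i => //; rewrite rmorphXn horner_exp expf_eq0.
Qed.

Lemma size_roots : size rs = (\sum_i (size (g i)).-1)%N.
Proof. by rewrite -(count_predT rs) (count_roots predT). Qed.

Lemma size_powprod : (size f).-1 = (\sum_(i < N) i.+1 * (size (g i)).-1)%N.
Proof.
have gm i : g i ^+ i.+1 \is monic by exact: monic_exp.
rewrite /f size_scale // /powprod.
suff [-> _] : size (\prod_i g i ^+ i.+1) = (\sum_(i < N) i.+1 * (size (g i)).-1).+1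
    /\ \prod_i g i ^+ i.+1 \is monic by [].
elim/big_rec2: _ => [|i p m _ [sp pm]]; first by rewrite size_poly1 monic1.
split; last by rewrite monicMl.
rewrite size_monicM // ?monic_neq0 // sp.
have s0 : (0 < size (g i ^+ i.+1))%N by rewrite size_poly_gt0 monic_neq0.
rewrite mulnC -size_exp; move: s0; case: (size (g i ^+ i.+1)) => // s' _.
by rewrite /= addnS.
Qed.

Lemma mup_le a : (mup a (im f) <= N)%N.
Proof.
have [ars|ars] := boolP (a \in rs); last by rewrite mupNroot // rsP.
by have [i0 h] := root_component ars; rewrite (mup_component h).
Qed.

Lemma powprod_power_free : power_free N.+1 f.
Proof.
move=> u huf; apply/eqP; apply: contraT => su.
have := su; rewrite -(size_map_poly iota) => /closed_rootP[a ra].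
have u0 : u != 0.
  by apply: contraTneq huf => ->; rewrite expr0n dvd0p powprod_neq0.
have := mup_le a; rewrite leqNgt mup_geq ?map_poly_eq0 ?powprod_neq0 // => /negP[].
apply: (@dvdp_trans _ ((im u) ^+ N.+1)).
  by rewrite dvdp_exp2r // dvdp_XsubCl.
by rewrite -rmorphXn dvdp_map.
Qed.

(** Each factor is recovered from [f] alone, through the multiplicities of the roots. This yields
    the uniqueness in [powprod_inj], so that distinct tuples count as distinct polynomials. *)
Lemma component_map i :
  (im (g i)) = \prod_(a <- rs | mup a (im f) == i.+1) ('X - a%:P).
Proof.
have [s es] := closed_field_poly_normal (im (g i)).
rewrite lead_coef_map (monicP (g_monic i)) rmorph1 scale1r in es.
have sep : separable_poly (im (g i)).
  rewrite separable_map; move: g_sep; rewrite (bigD1 i) //= separable_mul.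
  by case/and3P.
have us : uniq s by rewrite -separable_prod_XsubC -es.
rewrite es -[RHS]big_filter; apply: perm_big; apply: uniq_perm => //.
  by rewrite filter_uniq.
move=> a; rewrite mem_filter -root_prod_XsubC -es.
apply/idP/andP => [ra|[/eqP e ars]].
  have ars : a \in rs.
    rewrite -rsP /f map_polyZ rootZ ?fmorph_eq0 // /powprod rmorph_prod /root horner_prod.
    by apply/prodf_eq0; exists i => //; rewrite rmorphXn horner_exp expf_eq0.
  split=> //; have [i0 h] := root_component ars; rewrite (mup_component h).
  by have := h i; rewrite (separable_mup sep ra); case: eqP => // ->.
have [i0 h] := root_component ars; move: e; rewrite (mup_component h) => -[e].
have ei : i = i0 by exact: val_inj.
have := h i; rewrite {2}ei eqxx => m1.
by rewrite -dvdp_XsubCl XsubC_dvd // m1.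
Qed.

End Data.

Lemma powprod_inj N (c c' : F) (g g' : 'I_N -> {poly F}) : c != 0 -> c' != 0 ->
  (forall i, g i \is monic) -> (forall i, g' i \is monic) ->
  separable_poly (\prod_i g i) -> separable_poly (\prod_i g' i) ->
  c *: powprod g = c' *: powprod g' -> c = c' /\ g =1 g'.
Proof.
move=> c0 c'0 gm g'm gs g's e.
have pm (h : 'I_N -> {poly F}) : (forall i, h i \is monic) -> powprod h \is monic.
  by move=> hm; apply: monic_prod => i _; apply: monic_exp.
split.
  have := congr1 (@lead_coef F) e; rewrite !lead_coefZ.
  by rewrite (monicP (pm _ gm)) (monicP (pm _ g'm)) !mulr1.
move=> i; apply: (map_poly_inj iota).
have [s es] := closed_field_poly_normal (im (c *: powprod g)).
have f0 : (im (c *: powprod g)) != 0 by rewrite map_poly_eq0 powprod_neq0.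
have rsP a : root (im (c *: powprod g)) a = (a \in undup s).
  by rewrite es rootZ ?lead_coef_eq0 // root_prod_XsubC mem_undup.
have rsP' a : root (im (c' *: powprod g')) a = (a \in undup s) by rewrite -e rsP.
rewrite (component_map c0 gm gs (undup_uniq s) rsP).
rewrite (component_map c'0 g'm g's (undup_uniq s) rsP').
by apply: eq_bigl => a; rewrite e.
Qed.

End RootData.

(** * Counting *)

Lemma leq_card_bigcup (I T : finType) (P : pred I) (A : I -> {set T}) :
  (#|\bigcup_(i | P i) A i| <= \sum_(i | P i) #|A i|)%N.
Proof.
elim/big_rec2: _ => [|i m B _ le]; first by rewrite cards0.
by rewrite (leq_trans (leq_card_setU _ _)) // leq_add2l.
Qed.

Lemma card_family_prod (aT rT : finType) (S : aT -> {set rT}) :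
  #|family (fun i => mem (S i))| = (\prod_i #|S i|)%N.
Proof. by rewrite card_family foldrE big_map big_enum. Qed.

(** The terms are at most [q^(S - e - 1)], a geometric series. The induction keeps its unspent part
    [q^S %/ q^D] on the left-hand side. *)
Lemma geometric_bound (q S D : nat) (X : nat -> nat) : (0 < q)%N ->
  (forall e, e < D -> X e * q ^ e.+1 <= q ^ S)%N ->
  (q.-1 * \sum_(e < D) X e <= q ^ S)%N.
Proof.
move=> q0 hX.
suff : (q.-1 * (\sum_(e < D) X e) + q ^ S %/ q ^ D <= q ^ S)%N.
  by apply: leq_trans; exact: leq_addr.
elim: D hX => [|D IH] hX; first by rewrite big_ord0 muln0 expn0 divn1.
have {}IH := IH (fun e he => hX e (ltnW he)).
rewrite big_ord_recr mulnDr -addnA; apply: leq_trans IH; rewrite leq_add2l.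
have h1 : (X D <= q ^ S %/ q ^ D.+1)%N by rewrite leq_divRL ?expn_gt0 ?q0 ?hX.
have h2 : (q * (q ^ S %/ q ^ D.+1) <= q ^ S %/ q ^ D)%N.
  by rewrite expnSr divnMA mulnC leq_trunc_div.
apply: leq_trans h2; case: (q) q0 h1 => // q' _ h1.
by rewrite mulSn addnC leq_add2l leq_mul2l h1 orbT.
Qed.

(** * Squarefree and pairwise coprime tuples of given degrees *)

Section MonicTuples.
Variables (F : finFieldType) (D : nat).
Hypothesis char2 : 2%N \in [pchar F].
Local Notation q := #|F|.
Local Notation PT := {poly_(D.+1) F}.

Let q_gt0 : (0 < q)%N. Proof. by apply/card_gt0P; exists 0. Qed.

Definition monics (d : nat) : {set PT} :=
  [set p : PT | ((p : {poly F}) \is monic) && (size (p : {poly F}) == d.+1)]%SET.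

Lemma card_monics d : (d <= D)%N -> #|monics d| = (q ^ d)%N.
Proof.
move=> dD; rewrite -card_npoly -cardsT.
pose h (r : {poly_d F}) : PT := npolyp D.+1 ('X^d + (r : {poly F})).
have sr (r : {poly_d F}) : (size (r : {poly F}) < size ('X^d : {poly F}))%N.
  by rewrite size_polyXn ltnS size_npoly.
have hE r : h r = 'X^d + (r : {poly F}) :> {poly F}.
  by rewrite /h npolypK // size_polyDl // size_polyXn ltnS.
have -> : monics d = [set h r | r in [set: {poly_d F}]%SET]%SET.
  apply/setP => p; rewrite inE; apply/andP/imsetP => [[pm /eqP sp]|[r _ ->]]; last first.
    rewrite hE size_polyDl // size_polyXn eqxx; split=> //.
    by rewrite monicE lead_coefDl // lead_coefXn.
  have ps : (size ((p : {poly F}) - 'X^d)%R <= d)%N.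
    apply/leq_sizeP => j; rewrite leq_eqVlt coefB coefXn => /orP[/eqP <-|dj].
      by move/monicP: pm; rewrite /lead_coef sp eqxx => ->; rewrite subrr.
    by rewrite nth_default ?sp // gtn_eqF // subrr.
  exists (npolyp d ((p : {poly F}) - 'X^d)) => //; apply: val_inj.
  by rewrite /= hE npolypK // addrC subrK.
rewrite card_imset // => r r' /(congr1 (fun p : PT => (p : {poly F}))).
by rewrite !hE => /addrI /val_inj.
Qed.

Lemma card_monics_dvd d e (u : {poly F}) : (d <= D)%N -> u \is monic ->
  size u = e.+1 ->
  (#|[set p in monics d | (u %| (p : {poly F}))%R]%SET| * q ^ e <= q ^ d)%N.
Proof.
move=> dD um su; have u0 := monic_neq0 um.
have [ed|de] := leqP e d; last first.
  rewrite [X in (X * _)%N](_ : _ = 0%N) ?mul0n //; apply: eq_card0 => p.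
  rewrite !inE; apply/negP => /andP[/andP[pm /eqP sp] /dvdp_leq].
  by rewrite monic_neq0 // => /(_ isT); rewrite sp su leqNgt ltnS de.
rewrite -{2}(subnK ed) expnD leq_mul2r; apply/orP; right.
rewrite -card_monics ?(leq_trans (leq_subr _ _)) //.
pose h (p : PT) : PT := npolyp D.+1 ((p : {poly F}) %/ u).
have hE (p : PT) : h p = (p : {poly F}) %/ u :> {poly F}.
  by rewrite /h npolypK // (leq_trans (leq_divp _ _)) // size_npoly.
rewrite -(card_in_imset (f := h)) => [|p p']; last first.
  rewrite !inE => /andP[_ up] /andP[_ up'] /(congr1 (fun p : PT => (p : {poly F}))).
  rewrite !hE => e'; apply: val_inj.
  by rewrite -[LHS](divpK up) e' divpK.
apply/subset_leq_card/fintype.subsetP => x /imsetP[p]; rewrite !inE.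
move=> /andP[/andP[pm /eqP sp] up] ->; rewrite hE.
have pu : (p : {poly F}) %/ u \is monic.
  by move: pm; rewrite -{1}(divpK up) monicMr.
by rewrite pu size_divp // sp su /= subSn.
Qed.

Variable N : nat.
Hypothesis N_gt0 : (0 < N)%N.
Hypothesis q_large : (2 * N ^ 2 < q)%N.
Local Notation G := {ffun 'I_N -> PT}.

Definition tprod (g : G) : {poly F} := \prod_i (g i : {poly F}).

Section FixedDegrees.
Variable d : 'I_N -> nat.
Hypothesis dD : forall i, (d i <= D)%N.
Let S := (\sum_i d i)%N.

Definition monic_tuples : {set G} :=
  [set g : G | [forall i, g i \in monics (d i)]]%SET.

Lemma card_monic_tuples : #|monic_tuples| = (q ^ S)%N.
Proof.
transitivity #|family (fun i => mem (monics (d i)))|.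
  by apply: eq_card => g; rewrite inE; apply/forallP/familyP.
rewrite card_family_prod expn_sum; apply: eq_bigr => i _.
by rewrite card_monics.
Qed.

(** The exponent treats both ways for [p^2] to divide the product at once: [p^2] divides [g i] when
    [i = j], and [p] divides both [g i] and [g j] otherwise. *)
Definition repeated_factor (p : {poly F}) (i j : 'I_N) : {set G} :=
  [set g in monic_tuples |
    [forall l, p ^+ ((l == i) + (l == j)) %| (g l : {poly F})]]%SET.

Lemma card_repeated_factor p i j e : p \is monic -> size p = e.+1 ->
  (#|repeated_factor p i j| * q ^ (2 * e) <= q ^ S)%N.
Proof.
move=> pm sp.
pose T l := [set x in monics (d l) | p ^+ ((l == i) + (l == j)) %| (x : {poly F})]%SET.
have -> : #|repeated_factor p i j| = (\prod_l #|T l|)%N.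
  rewrite -card_family_prod; apply: eq_card => g; rewrite !inE.
  apply/andP/familyP => [[/forallP h1 /forallP h2] l|h].
    by rewrite !inE; have := h1 l; rewrite inE => ->; exact: h2.
  by split; apply/forallP => l; have := h l; rewrite !inE => /andP[].
have -> : (2 * e = \sum_l ((l == i) + (l == j)) * e)%N.
  rewrite -big_distrl big_split /= -!big_mkcond /= !big_pred1_eq //.
rewrite expn_sum -big_split /= expn_sum; apply: leq_prod => l _.
have hm : p ^+ ((l == i) + (l == j)) \is monic by exact: monic_exp.
apply: card_monics_dvd => //.
have := size_exp p ((l == i) + (l == j)); rewrite sp /= mulnC => <-.
by rewrite prednK // size_poly_gt0 monic_neq0.
Qed.

Lemma nonseparable_repeated_factor g : g \in monic_tuples ->
  ~~ separable_poly (tprod g) ->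
  exists (x : 'I_D * (PT * ('I_N * 'I_N))), x.2.1 \in monics x.1.+1
    /\ g \in repeated_factor x.2.1 x.2.2.1 x.2.2.2.
Proof.
move=> gt ns; have /forallP gm : [forall i, g i \in monics (d i)] by move: gt; rewrite inE.
have gmon i : (g i : {poly F}) \is monic by have := gm i; rewrite inE => /andP[].
have P0 : tprod g != 0 by apply/prodf_neq0 => i _; rewrite monic_neq0.
have [p [pm pirr psq]] := nonseparable_square char2 P0 ns.
have [i [j hij]] : exists i j, forall l, p ^+ ((l == i) + (l == j)) %| (g l : {poly F}).
  have pP : p %| tprod g by rewrite (dvdp_trans _ psq) // expr2 dvdp_mulr.
  have [i _ pi] := irreducible_dvd_prod pirr pP.
  have [p2|np2] := boolP (p ^+ 2 %| (g i : {poly F})).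
    by exists i, i => l; have [->|_] := eqVneq l i; rewrite ?dvd1p.
  have /dvdpP[u gu] := pi.
  have npu : ~~ (p %| u).
    by apply: contra np2 => /dvdpP[w uw]; rewrite gu uw -mulrA -expr2 dvdp_mull.
  have p0 : p != 0 by rewrite monic_neq0.
  have : p %| u * \prod_(l | l != i) (g l : {poly F}).
    move: psq; rewrite /tprod (bigD1 i) //= gu expr2.
    by rewrite [u * p]mulrC -mulrA dvdp_mul2l.
  move=> /(irreducible_dvdM pirr); rewrite (negbTE npu) /=.
  move=> /(irreducible_dvd_prod pirr)[j ji pj].
  exists i, j => l; have [->|li] := eqVneq l i; first by rewrite eq_sym (negbTE ji) expr1.
  by have [->|_] := eqVneq l j; rewrite ?dvd1p // expr1.
have pgi : p %| (g i : {poly F}).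
  by have := hij i; rewrite eqxx add1n exprS; apply: dvdp_trans; rewrite dvdp_mulr.
have sp : (size p <= D.+1)%N.
  by rewrite (leq_trans (dvdp_leq _ pgi)) ?monic_neq0 // size_npoly.
have sp1 := pirr.1; have he : ((size p).-2 < D)%N.
  by move: sp sp1; move: (size p) => s; lia.
exists (Ordinal he, (npolyp D.+1 p, (i, j))); rewrite /= !inE npolypK //.
rewrite pm; split; first by move: sp1; case: (size p) => [|[|s]] //= _; rewrite eqxx.
by move: gt; rewrite inE => -> /=; apply/forallP.
Qed.

Definition separable_tuples : {set G} :=
  [set g in monic_tuples | separable_poly (tprod g)]%SET.

(** A union bound: for each degree [e > 0] there are [q^e] monic [p] and [N^2] pairs [(i, j)], each
    responsible for at most a proportion [q^(-2e)] of all tuples. Summed over [e] this is at most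
    [N^2 / (q - 1)], and [q_large] makes it at most one half. *)
Lemma card_separable_tuples : (q ^ S <= 2 * #|separable_tuples|)%N.
Proof.
pose NS := [set g in monic_tuples | ~~ separable_poly (tprod g)]%SET.
have split : (#|separable_tuples| + #|NS| = q ^ S)%N.
  rewrite -card_monic_tuples -(cardsID [set g | separable_poly (tprod g)]%SET monic_tuples).
  by congr (_ + _)%N; apply: eq_card => g; rewrite !inE // andbC.
pose X (e : nat) := (\sum_(p in monics e.+1) \sum_(i < N) \sum_(j < N)
   #|repeated_factor p i j|)%N.
have le1 : (#|NS| <= \sum_(e < D) X e)%N.
  pose P (x : 'I_D * (PT * ('I_N * 'I_N))) := x.2.1 \in monics x.1.+1.
  pose A (x : 'I_D * (PT * ('I_N * 'I_N))) := repeated_factor x.2.1 x.2.2.1 x.2.2.2.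
  apply: (@leq_trans #|\bigcup_(x | P x) A x|).
    apply/subset_leq_card/fintype.subsetP => g; rewrite inE => /andP[gt ns].
    have [x [hx gx]] := nonseparable_repeated_factor gt ns.
    by apply/bigcupP; exists x.
  apply: leq_trans (leq_card_bigcup _ _) _; rewrite /X.
  under [X in (_ <= X)%N]eq_bigr => e _ do under eq_bigr => p _ do rewrite pair_big.
  under [X in (_ <= X)%N]eq_bigr => e _ do rewrite pair_big_dep.
  rewrite pair_big_dep /=; apply: eq_leq; apply: eq_bigl => x.
  by rewrite /P !andbT.
have le2 : (q.-1 * \sum_(e < D) X e <= N ^ 2 * q ^ S)%N.
  pose Y e := (\sum_(p in monics e.+1) (q ^ S %/ q ^ (2 * e.+1)))%N.
  apply: (@leq_trans (N ^ 2 * (q.-1 * \sum_(e < D) Y e))%N); last first.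
    rewrite leq_mul2l geometric_bound ?orbT // => e eD.
    rewrite /Y sum_nat_const card_monics // mulnC mulnA -expnD addnn -mul2n mulnC.
    exact: leq_trunc_div.
  rewrite mulnCA leq_mul2l big_distrr /=; apply/orP; right.
  apply: leq_sum => e _; rewrite /X /Y big_distrr /=; apply: leq_sum => p pm.
  have {}pm : (p : {poly F}) \is monic /\ size (p : {poly F}) = e.+2.
    by move: pm; rewrite inE => /andP[? /eqP].
  apply: (@leq_trans (\sum_(i < N) \sum_(j < N) (q ^ S %/ q ^ (2 * e.+1)))%N).
    apply: leq_sum => i _; apply: leq_sum => j _.
    rewrite leq_divRL ?expn_gt0 ?q_gt0 //.
    by apply: card_repeated_factor; case: pm.
  by rewrite !sum_nat_const !card_ord mulnA mulnn.
have : (2 * N ^ 2 * #|NS| <= N ^ 2 * q ^ S)%N.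
  by apply: leq_trans le2; apply: leq_mul le1; rewrite -ltnS prednK.
rewrite -mulnA mulnCA leq_pmul2l ?expn_gt0 ?N_gt0 // -split.
by lia.
Qed.

End FixedDegrees.
End MonicTuples.

(* The equality of the dimensions of the eigenspaces of index 1 and 2, in      *)
(* terms of the degrees [d i] of the factors [f_(i+1)] of [f].                 *)
Definition degree_relation (n : nat) (d : 'I_n.-1 -> nat) : bool :=
  (\sum_(i < n.-1 | n < 2 * i.+1) d i + (\sum_(i < n.-1) i.+1 * d i) %/ n
   == (2 * \sum_(i < n.-1) i.+1 * d i) %/ n)%N.

(** * Degree vectors with given sum, with and without the relation *)

Section DegreeVectors.
Variable m : nat.

(** Here [n = m.+3]: [ord0], [mid] and [last_ix] are the indices of [f_1], of [f_2, ..., f_(n-2)],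
    and of [f_(n-1)]. *)
Let last_ix : 'I_m.+2 := lift ord0 ord_max.
Let mid (j : 'I_m) : 'I_m.+2 := lift ord0 (widen_ord (leqnSn m) j).

Lemma big_ord_ends (F : 'I_m.+2 -> nat) :
  (\sum_i F i = F ord0 + (\sum_j F (mid j) + F last_ix))%N.
Proof. by rewrite big_ord_recl big_ord_recr. Qed.

(** All degrees but the first are chosen freely up to [D %/ m.+2]; the first one makes up the
    sum. *)
Lemma card_degree_vectors D :
  ((D %/ m.+2).+1 ^ m.+1 <=
   #|[set d : {ffun 'I_m.+2 -> 'I_D.+1} | (\sum_i d i == D)%N]%SET|)%N.
Proof.
set B := (D %/ m.+2)%N.
have BD : (m.+1 * B <= D)%N.
  by rewrite (leq_trans _ (leq_trunc_div D m.+2)) // mulnC leq_mul2l leqnSn orbT.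
pose s (e : {ffun 'I_m.+1 -> 'I_B.+1}) := (\sum_j e j)%N.
have sD e : (s e <= D)%N.
  apply: leq_trans BD; rewrite -[m.+1 in X in (_ <= X)%N]card_ord -sum_nat_const.
  by apply: leq_sum => j _; rewrite -ltnS.
pose h (e : {ffun 'I_m.+1 -> 'I_B.+1}) : {ffun 'I_m.+2 -> 'I_D.+1} :=
  [ffun i => inord (if unlift ord0 i is Some j then e j : nat else D - s e)%N].
have h0 e : h e ord0 = (D - s e)%N :> nat.
  by rewrite ffunE unlift_none inordK // ltnS leq_subr.
have h1 e j : h e (lift ord0 j) = e j :> nat.
  rewrite ffunE liftK inordK // ltnS; apply: leq_trans (leq_div D m.+2).
  by rewrite -ltnS.
have inj : injective h.
  by move=> e e' he; apply/ffunP => j; apply: val_inj; rewrite /= -!h1 he.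
rewrite -[B.+1]card_ord -[X in (_ ^ X)%N](card_ord m.+1) -card_ffun -(card_imset _ inj).
apply/subset_leq_card/fintype.subsetP => d /imsetP[e _ ->]; rewrite inE big_ord_recl h0.
by under eq_bigr => j _ do rewrite h1; rewrite subnK.
Qed.

(* Multiplied by [n], the relation reads [2 t = const + (r - r2)] with         *)
(* remainders [r, r2 < n]: it confines [t] to a window of length [n].          *)
Lemma degree_relation_window (H U C D a t a' t' : nat) :
  (a + (C + t) = D)%N -> (a' + (C + t') = D)%N ->
  (0 + (H + t) + (a + (U + m.+2 * t)) %/ m.+3 = (2 * (a + (U + m.+2 * t))) %/ m.+3)%N ->
  (0 + (H + t') + (a' + (U + m.+2 * t')) %/ m.+3 = (2 * (a' + (U + m.+2 * t'))) %/ m.+3)%N ->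
  (t = t' %[mod m.+3])%N -> t = t'.
Proof.
move=> e1 e2 r1 r2.
have aux p q r : (2 * (p * m.+3 + r) < 2 * (q * m.+3 + r) + 2 * m.+3)%N -> (p <= q)%N.
  move=> h; rewrite -ltnS -(ltn_pmul2r (ltn0Sn m.+2)) mulSn.
  by move: h; move: (p * _)%N (q * _)%N => x y; lia.
have window x y : (2 * x < 2 * y + 2 * m.+3)%N -> (2 * y < 2 * x + 2 * m.+3)%N ->
    (x = y %[mod m.+3])%N -> x = y.
  move=> l1 l2 e; rewrite (divn_eq x m.+3) (divn_eq y m.+3) e; congr (_ * _ + _)%N.
  rewrite (divn_eq x m.+3) (divn_eq y m.+3) e in l1 l2.
  by apply/eqP; rewrite eqn_leq (aux _ _ _ l1) (aux _ _ _ l2).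
set u := (a + (U + m.+2 * t))%N in r1; set u' := (a' + (U + m.+2 * t'))%N in r2.
have := divn_eq u m.+3; have := ltn_pmod u (ltn0Sn m.+2).
have := divn_eq (2 * u) m.+3; have := ltn_pmod (2 * u) (ltn0Sn m.+2).
have := divn_eq u' m.+3; have := ltn_pmod u' (ltn0Sn m.+2).
have := divn_eq (2 * u') m.+3; have := ltn_pmod (2 * u') (ltn0Sn m.+2).
rewrite -r1 -r2; move: (u %/ _)%N (u %% _)%N (u' %/ _)%N (u' %% _)%N.
move: ((2 * u) %% _)%N ((2 * u') %% _)%N => s s' q r q' r' h1 h2 h3 h4 h5 h6 h7 h8.
apply: window.
  by move: e1 e2 h1 h2 h3 h4 h5 h6 h7 h8; rewrite /u /u'; clear; lia.
by move: e1 e2 h1 h2 h3 h4 h5 h6 h7 h8; rewrite /u /u'; clear; lia.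
Qed.

(** The middle degrees together with [d_(n-1)] modulo [n] determine the vector:
    [degree_relation_window] recovers [d_(n-1)], and the fixed sum gives [d_1]. This leaves [m] free
    degrees instead of [m.+1]. *)
Lemma card_degree_relation M D :
  (#|[set d : {ffun 'I_m.+2 -> 'I_M.+1} |
      (\sum_i d i == D)%N && @degree_relation m.+3 (fun i => d i)]%SET|
   <= m.+3 * M.+1 ^ m)%N.
Proof.
pose h (d : {ffun 'I_m.+2 -> 'I_M.+1}) : 'I_m.+3 * {ffun 'I_m -> 'I_M.+1} :=
  (inord (d last_ix %% m.+3), [ffun j => d (mid j)]).
rewrite -(card_in_imset (f := h)) => [|d d']; last first.
  rewrite !inE /degree_relation /= => /andP[/eqP s1 /eqP r1] /andP[/eqP s2 /eqP r2] [].
  move=> /(congr1 val) /=; rewrite !inordK ?ltn_pmod // => et /ffunP em.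
  have {}em j : d (mid j) = d' (mid j) by have := em j; rewrite !ffunE.
  have hi (x : {ffun 'I_m.+2 -> 'I_M.+1}) : (\sum_(i < m.+2 | m.+3 < 2 * i.+1) x i
      = 0 + (\sum_(j < m) (if m.+3 < 2 * (mid j).+1 then x (mid j) : nat else 0)
             + x last_ix))%N.
    rewrite big_mkcond big_ord_ends /=; congr (_ + (_ + _))%N.
    by rewrite /bump /=; case: ltnP => //; lia.
  have hu (x : {ffun 'I_m.+2 -> 'I_M.+1}) : (\sum_(i < m.+2) i.+1 * x i
      = x ord0 + (\sum_(j < m) (mid j).+1 * x (mid j) + m.+2 * x last_ix))%N.
    by rewrite big_ord_ends mul1n.
  have e1 : (\sum_(j < m) d' (mid j) = \sum_(j < m) d (mid j))%N.
    by apply: eq_bigr => j _; rewrite em.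
  have e2 : (\sum_(j < m) (mid j).+1 * d' (mid j) = \sum_(j < m) (mid j).+1 * d (mid j))%N.
    by apply: eq_bigr => j _; rewrite em.
  have e3 : (\sum_(j < m) (if m.+3 < 2 * (mid j).+1 then d' (mid j) : nat else 0)
      = \sum_(j < m) (if m.+3 < 2 * (mid j).+1 then d (mid j) : nat else 0))%N.
    by apply: eq_bigr => j _; rewrite em.
  rewrite big_ord_ends in s1; rewrite big_ord_ends e1 in s2.
  rewrite !hi !hu in r1; rewrite !hi !hu e2 e3 in r2.
  have et' : d last_ix = d' last_ix.
    by apply/val_inj; exact: (degree_relation_window s1 s2 r1 r2 et).
  have e0 : d ord0 = d' ord0.
    by apply/val_inj; move: s1; rewrite -s2 et' => /addIn.
  apply/ffunP => i; have [j ->|->//] := unliftP ord0 i.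
  have [j' ->|->] := unliftP ord_max j; last exact: et'.
  have := em j'; rewrite /mid; congr (d (lift _ _) = d' (lift _ _)); apply: val_inj;
    by rewrite /= /bump leqNgt ltn_ord.
apply: leq_trans (max_card _) _.
by rewrite card_prod card_ffun !card_ord.
Qed.

End DegreeVectors.

(** * Tuples of polynomials sorted by their degree vectors *)

Section TupleCounts.
Variable F : finFieldType.
Hypothesis char2 : 2%N \in [pchar F].
Variable m : nat.
Local Notation q := #|F|.
Hypothesis q_large : (2 * m.+2 ^ 2 < q)%N.

Let q_gt0 : (0 < q)%N. Proof. by apply: leq_trans q_large. Qed.

Section Bound.
Variable D : nat.
Local Notation G := {ffun 'I_m.+2 -> {poly_(D.+1) F}}.

Definition degrees (g : G) : {ffun 'I_m.+2 -> 'I_D.+1} :=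
  [ffun i => inord (size (g i : {poly F})).-1].

Lemma degreesE (g : G) i : degrees g i = (size (g i : {poly F})).-1 :> nat.
Proof.
rewrite ffunE inordK // ltnS -subn1 leq_subLR add1n.
exact: size_npoly.
Qed.

Definition all_monic (g : G) := [forall i, (g i : {poly F}) \is monic].

Lemma monic_tuplesE (d : {ffun 'I_m.+2 -> 'I_D.+1}) g :
  (g \in monic_tuples F D (fun i => d i)) = all_monic g && (degrees g == d).
Proof.
rewrite inE; apply/forallP/andP => [h|[/forallP h /eqP <-] i].
  split; first by apply/forallP => i; have := h i; rewrite inE => /andP[].
  apply/eqP/ffunP => i; apply: val_inj; rewrite /= degreesE.
  by have := h i; rewrite inE => /andP[_ /eqP ->].
rewrite inE h degreesE prednK ?eqxx // size_poly_gt0.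
by rewrite monic_neq0.
Qed.

Definition good_tuples : {set G} :=
  [set g : G | [&& all_monic g, separable_poly (tprod g)
                 & (\sum_i (size (g i : {poly F})).-1 == D)%N]]%SET.

Lemma card_good_tuples :
  (q ^ D * (D %/ m.+2).+1 ^ m.+1 <= 2 * #|good_tuples|)%N.
Proof.
pose Dl := [set d : {ffun 'I_m.+2 -> 'I_D.+1} | (\sum_i d i == D)%N]%SET.
apply: (@leq_trans (q ^ D * #|Dl|)%N).
  by rewrite leq_mul2l card_degree_vectors orbT.
have dD (d : {ffun 'I_m.+2 -> 'I_D.+1}) i : (d i <= D)%N by rewrite -ltnS.
rewrite mulnC -sum_nat_const.
apply: (@leq_trans (\sum_(d in Dl) 2 * #|separable_tuples F D (fun i => d i)|)%N).
  apply: leq_sum => d; rewrite inE => /eqP sd.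
  rewrite -[D in (_ ^ D)%N]sd; exact: (card_separable_tuples char2 _ q_large (dD d)).
rewrite -big_distrr leq_mul2l /= -[#|good_tuples|]sum1_card.
rewrite (partition_big degrees (mem Dl)) /= => [|g]; last first.
  rewrite !inE => /and3P[_ _ /eqP sg]; apply/eqP; rewrite -[RHS]sg.
  by apply: eq_bigr => i _; rewrite degreesE.
apply: leq_sum => d; rewrite inE => /eqP sd; rewrite sum1_card.
apply: subset_leq_card; apply/fintype.subsetP => g; rewrite inE monic_tuplesE.
move=> /andP[/andP[gm /eqP gd] gs]; rewrite unfold_in /= inE gm gs gd eqxx andbT /=.
apply/eqP; rewrite -[RHS]sd; apply: eq_bigr => i _; by rewrite -gd degreesE.
Qed.

Definition relation_tuples : {set G} :=
  [set g : G | [&& all_monic g,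
     @degree_relation m.+3 (fun i => (size (g i : {poly F})).-1)
     & (\sum_i (size (g i : {poly F})).-1 <= D)%N]]%SET.

Lemma card_relation_tuples :
  (#|relation_tuples| <= \sum_(e < D.+1) q ^ e * (m.+3 * D.+1 ^ m))%N.
Proof.
pose Rl (e : 'I_D.+1) := [set d : {ffun 'I_m.+2 -> 'I_D.+1} |
  (\sum_i d i == e)%N && @degree_relation m.+3 (fun i => d i)]%SET.
have dD (d : {ffun 'I_m.+2 -> 'I_D.+1}) i : (d i <= D)%N by rewrite -ltnS.
apply: (@leq_trans #|(\bigcup_(e : 'I_D.+1 | true) \bigcup_(d | d \in Rl e)
    monic_tuples F D (fun i => d i))%SET|).
  apply: subset_leq_card; apply/fintype.subsetP => g; rewrite inE.
  move=> /and3P[gm gr gD]; apply/bigcupP.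
  have se : (\sum_i degrees g i = \sum_i (size (g i : {poly F})).-1)%N.
    by apply: eq_bigr => i _; rewrite degreesE.
  have hD : (\sum_i (size (g i : {poly F})).-1 < D.+1)%N by rewrite ltnS.
  exists (Ordinal hD) => //; apply/bigcupP; exists (degrees g); last first.
    by rewrite monic_tuplesE gm eqxx.
  rewrite inE se eqxx /=; move: gr; rewrite /degree_relation.
  under eq_bigr => i _ do rewrite -degreesE.
  by under [X in (_ + X %/ _ == _)%N]eq_bigr => i _ do rewrite -degreesE;
    under [X in (_ == (2 * X) %/ _)%N]eq_bigr => i _ do rewrite -degreesE.
apply: leq_trans (leq_card_bigcup _ _) _; apply: leq_sum => e _.
apply: leq_trans (leq_card_bigcup _ _) _.
apply: (@leq_trans (\sum_(d in Rl e) q ^ e)%N).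
  apply: leq_sum => d; rewrite inE => /andP[/eqP sd _].
  by rewrite (card_monic_tuples F (dD d)) sd.
by rewrite sum_nat_const mulnC leq_mul2l card_degree_relation orbT.
Qed.

Lemma card_relation_tuples_le :
  (#|relation_tuples| <= 2 * q ^ D * (m.+3 * D.+1 ^ m))%N.
Proof.
apply: leq_trans card_relation_tuples _; rewrite -big_distrl leq_mul2r /=.
apply/orP; right; elim: D => [|d IH]; first by rewrite big_ord1 expn0.
rewrite big_ord_recr /= mul2n -addnn leq_add2r; apply: leq_trans IH _.
by rewrite expnS leq_mul2r (leq_trans _ q_large) ?orbT // mulnS.
Qed.

End Bound.
End TupleCounts.

(** * The density of ordinary curves *)

Section Density.
Variables (m : nat) (F : finFieldType) (Fbar : closedFieldType).
Variables (iota : {rmorphism F -> Fbar}) (R : realType).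
Local Notation n := m.+3.
Local Notation q := #|F|.
Hypothesis n_prime : prime n.
Hypothesis n_odd : odd n.
Hypothesis char2 : 2%N \in [pchar F].
Hypothesis q_large : (2 * m.+2 ^ 2 < q)%N.
Local Notation im := (map_poly iota).

Let q_gt1 : (1 < q)%N. Proof. by apply: leq_trans q_large; rewrite ltnS muln_gt0 expn_gt0. Qed.

Let char2b : 2%N \in [pchar Fbar].
Proof.
by rewrite inE /= -(rmorph_nat iota) (pcharf0 char2) rmorph0 eqxx.
Qed.

Definition root_list (f : {poly F}) : seq Fbar :=
  undup (sval (closed_field_poly_normal (im f))).

Lemma root_list_uniq f : uniq (root_list f). Proof. exact: undup_uniq. Qed.

Lemma root_listP f a : f != 0 -> root (im f) a = (a \in root_list f).
Proof.
move=> f0; rewrite mem_undup; case: closed_field_poly_normal => s /= es.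
by rewrite {1}es rootZ ?root_prod_XsubC // lead_coef_eq0 map_poly_eq0.
Qed.

Lemma power_free_neq0 (f : {poly F}) : power_free n f -> f != 0.
Proof.
move=> pf; apply/negP => /eqP f0; have := pf 'X.
by rewrite f0 dvdp0 size_polyX => /(_ isT).
Qed.

Definition tuple_poly D (g : {ffun 'I_m.+2 -> {poly_(D.+1) F}}) : {poly F} :=
  powprod (fun i => (g i : {poly F})).

Definition relation_list (M : nat) : seq {poly F} :=
  [seq c *: tuple_poly g | c <- enum F, g <- enum (relation_tuples F m M)].

Lemma size_relation_list M :
  (size (relation_list M) <= q * (2 * q ^ M * (n * M.+1 ^ m)))%N.
Proof.
rewrite size_allpairs -!cardE leq_mul2l; apply/orP; right.
exact: card_relation_tuples_le.
Qed.

Lemma ordinary_in_relation_list f M : power_free n f ->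
  ordinary_curve n (im f) -> (ramified_points n (im f) <= M)%N ->
  f \in relation_list M.
Proof.
move=> pf ord rM; have f0 := power_free_neq0 pf.
have [c [g [c0 gm gs ef]]] := power_free_factorization char2 (isT : (1 < n)%N) f0 pf.
have us := root_list_uniq f.
have rsP a : root (im (c *: powprod g)) a = (a \in root_list f).
  by rewrite -ef; exact: root_listP.
have imf0 : im f != 0 by rewrite map_poly_eq0.
have mlt a : (mup a (im f) < n)%N.
  by rewrite ef ltnS (mup_le c0 gm gs us rsP).
have [le rel] := ordinary_curve_relation n_prime n_odd char2b imf0 us
  (fun a => root_listP a f0) mlt ord.
have sM : (\sum_i (size (g i)).-1 <= M)%N.
  by rewrite -(size_roots c0 gm gs us rsP) (leq_trans le).
have sg i : (size (g i) <= M.+1)%N.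
  have : ((size (g i)).-1 <= M)%N by rewrite (leq_trans _ sM) // (bigD1 i) //= leq_addr.
  by case: (size (g i)).
apply/allpairsP; exists (c, [ffun i => npolyp M.+1 (g i)]) => /=.
have gE i : [ffun i => npolyp M.+1 (g i)] i = g i :> {poly F}.
  by rewrite ffunE npolypK.
split; first by rewrite mem_enum.
  rewrite mem_enum inE; apply/and3P; split.
  - by apply/forallP => i; rewrite gE.
  - have /= cr := count_roots c0 gm gs us rsP (fun j => n < 2 * j)%N.
    rewrite -ef in cr; move: rel; rewrite cr size_map_poly ef (size_powprod c0 gm) => rel.
    rewrite /degree_relation; apply/eqP.
    under eq_bigr => i _ do rewrite gE.
    under [X in (_ + X %/ _ = _)%N]eq_bigr => i _ do rewrite gE.
    by under [X in (_ = (2 * X) %/ _)%N]eq_bigr => i _ do rewrite gE.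
  - by under eq_bigr => i _ do rewrite gE.
by rewrite ef; congr (_ *: _); apply: eq_bigr => i _; rewrite gE.
Qed.

Definition good_list (D : nat) : seq {poly F} :=
  [seq tuple_poly g | g <- enum (good_tuples F m D)].

Lemma size_good_list D :
  (q ^ D * (D %/ m.+2).+1 ^ m.+1 <= 2 * size (good_list D))%N.
Proof. by rewrite size_map -cardE; exact: card_good_tuples. Qed.

Lemma good_list_uniq D : uniq (good_list D).
Proof.
rewrite map_inj_in_uniq ?enum_uniq // => g g'.
rewrite !mem_enum !inE => /and3P[/forallP gm gs _] /and3P[/forallP gm' gs' _] e.
have [|_ h] := @powprod_inj _ _ iota _ 1 1 (fun i => (g i : {poly F}))
  (fun i => (g' i : {poly F})) (oner_neq0 _) (oner_neq0 _) gm gm' gs gs'.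
  by rewrite !scale1r.
by apply/ffunP => i; apply: val_inj; exact: h.
Qed.

Lemma good_listP D f : f \in good_list D ->
  power_free n f /\ (ramified_points n (im f) <= D.+1)%N.
Proof.
move=> /mapP[g]; rewrite mem_enum inE => /and3P[/forallP gm gs /eqP sD] ef.
have {}ef : f = 1 *: powprod (fun i => (g i : {poly F})) by rewrite scale1r.
have f0 : f != 0 by rewrite ef; exact: (powprod_neq0 (oner_neq0 _) gm).
have us := root_list_uniq f.
have rsP a : root (im (1 *: powprod (fun i => (g i : {poly F})))) a = (a \in root_list f).
  by rewrite -ef; exact: root_listP.
split; first by rewrite ef; exact: (powprod_power_free (oner_neq0 _) gm gs us rsP).
have imf0 : im f != 0 by rewrite map_poly_eq0.
have := ramified_points_le n_prime n_odd char2b imf0 (fun a => root_listP a f0).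
by rewrite (size_roots (oner_neq0 _) gm gs us rsP) sD.
Qed.

Let h := (n.-1./2)%N.

Let n1h : n.-1 = (2 * h)%N.
Proof. by rewrite mul2n -[LHS]odd_double_half; move: n_odd => /= /negbTE ->. Qed.

Let h_gt0 : (0 < h)%N.
Proof. by move: n1h; case: h => // ; rewrite muln0. Qed.

Lemma genusE (f : {poly Fbar}) : genus n f = h%:Z * ((ramified_points n f)%:Z - 2).
Proof.
rewrite /genus; have -> : (n%:Z - 1 : int) = h%:Z * 2.
  by rewrite -PoszM mulnC -n1h /= intS addrC addKr.
by rewrite mulrAC mulzK.
Qed.

Let qR : R := q%:R.
Let qR_gt1 : 1 < qR. Proof. by rewrite /qR ltr1n. Qed.

(** The hypotheses on [X] say that [q^g < X] holds exactly when at most [M] points ramify. From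
    above, the ordinary curves have degree sum at most [M]. From below, monic polynomials of degree
    sum [M - 1] are taken, which leaves room for infinity. *)
Lemma density_bound (M : nat) (X : R) : (0 < M)%N ->
  qR ^ (h%:Z * (M%:Z - 2)) < X -> X <= qR ^ (h%:Z * (M%:Z - 1)) ->
  (N_ordinary iota n X)%:R / (N_all iota n X)%:R
    <= (4 * q ^ 2 * n ^ m.+1)%N%:R / (M.-1 %/ m.+2).+1%:R :> R.
Proof.
move=> M0 ltX leX.
have h0 : 0 < h%:Z :> int by rewrite ltz_nat.
(* For an infinite set [N_all] would be 0, and the quotient 0 by the convention on division. *)
have [fin|inf] := pselect (finite_set (curves_below iota n X)); last first.
  rewrite [N_all _ _ _](_ : _ = 0%N); last first.
    by rewrite /N_all /fset_set; case: pselect => //= _; rewrite cardfs0.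
  by rewrite invr0 mulr0 divr_ge0.
have up : (N_ordinary iota n X <= q * (2 * q ^ M * (n * M.+1 ^ m)))%N.
  apply: leq_trans (size_relation_list M); apply: card_fset_set_le => f [[pf fX] ord].
  apply: ordinary_in_relation_list => //.
  have := lt_le_trans fX leX; rewrite genusE ltr_eXz2l // ltr_pM2l //.
  by move: (ramified_points _ _) => r; lia.
have lo : (q ^ M.-1 * (M.-1 %/ m.+2).+1 ^ m.+1 <= 2 * N_all iota n X)%N.
  apply: leq_trans (size_good_list M.-1) _; rewrite leq_mul2l /=.
  apply: card_fset_set_ge => //; first exact: good_list_uniq.
  move=> f /good_listP[pf rf]; split=> //; apply: le_lt_trans ltX.
  rewrite genusE ler_eXz2l // ler_pM2l //.
  by move: rf; rewrite prednK //; move: (ramified_points _ _) => r; lia.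
move: up lo; set u := (M.-1 %/ m.+2).+1; move: (N_ordinary _ _ _) (N_all _ _ _) => A B up lo.
(* Both counts become powers of the same [u], with exponents [m] and [m.+1]; their quotient leaves
   [1 / u]. *)
have Mu : (M.+1 <= n * u)%N.
  have : (M.-1 < m.+2 * u)%N.
    by rewrite /u mulnC {1}(divn_eq M.-1 m.+2) mulSn addnC ltn_add2r ltn_pmod.
  by rewrite mulSn; move: M0; rewrite /u; move: (_ %/ _)%N => v; lia.
have AuB : (A * u <= 4 * q ^ 2 * n ^ m.+1 * B)%N.
  apply: (@leq_trans (q * (2 * q ^ M * (n * (n * u) ^ m)) * u)%N).
    rewrite leq_mul2r; apply/orP; right; apply: leq_trans up _.
    have exp2r a b e : (a <= b)%N -> (a ^ e <= b ^ e)%N.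
      by move=> ab; elim: e => // e IH; rewrite !expnS leq_mul.
    by rewrite !leq_mul2l exp2r ?orbT.
  apply: (@leq_trans (2 * q ^ 2 * n ^ m.+1 * (q ^ M.-1 * u ^ m.+1))%N); last first.
    have -> : (4 * q ^ 2 * n ^ m.+1 * B = 2 * q ^ 2 * n ^ m.+1 * (2 * B))%N by ring.
    by rewrite leq_mul2l lo orbT.
  rewrite -[M in (q ^ M)%N](prednK M0) !expnS expnMn.
  by rewrite leq_eqVlt; apply/orP; left; apply/eqP; ring.
have [->|B0] := posnP B; first by rewrite invr0 mulr0 divr_ge0.
rewrite ler_pdivrMr ?ltr0n // mulrAC ler_pdivlMr ?ltr0n //.
by rewrite -!natrM ler_nat.
Qed.

Lemma ordinary_density_zero :
  (N_ordinary iota n (X : R))%:R / (N_all iota n X)%:R @[X --> +oo] --> (0 : R).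
Proof.
apply/cvgrPdist_lt => eps eps_gt0.
pose C : R := (4 * q ^ 2 * n ^ m.+1)%N%:R.
have C0 : 0 <= C by exact: ler0n.
(* [u0] is such that [C < eps * u0], and [M0] such that every [M >= M0] has
   [(M - 1) %/ m.+2 >= u0]. *)
pose u0 := Num.bound (C / eps); pose M0 := (m.+2 * u0).+2.
have hu0 : C / eps < u0%:R.
  by have := archi_boundP (divr_ge0 C0 (ltW eps_gt0)).
exists (qR ^ (h%:Z * (M0%:Z - 2))); split; first exact: num_real.
move=> X ltX /=; rewrite sub0r normrN.
have ex : exists M, (M0 <= M)%N && (X <= qR ^ (h%:Z * (M%:Z - 1))).
  have [b hb] : exists b : nat, `|X| < b%:R.
    by exists (Num.bound `|X|); exact: archi_boundP.
  exists (maxn M0 b.+1); rewrite leq_maxl /=.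
  apply: (@le_trans _ _ b%:R); first by rewrite (le_trans (ler_norm X)) // ltW.
  apply: (@le_trans _ _ (qR ^+ b)).
    by rewrite /qR -natrX ler_nat ltnW // ltn_expl.
  rewrite exprnP ler_eXz2l //.
  have := leq_maxr M0 b.+1; move: (maxn _ _) => a ab.
  by have := h_gt0; move: h ab; clear => h' ab h'0; nia.
(* The least [M] places [X] between consecutive values of [q^g]: the lower inequality comes from
   minimality, or from the choice of the threshold when [M = M0]. *)
have [M /andP[M0M leX] minM] := ex_minnP ex.
have M_gt0 : (0 < M)%N by rewrite (leq_trans _ M0M).
have ltM : qR ^ (h%:Z * (M%:Z - 2)) < X.
  have [e|ne] := eqVneq M M0; first by rewrite e.
  rewrite ltNge; apply/negP => le.
  have := minM M.-1; rewrite -ltnS (prednK M_gt0) ltn_neqAle eq_sym ne M0M /=.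
  have -> : M.-1%:Z - 1 = M%:Z - 2.
    by rewrite -{2}(prednK M_gt0) intS opprD addrACA subrr add0r.
  by rewrite le => /(_ isT); rewrite leqNgt ltn_predL M_gt0.
have := density_bound M_gt0 ltM leX => bd.
rewrite ger0_norm ?divr_ge0 //; apply: le_lt_trans bd _.
rewrite ltr_pdivrMr ?ltr0n // mulrC -ltr_pdivrMr //; apply: lt_trans hu0 _.
rewrite ltr_nat ltnS leq_divRL //.
by rewrite mulnC -ltnS (prednK M_gt0) (leq_trans _ M0M) // /M0 leqnSn.
Qed.

End Density.

Theorem mainTheorem6 (n : nat) (n_prime : prime n) (n_odd : odd n) :
  exists q0 : nat,
    forall (F : finFieldType) (Fbar : closedFieldType)
           (iota : {rmorphism F -> Fbar}) (R : realType),
      2%N \in [pchar F] -> (q0 <= #|F|)%N -> integralRange iota ->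
      (N_ordinary iota n (X : R))%:R / (N_all iota n X)%:R @[X --> +oo] --> (0 : R).
Proof.
case: n n_prime n_odd => [|[|[|m]]] // n_prime n_odd.
(* As [n = m.+3], this asks for [2 (n - 1)^2 < q], the hypothesis of the count of separable tuples
   with [n - 1] factors. *)
exists (2 * m.+2 ^ 2).+1 => F Fbar iota R char2 q_large _.
exact: ordinary_density_zero.
Qed.
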